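(* Let $d\geq0$, $n\geq1$, and let $\eta$ be a multiset of $n+1$ non-negative integers. (i) $\mathbb{Q}[x_1,\ldots,x_{n+1}]_d$ is the direct sum of the three spaces $\operatorname{Ext}\,\mathbb{Q}[x_1,\ldots,x_n]_d$, $\operatorname{LE}\,\mathbb{Q}[x_1,\ldots,x_n]_{d-n}$ and $e_{n+1}\mathbb{Q}[x_1,\ldots,x_{n+1}]_{d-n-1}$. (ii) Suppose $0\in\eta$, and let $\eta\setminus\{0\}$ be $\eta$ with one copy of $0$ removed. Then the intersection of $\mathbb{Q}[x_1,\ldots,x_{n+1}]_\eta$ with the first summand of (i) is $\operatorname{Ext}\,\mathbb{Q}[x_1,\ldots,x_n]_{\eta\setminus\{0\}}$. If $\eta$ contains $0$ more than once, this is all of $\mathbb{Q}[x_1,\ldots,x_{n+1}]_\eta$. (iii) Suppose $0\in\eta$ and all entries of $\eta\setminus\{0\}$ are positive, and let $\mu$ be the multiset of $n$ integers obtained by subtracting $1$ from each element of $\eta\setminus\{0\}$. Then the second summand of (i) intersects $\mathbb{Q}[x_1,\ldots,x_{n+1}]_\eta$ in $\operatorname{LE}\,\mathbb{Q}[x_1,\ldots,x_n]_\mu$. (iv) Suppose all elements of $\eta$ are positive, and let $\mu$ be obtained by subtracting $1$ from each entry, a multiset of $n+1$ integers. Then the third summand of (i) intersects $\mathbb{Q}[x_1,\ldots,x_{n+1}]_\eta$ in $e_{n+1}\mathbb{Q}[x_1,\ldots,x_{n+1}]_\mu$.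
   Context: $S_m$ acts on $\mathbb{Q}[x_1,\ldots,x_m]$ by permuting variables. $\mathbb{Q}[x_1,\ldots,x_m]_d$ is the degree-$d$ homogeneous part, and it is $0$ if $d<0$. For a multiset $\mu$ of $m$ non-negative integers, $\mathbb{Q}[x_1,\ldots,x_m]_\mu$ is the span of the monomials whose multiset of exponents of $x_1,\ldots,x_m$ is $\mu$. $e_{n+1}=x_1\cdots x_{n+1}$. Tableaux: $\operatorname{SSYT}(\lambda)$ is the set of semistandard fillings of $\lambda$ by non-negative integers (rows weakly increasing, columns strictly increasing). $\operatorname{SSYT}_d(\lambda)$ and $\operatorname{SSYT}_\mu(\lambda)$ are those with entry sum $d$, respectively content (multiset of entries) $\mu$. Specht polynomials: for $T$ a filling of $\lambda\vdash m$ by $1,\ldots,m$, $\varepsilon_T=\sum_{\sigma\in C(T)}\sum_{\tau\in R(T)}\operatorname{sgn}(\sigma)\sigma\tau$ (column and row stabilizers). $p_{M,T}=\prod x_i^{h_i}$, where $h_i$ is the entry of $M$ in the box of $T$ containing $i$; $s_{M,T}$ is the order of the stabilizer of $p_{M,T}$ in $R(T)$; $F_{M,T}=\varepsilon_Tp_{M,T}/s_{M,T}$; and $V_M$ is the span of all $F_{M,T}$. It is known that $\mathbb{Q}[x_1,\ldots,x_m]_d=\bigoplus_{\lambda\vdash m}\bigoplus_{M\in\operatorname{SSYT}_d(\lambda)}V_M$. The operations $M\hat+v$: for $\lambda\vdash n$ and $M\in\operatorname{SSYT}(\lambda)$, - let $S\in\operatorname{SYT}(\lambda)$ be the standardization of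 $M$; - let $J(M)$ be the multiset $\{j_1,\ldots,j_m\}$, where $m$ is the maximal entry of $M$ and $j_h$ is the number of entries of $M$ smaller than $h$; - for a multiset $J$ and a standard tableau $S'$, let $\operatorname{ct}_J(S')$ put into the box of $S'$ containing $p$ the number of elements of $J$ (with multiplicity) smaller than $p$; - let $\operatorname{ev}$ be Schützenberger evacuation; - $\operatorname{EC}(\lambda)$ is the set of boxes outside $\lambda$ whose addition gives a partition $\lambda+v$; - for $v\in\operatorname{EC}(\lambda)$, let $\operatorname{ev}S+v$ be $\operatorname{ev}S$ with $v$ added and filled with $n+1$, and $S\tilde+v=\operatorname{ev}(\operatorname{ev}S+v)$; - $\delta_{M,v}=0$ if $v$ lies in a row strictly below the row containing $n$ in $\operatorname{ev}S$, and $\delta_{M,v}=1$ otherwise; - with $J_+=\{j+1:j\in J(M)\}$, set $M\hat+v=\operatorname{ct}_{J_+}(S\tilde+v)$ if $\delta_{M,v}=1$, and $M\hat+v=\operatorname{ct}_{J_+\cup\{1\}}(S\tilde+v)$ (multiset union) if $\delta_{M,v}=0$. Extension and lower enlargement: - $\operatorname{Ext}V_M=\bigoplus_{v\in\operatorname{EC}(\lambda),\,\delta_{M,v}=1}V_{M\hat+v}$ and $\operatorname{LE}V_M=\bigoplus_{v\in\operatorname{EC}(\lambda),\,\delta_{M,v}=0}V_{M\hat+v}$; these are subspaces of $\mathbb{Q}[x_1,\ldots,x_{n+1}]$. - $\operatorname{Ext}\,\mathbb{Q}[x_1,\ldots,x_n]_d=\bigoplus_{\lambda\vdash n}\bigoplus_{M\in\operatorname{SSYT}_d(\lambda)}\operatorname{Ext}V_M$,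 and similarly for $\operatorname{LE}$ and for the spaces with index a content $\mu$ (summing over $\operatorname{SSYT}_\mu(\lambda)$).
   Formalization: In (ii)-(iv), d is assumed to equal the sum of the entries of η; for any other d the intersections with the summands of (i) are 0 while the right-hand sides are nonzero. *)

(* Defs.v *)
From mathcomp Require Import all_boot all_order all_fingroup all_algebra.
From mathcomp.multinomials Require Import mpoly.

Set Implicit Arguments.
Unset Strict Implicit.
Unset Printing Implicit Defensive.

Import GRing.Theory.

Local Open Scope ring_scope.

(* {mpoly rat[m]} is infinite-dimensional, so that {vspace _} is unavailable;
   a subspace is represented by its (Prop-valued) membership predicate. *)
Definition subspace (m : nat) := {mpoly rat[m]} -> Prop.

Definition span m (G : {mpoly rat[m]} -> Prop) : subspace m := fun p =>
  exists (k : nat) (c : 'I_k -> rat) (g : 'I_k -> {mpoly rat[m]}),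
    (forall i, G (g i)) /\ p = \sum_(i < k) c i *: g i.

(* The sum of the W i, for i in the possibly infinite set A. *)
Definition sum_of m (I : eqType) (A : pred I) (W : I -> subspace m) :
    subspace m := fun p =>
  exists (s : seq I) (f : I -> {mpoly rat[m]}),
    [/\ uniq s, {subset s <= A}, forall i, i \in s -> W i (f i)
      & p = \sum_(i <- s) f i].

Definition direct m (I : eqType) (A : pred I) (W : I -> subspace m) : Prop :=
  forall (s : seq I) (f : I -> {mpoly rat[m]}),
    uniq s -> {subset s <= A} -> (forall i, i \in s -> W i (f i)) ->
    \sum_(i <- s) f i = 0 -> forall i, i \in s -> f i = 0.

Definition direct_sum3 m (U A B C : subspace m) : Prop :=
  (forall p, U p <-> exists a b c, [/\ A a, B b, C c & p = a + b + c]) /\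
  (forall a b c, A a -> B b -> C c -> a + b + c = 0 ->
     [/\ a = 0, b = 0 & c = 0]).

(* Degrees are integers, so that d - n may be negative. *)
Definition pol_deg m (d : int) : subspace m := fun p =>
  match d with
  | Posz k => p \is k.-homog
  | Negz _ => p = 0
  end.
Arguments pol_deg : clear implicits.

(* Multisets of natural numbers are sequences, used only up to perm_eq. *)
Definition pol_cont m (mu : seq nat) : subspace m :=
  span (fun q => exists a : 'X_{1..m}, perm_eq a mu /\ q = 'X_[a]).
Arguments pol_cont : clear implicits.

Definition e_top m : {mpoly rat[m]} := \prod_(i < m) 'X_i.

Definition mul_by m (e : {mpoly rat[m]}) (U : subspace m) : subspace m :=
  fun p => exists q, U q /\ p = e * q.

Local Open Scope nat_scope.

Definition is_part (lam : seq nat) := sorted geq lam && (0 \notin lam).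

Definition is_part_of (n : nat) (lam : seq nat) :=
  is_part lam && (sumn lam == n).

(* The box (i, j) lies in row i and column j, both counted from 0. *)
Definition box : Type := (nat * nat)%type.

Definition boxes (lam : seq nat) : seq box :=
  [seq (i, j) | i <- iota 0 (size lam), j <- iota 0 (nth 0 lam i)].

(* A filling is the list of its rows, so that its shape is seq.shape. *)
Definition tableau : Type := seq (seq nat).

Definition entry (M : tableau) (b : box) : nat := nth 0 (nth [::] M b.1) b.2.

Definition set_entry (M : tableau) (b : box) (e : nat) : tableau :=
  set_nth [::] M b.1 (set_nth 0 (nth [::] M b.1) b.2 e).

Definition fill (lam : seq nat) (f : box -> nat) : tableau :=
  [seq [seq f (i, j) | j <- iota 0 (nth 0 lam i)] | i <- iota 0 (size lam)].

Definition row_of (A : eqType) (T : seq (seq A)) (x : A) : nat :=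
  find (fun r => x \in r) T.

Definition col_of (A : eqType) (T : seq (seq A)) (x : A) : nat :=
  index x (nth [::] T (row_of T x)).

Definition box_of (A : eqType) (T : seq (seq A)) (x : A) : box :=
  (row_of T x, col_of T x).

Definition SSYT (lam : seq nat) : pred tableau := fun M =>
  [&& shape M == lam, all (sorted leq) M
    & all (fun b => (0 < b.1) ==> (entry M (b.1.-1, b.2) < entry M b))
          (boxes lam)].

Definition SSYT_deg (lam : seq nat) (d : int) : pred tableau := fun M =>
  SSYT lam M && ((sumn (flatten M))%:Z == d).

Definition SSYT_cont (lam : seq nat) (mu : seq nat) : pred tableau := fun M =>
  SSYT lam M && perm_eq (flatten M) mu.

(* Equal entries are standardized from left to right. *)
Definition standardize (M : tableau) : tableau :=
  fill (shape M) (fun b =>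
    (count (fun c => (entry M c < entry M b)
                  || (entry M c == entry M b) && (c.2 < b.2))
           (boxes (shape M))).+1).

Definition J_of (M : tableau) : seq nat :=
  [seq count (fun e => e < h) (flatten M)
     | h <- iota 1 (\max_(e <- flatten M) e)].

Definition ct (J : seq nat) (S : tableau) : tableau :=
  [seq [seq count (fun j => j < p) J | p <- r] | r <- S].

(* A jeu de taquin slide of positive entries, the value 0 marking the boxes
   which are not (or no longer) there: starting with the hole in b, the smaller
   of the entries right of the hole and below it moves into the hole, until both
   are missing. The result is the new filling with the vacated box. The first
   argument bounds the number of moves. *)
Fixpoint slide (k : nat) (T : tableau) (b : box) : tableau * box :=
  let r := entry T (b.1, b.2.+1) in
  let u := entry T (b.1.+1, b.2) in
  if k isn't k'.+1 then (set_entry T b 0, b)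
  else if (r == 0) && (u == 0) then (set_entry T b 0, b)
  else if (u == 0) || (r != 0) && (r < u)
  then slide k' (set_entry T b r) (b.1, b.2.+1)
  else slide k' (set_entry T b u) (b.1.+1, b.2).

(* The smallest remaining entry of T is in the corner (0, 0). It is removed,
   the others slide, and the vacated box gets k in the result U. *)
Fixpoint evac_rec (k : nat) (T U : tableau) : tableau :=
  if k is k'.+1 then
    let: (T', b) := slide (size (flatten T)) T (0, 0) in
    evac_rec k' T' (set_entry U b k)
  else U.

Definition ev (S : tableau) : tableau := evac_rec (size (flatten S)) S S.

(* The only box of row i outside lam that can give a partition is (i, lam_i). *)
Definition EC (lam : seq nat) : pred box := fun v =>
  (v.2 == nth 0 lam v.1) && is_part (incr_nth lam v.1).

Definition add_box (S : tableau) (v : box) : tableau :=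
  set_entry S v (size (flatten S)).+1.

Definition tilde_add (S : tableau) (v : box) : tableau :=
  ev (add_box (ev S) v).

(* delta M v stands for delta_{M,v} = 1. *)
Definition delta (M : tableau) (v : box) : bool :=
  v.1 <= row_of (ev (standardize M)) (size (flatten M)).

Definition hat_add (M : tableau) (v : box) : tableau :=
  let Jplus := [seq j.+1 | j <- J_of M] in
  ct (if delta M v then Jplus else 1 :: Jplus)
     (tilde_add (standardize M) v).

Local Open Scope ring_scope.

(* The numbers 1, ..., m are represented by the elements of 'I_m. *)
Definition is_filling m (lam : seq nat) (T : seq (seq 'I_m)) : bool :=
  (shape T == lam) && perm_eq (flatten T) (enum 'I_m).

Definition row_stab m (T : seq (seq 'I_m)) : {set 'S_m} :=
  [set t : 'S_m | [forall i, row_of T (t i) == row_of T i]].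

Definition col_stab m (T : seq (seq 'I_m)) : {set 'S_m} :=
  [set s : 'S_m | [forall i, col_of T (s i) == col_of T i]].

(* msym s maps 'X_i to 'X_(s i); the product sigma tau applies tau first. *)
Definition epsilon m (T : seq (seq 'I_m)) (p : {mpoly rat[m]}) :
    {mpoly rat[m]} :=
  \sum_(s in col_stab T) \sum_(t in row_stab T)
     (-1) ^+ s *: msym s (msym t p).

Definition p_mon m (M : tableau) (T : seq (seq 'I_m)) : {mpoly rat[m]} :=
  \prod_(i < m) 'X_i ^+ entry M (box_of T i).

Definition s_num m (M : tableau) (T : seq (seq 'I_m)) : nat :=
  #|[set t in row_stab T | msym t (p_mon M T) == p_mon M T]|.

Definition F_pol m (M : tableau) (T : seq (seq 'I_m)) : {mpoly rat[m]} :=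
  (s_num M T)%:R^-1 *: epsilon T (p_mon M T).

(* Meaningful when M has m boxes. *)
Definition V m (M : tableau) : subspace m :=
  span (fun q => exists T : seq (seq 'I_m),
          is_filling (shape M) T /\ q = F_pol M T).
Arguments V : clear implicits.

Definition EC_delta (M : tableau) (del : bool) : pred box := fun v =>
  EC (shape M) v && (delta M v == del).

Definition enlarge n (del : bool) (M : tableau) : subspace n.+1 :=
  sum_of (EC_delta M del) (fun v => V n.+1 (hat_add M v)).
Arguments enlarge : clear implicits.

Definition ExtV n (M : tableau) : subspace n.+1 := enlarge n true M.
Arguments ExtV : clear implicits.
Definition LEV n (M : tableau) : subspace n.+1 := enlarge n false M.
Arguments LEV : clear implicits.

(* The double sum over lam |- n and M in SSYT(lam) is a sum over M alone, since
   M determines lam. *)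
Definition all_SSYT_deg n (d : int) : pred tableau := fun M =>
  is_part_of n (shape M) && SSYT_deg (shape M) d M.

Definition all_SSYT_cont n (mu : seq nat) : pred tableau := fun M =>
  is_part_of n (shape M) && SSYT_cont (shape M) mu M.

Definition Ext_deg n (d : int) : subspace n.+1 :=
  sum_of (all_SSYT_deg n d) (ExtV n).
Arguments Ext_deg : clear implicits.
Definition LE_deg n (d : int) : subspace n.+1 :=
  sum_of (all_SSYT_deg n d) (LEV n).
Arguments LE_deg : clear implicits.
Definition Ext_cont n (mu : seq nat) : subspace n.+1 :=
  sum_of (all_SSYT_cont n mu) (ExtV n).
Arguments Ext_cont : clear implicits.
Definition LE_cont n (mu : seq nat) : subspace n.+1 :=
  sum_of (all_SSYT_cont n mu) (LEV n).
Arguments LE_cont : clear implicits.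

(* The sums defining Ext and LE (inner sums over the boxes v, outer sum over the
   tableaux M in A) are direct. *)
Definition direct_enlarge n (del : bool) (A : pred tableau) : Prop :=
  (forall M, A M -> direct (EC_delta M del) (fun v => V n.+1 (hat_add M v))) /\
  direct A (enlarge n del).

(* Main.v *)
(* Evacuation.  A standard tableau is recorded by the word of its boxes, in the
   order of their entries.  A jeu de taquin slide passes the first box through
   the word: the hole trades places with every following box that is adjacent
   to it.  This is a sequence of moves on pairs of consecutive letters, hence
   reversible, and on three consecutive letters such a move transfers a descent
   from one pair to the other.  So evacuation is bijective and reverses the
   descent set.  A semistandard tableau is a standard word labelled by a weakly
   increasing sequence which increases strictly at the descents; M +^ v has the
   labels of M (raised by 1 if delta = 0) preceded by a 0, and its first step is
   a descent exactly when delta = 0.  Therefore (M, v) |-> M +^ v is a bijection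
   onto the semistandard tableaux containing a 0, and delta can be read off from
   M +^ v.

   Specht decomposition.  The sum of the V_M is direct: by von Neumann's lemma
   epsilon_T maps V_M into the line of F_{M,T}, or to 0 if the shapes differ; the
   F_{M,T} with T fixed are linearly independent by unitriangularity; and an
   element of V_M killed by all epsilon_T is 0, by positivity of the standard
   scalar product.  To see that the V_M span, let g be orthogonal to all F_{M,T}.
   By induction on the sum of the column indices, every column antisymmetrizer c
   kills g: moving a variable to an earlier column gives an antisymmetrizer
   that kills g, so f = c g satisfies exchange relations between columns.  These
   force a monomial of maximal weight in f to be semistandard, so f is a linear
   combination of the F_{M,T}, and orthogonal to itself.

   The tableaux without 0 span the multiples of x_1 ... x_(n+1). *)

Require Import Defs.
From HB Require Import structures.
From mathcomp Require Import all_boot all_order all_fingroup all_algebra zify.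
From mathcomp.multinomials Require Import mpoly.

Set Implicit Arguments.
Unset Strict Implicit.
Unset Printing Implicit Defensive.

Local Open Scope nat_scope.

(** * Evacuation on words of boxes *)

Definition below (x y : box) := x.1 < y.1.

Definition adj (h p : box) := (p == (h.1, h.2.+1)) || (p == (h.1.+1, h.2)).

Definition addable (a : seq box) (b : box) :=
  [&& b \notin a, (b.2 == 0) || ((b.1, b.2.-1) \in a)
    & (b.1 == 0) || ((b.1.-1, b.2) \in a)].

Fixpoint std_after (a w : seq box) :=
  if w is b :: w' then addable a b && std_after (b :: a) w' else true.

Definition std := std_after [::].

Definition ideal (a : seq box) :=
  forall b i j, b \in a -> i <= b.1 -> j <= b.2 -> (i, j) \in a.

Fixpoint pass (h : box) (s : seq box) : seq box * box :=
  if s is p :: s' then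
    if adj h p then (h :: (pass p s').1, (pass p s').2)
    else (p :: (pass h s').1, (pass h s').2)
  else ([::], h).

Lemma addable_eq (a a' : seq box) b : a =i a' -> addable a b = addable a' b.
Proof. by move=> e; rewrite /addable !e. Qed.

Lemma std_after_eq (a a' w : seq box) : a =i a' -> std_after a w = std_after a' w.
Proof.
elim: w a a' => //= b w IH a a' e; rewrite (addable_eq _ e).
by congr (_ && _); apply: IH => x; rewrite !inE e.
Qed.

Lemma std_after_cat (a w1 w2 : seq box) :
  std_after a (w1 ++ w2) = std_after a w1 && std_after (w1 ++ a) w2.
Proof.
elim: w1 a => //= b w IH a; rewrite IH -andbA; do 2!congr (_ && _).
by apply: std_after_eq => x; rewrite !(inE, mem_cat); case: (x == b); rewrite ?orbT.
Qed.

Lemma std_after_rcons (a w : seq box) v :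
  std_after a (rcons w v) = std_after a w && addable (w ++ a) v.
Proof. by rewrite -cats1 std_after_cat /= andbT. Qed.

Lemma std_rcons (w : seq box) v : std (rcons w v) = std w && addable w v.
Proof. by rewrite /std std_after_rcons cats0. Qed.

Lemma ideal0 : ideal [::]. Proof. by []. Qed.

Lemma ideal_cons (a : seq box) b : ideal a -> addable a b -> ideal (b :: a).
Proof.
move=> Ia /and3P[nb hl hu] c i j; rewrite inE => /orP[/eqP->|ca] hi hj; last first.
  by rewrite inE (Ia _ _ _ ca hi hj) orbT.
rewrite inE; have [//|ne] := eqVneq (i, j) b.
case: b nb hl hu hi hj ne => b1 b2 /= nb hl hu hi hj ne.
have [lt|ge] := ltnP j b2.
  have hl' : (b1, b2.-1) \in a by case/orP: hl => // /eqP h; lia.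
  by rewrite (Ia _ _ _ hl') //=; lia.
have lt : i < b1.
  by rewrite ltn_neqAle hi andbT; apply: contraNneq ne => ->; apply/eqP; congr pair; lia.
have hu' : (b1.-1, b2) \in a by case/orP: hu => // /eqP h; lia.
by rewrite (Ia _ _ _ hu') //=; lia.
Qed.

Lemma ideal_std_after (a w : seq box) : ideal a -> std_after a w -> ideal (w ++ a).
Proof.
elim: w a => //= b w IH a Ia /andP[hb hw].
have h := IH _ (ideal_cons Ia hb) hw.
have e : w ++ b :: a =i b :: w ++ a.
  by move=> x; rewrite !(inE, mem_cat); case: (x == b); rewrite ?orbT.
by move=> c i j; rewrite -!e; apply: h.
Qed.

Lemma std_ideal (w : seq box) : std w -> ideal w.
Proof. by move=> h; rewrite -[w]cats0; apply: ideal_std_after. Qed.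

Lemma addable_nle (a : seq box) b c :
  ideal a -> addable a b -> c \in a -> ~~ ((b.1 <= c.1) && (b.2 <= c.2)).
Proof.
move=> Ia /and3P[nb _ _] ca; apply: contra nb => /andP[h1 h2].
by rewrite [b]surjective_pairing; apply: Ia ca _ _.
Qed.

Lemma std_after_swap (a b : seq box) x y :
  std_after a [:: x, y & b] -> ~~ adj x y -> std_after a [:: y, x & b].
Proof.
move=> /= /and3P[hx hy hb] nxy.
have e : x :: y :: a =i y :: x :: a.
  by move=> z; rewrite !inE; case: (z == x); rewrite ?orbT.
rewrite (std_after_eq _ e) hb andbT.
case/and3P: hx => nx x1 x2; case/and3P: hy; rewrite !inE negb_or => /andP[nyx ny] y1 y2.
apply/andP; split; apply/and3P; split => //.
- case/orP: y1 => [->//|/orP[/eqP ex|->]]; last by rewrite orbT.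
  have [//|y0] := eqVneq y.2 0; case/negP: nxy; apply/orP; left.
  by rewrite -ex /= prednK ?lt0n // -surjective_pairing.
- case/orP: y2 => [->//|/orP[/eqP ex|->]]; last by rewrite orbT.
  have [//|y0] := eqVneq y.1 0; case/negP: nxy; apply/orP; right.
  by rewrite -ex /= prednK ?lt0n // -surjective_pairing.
- by rewrite inE negb_or eq_sym nyx.
- by rewrite inE orbCA x1 orbT.
by rewrite inE orbCA x2 orbT.
Qed.

Lemma addable_incomparable (a : seq box) x y : ideal a ->
  addable a x -> addable (x :: a) y -> ~~ adj x y ->
  (x.1 < y.1) && (y.2 < x.2) || (y.1 < x.1) && (x.2 < y.2).
Proof.
move=> Ia hx hy nxy; have /and3P[hy' hx' _] : std_after a [:: y; x].
  by apply: std_after_swap; rewrite //= hx hy.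
have := addable_nle (ideal_cons Ia hx) hy (mem_head _ _).
have := addable_nle (ideal_cons Ia hy') hx' (mem_head _ _).
by case: x y {nxy hx hy hy' hx'} => x1 x2 [y1 y2] /=; lia.
Qed.

Lemma adj_adj_below (a : seq box) x y z : ideal a ->
  addable a x -> addable (x :: a) y -> addable (y :: x :: a) z ->
  adj x y -> adj y z -> below x y = below y z.
Proof.
move=> Ia hx hy /and3P[_ l u].
have nx c : c \in a -> ~~ ((x.1 <= c.1) && (x.2 <= c.2)) by apply: addable_nle.
have nq q : q \in y :: x :: a -> q != y -> q != x ->
    ~~ ((x.1 <= q.1) && (x.2 <= q.2)).
  by rewrite !inE => + /negbTE ny /negbTE nx'; rewrite ny nx' => /nx.
move: l u nq; case: x y z {hx hy nx} => x1 x2 [y1 y2] [z1 z2]; rewrite /adj !xpair_eqE /below /=.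
move=> l u nq xy yz; have := nq (z1, z2.-1); have := nq (z1.-1, z2); rewrite !xpair_eqE /=.
case/orP: l => l; case/orP: u => u; rewrite ?l ?u; lia.
Qed.

Definition exch (x y : box) := if adj x y then (x, y) else (y, x).

Lemma below_exch_right (a : seq box) x y z : ideal a ->
  addable a x -> addable (x :: a) y -> addable (y :: x :: a) z ->
  below x y = below (exch x (exch y z).1).2 (exch y z).2.
Proof.
move=> Ia hx hy hz; rewrite /exch; have [yz|yz] := boolP (adj y z).
  have [xy|xy] := boolP (adj x y); first exact: (adj_adj_below Ia hx hy hz xy yz).
  have := addable_incomparable Ia hx hy xy; rewrite /below /=.
  by case/orP: yz => /eqP -> /=; lia.
have := addable_incomparable (ideal_cons Ia hx) hy hz yz; rewrite /below /=.
by case: ifP => //= /orP[]/eqP -> /=; lia.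
Qed.

Lemma below_exch_left (a : seq box) x y z : ideal a ->
  addable a x -> addable (x :: a) y -> addable (y :: x :: a) z ->
  below y z = below (exch x y).1 (exch (exch x y).2 z).1.
Proof.
move=> Ia hx hy hz; rewrite /exch; have [xy|xy] := boolP (adj x y).
  have [yz|yz] := boolP (adj y z).
    exact/esym/(adj_adj_below Ia hx hy hz xy yz).
  have := addable_incomparable (ideal_cons Ia hx) hy hz yz; rewrite /below /=.
  by case/orP: xy => /eqP -> /=; lia.
have := addable_incomparable Ia hx hy xy; rewrite /below /=.
by case: ifP => //= /orP[]/eqP -> /=; lia.
Qed.

Definition des (w : seq box) : seq bool := pairmap below (head (0, 0) w) (behead w).

Fixpoint evac_word_rec (k : nat) (w : seq box) : seq box :=
  if k is k'.+1 then
    if w is h :: s then rcons (evac_word_rec k' (pass h s).1) (pass h s).2 else [::]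
  else [::].

Definition evac_word (w : seq box) := evac_word_rec (size w) w.

Lemma size_pass h s : size (pass h s).1 = size s.
Proof. by elim: s h => //= p s IH h; case: ifP => _ /=; rewrite IH. Qed.

Lemma evac_word_cons h s : evac_word (h :: s) = rcons (evac_word (pass h s).1) (pass h s).2.
Proof. by rewrite /evac_word /= size_pass. Qed.

Lemma size_evac_word w : size (evac_word w) = size w.
Proof.
have [n] := ubnP (size w); elim: n w => // n IH [//|h s] /= lt.
by rewrite evac_word_cons size_rcons IH size_pass.
Qed.

Lemma evac_word_ind (P : seq box -> Prop) :
  P [::] -> (forall h s, P (pass h s).1 -> P (h :: s)) -> forall w, P w.
Proof.
move=> P0 PS w; have [n] := ubnP (size w); elim: n w => // n IH [//|h s] /= lt.
by apply: PS; apply: IH; rewrite size_pass.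
Qed.

Lemma perm_pass h s : perm_eq (rcons (pass h s).1 (pass h s).2) (h :: s).
Proof.
elim: s h => //= p s IH h; case: ifP => _ /=.
  by rewrite perm_cons.
apply: perm_trans (_ : perm_eq [:: p, h & s] _); first by rewrite perm_cons.
by apply/permPl; apply: (perm_catCA [:: p] [:: h] s).
Qed.

Lemma perm_evac_word w : perm_eq (evac_word w) w.
Proof.
elim/evac_word_ind: w => // h s IH; rewrite evac_word_cons -(permPr (perm_pass h s)).
by rewrite perm_rcons perm_sym perm_rcons perm_cons perm_sym.
Qed.

Lemma std_after_pass (a : seq box) h s :
  std_after a (h :: s) -> std_after a (rcons (pass h s).1 (pass h s).2).
Proof.
elim: s a h => //= p s IH a h /and3P[hh hp hs].
case: ifP => [ad|/negbT ad] /=; first by rewrite hh IH //= hp hs.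
have := @std_after_swap a s h p; rewrite /= hh hp hs /= => /(_ isT ad) /and3P[-> h1 h2] /=.
by rewrite IH //= h1 h2.
Qed.

Lemma std_prefix (w1 w2 : seq box) : std (w1 ++ w2) -> std w1.
Proof. by rewrite /std std_after_cat => /andP[]. Qed.

Lemma std_pass h s : std (h :: s) -> std (pass h s).1.
Proof. by move/std_after_pass; rewrite -cats1; apply: std_prefix. Qed.

Lemma std_evac_word w : std w -> std (evac_word w).
Proof.
elim/evac_word_ind: w => // h s IH hw; rewrite evac_word_cons std_rcons IH ?std_pass //=.
rewrite (addable_eq (a' := (pass h s).1)) ?(perm_mem (perm_evac_word _)) //.
  by have := std_after_pass hw; rewrite -/std std_rcons => /andP[].
exact: perm_mem (perm_evac_word _).
Qed.

Lemma pass_cat h s t :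
  pass h (s ++ t) = ((pass h s).1 ++ (pass (pass h s).2 t).1, (pass (pass h s).2 t).2).
Proof.
elim: s h => [|p s IH] h /=; first by case: (pass h t).
by case: ifP => _ /=; rewrite IH.
Qed.

Lemma std_after_uniq (a w : seq box) : std_after a w -> uniq a -> uniq (w ++ a).
Proof.
elim: w a => //= b w IH a /andP[/and3P[nb _ _] h] ua.
have := IH _ h; rewrite /= nb ua => /(_ isT).
by rewrite -cat_rcons cat_uniq rcons_uniq => /and3P[/andP[n1 n2] n3 n4];
  rewrite mem_cat (negbTE nb) orbF n1 cat_uniq n2 n4 (contra _ n3) // => /hasP[x xa xw];
  apply/hasP; exists x; rewrite // mem_rcons inE xw orbT.
Qed.

Lemma std_uniq (w : seq box) : std w -> uniq w.
Proof. by move=> h; have := std_after_uniq h isT; rewrite cats0. Qed.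

Lemma pass_inj h s g t : std (h :: s) -> std (g :: t) -> size s = size t ->
  pass h s = pass g t -> h :: s = g :: t.
Proof.
elim/last_ind: s t => [|s p IH] t; case/lastP: t => [|t q] //; rewrite ?size_rcons //.
  by move=> _ _ _ [->].
move=> hs ht [sz]; rewrite -!cats1 !pass_cat /=.
have hs' : std (h :: s) by apply: (@std_prefix _ [:: p]); rewrite cats1.
have ht' : std (g :: t) by apply: (@std_prefix _ [:: q]); rewrite cats1.
have hp : addable (rcons (pass h s).1 (pass h s).2) p.
  rewrite (addable_eq _ (perm_mem (perm_pass h s))).
  by move: hs; rewrite -rcons_cons std_rcons => /andP[].
have hq : addable (rcons (pass g t).1 (pass g t).2) q.
  rewrite (addable_eq _ (perm_mem (perm_pass g t))).
  by move: ht; rewrite -rcons_cons std_rcons => /andP[].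
have Is : ideal (rcons (pass h s).1 (pass h s).2).
  by apply: std_ideal; apply: std_after_pass.
have It : ideal (rcons (pass g t).1 (pass g t).2).
  by apply: std_ideal; apply: std_after_pass.
have ns := addable_nle Is hp; have nt := addable_nle It hq.
have {}ns := ns (pass h s).2; have {}nt := nt (pass g t).2.
rewrite mem_rcons mem_head in ns; rewrite mem_rcons mem_head in nt.
move: (IH _ hs' ht' sz).
case: (pass h s) (pass g t) ns nt => s' k [t' l] /= ns nt {}IH.
have aux (x y : box) : adj x y -> (x.1 <= y.1) && (x.2 <= y.2).
  by case/orP => /eqP -> /=; rewrite !leqnn ?leqnSn.
move=> E; move: (congr1 fst E) (congr1 snd E) => {E}.
case: ifP => a1; case: ifP => a2 /= /eqP; rewrite !cats1 eqseq_rcons;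
  case/andP=> /eqP e1 /eqP e2 e3; rewrite -!rcons_cons.
- by rewrite e1 e2 in IH; rewrite IH // e3.
- by case/negP: (nt isT); rewrite -e2 -e3; apply: aux.
- by case/negP: (ns isT); rewrite e2 e3; apply: aux.
by rewrite e1 e3 in IH; rewrite IH // e2.
Qed.

Lemma evac_word_inj w t : std w -> std t -> evac_word w = evac_word t -> w = t.
Proof.
elim/evac_word_ind: w t => [|h s IH] [|g t] //.
- by move=> _ _ /(congr1 size); rewrite !size_evac_word.
- by move=> _ _ /(congr1 size); rewrite !size_evac_word.
move=> hs ht e; have sz : size s = size t.
  by move/(congr1 size): e; rewrite !size_evac_word => - [].
move: e; rewrite !evac_word_cons => /eqP; rewrite eqseq_rcons => /andP[/eqP e1 /eqP e2].
apply: pass_inj => //; rewrite [LHS]surjective_pairing [RHS]surjective_pairing e2.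
by rewrite (IH _ (std_pass hs) (std_pass ht) e1).
Qed.

Lemma evac_word_surj w : std w -> exists2 t, std t & evac_word t = w.
Proof.
move=> hw; pose L := [seq t <- permutations w | std t].
have uL : uniq L by rewrite filter_uniq // permutations_uniq.
have mL t : t \in L = perm_eq t w && std t.
  by rewrite mem_filter mem_permutations andbC.
have uE : uniq (map evac_word L).
  rewrite map_inj_in_uniq // => t u; rewrite !mL => /andP[_ ht] /andP[_ hu].
  exact: evac_word_inj.
have sE : {subset map evac_word L <= L}.
  move=> _ /mapP[t + ->]; rewrite !mL => /andP[pt ht]; rewrite std_evac_word // andbT.
  exact: perm_trans (perm_evac_word t) pt.
have [|_ e] := uniq_min_size uE sE; first by rewrite size_map.
have : w \in map evac_word L by rewrite e mL perm_refl.
by case/mapP => t; rewrite mL => /andP[_ ht] ->; exists t.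
Qed.

Lemma des_cons x y s : des [:: x, y & s] = below x y :: des (y :: s).
Proof. by []. Qed.

Lemma des_rcons w v : 0 < size w ->
  des (rcons w v) = rcons (des w) (below (last (0, 0) w) v).
Proof. by case: w => // x s _; rewrite /des /= -cats1 pairmap_cat /= cats1. Qed.

Lemma nth_des w i : i.+1 < size w ->
  nth false (des w) i = below (nth (0, 0) w i) (nth (0, 0) w i.+1).
Proof. by case: w => // x s lt; rewrite (nth_pairmap (0, 0)). Qed.

Lemma pass_cons h p s : pass h (p :: s) =
  ((exch h p).1 :: (pass (exch h p).2 s).1, (pass (exch h p).2 s).2).
Proof. by rewrite /= /exch; case: ifP. Qed.

Lemma std_after_exch (a : seq box) x y s : std_after a [:: x, y & s] ->
  std_after a [:: (exch x y).1, (exch x y).2 & s].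
Proof. by rewrite /exch; case: ifP => // /negbT n h; apply: std_after_swap. Qed.

Lemma des_pass (a : seq box) h s : ideal a -> std_after a (h :: s) -> des (pass h s).1 = des s.
Proof.
elim: s a h => // y [|z s] IH a h Ia hs.
  by rewrite pass_cons.
case/and4P: (hs) => hh hy hz hs'.
have e := below_exch_left Ia hh hy hz.
case/andP: (std_after_exch hs) => h1 h2.
have := IH _ _ (ideal_cons Ia h1) h2.
by rewrite (pass_cons h) (pass_cons _ z) !des_cons e => <-.
Qed.

Lemma below_pass2 (a : seq box) x y u : ideal a -> std_after a [:: x, y & u] ->
  below x y = below (pass x (pass y u).1).2 (pass y u).2.
Proof.
elim: u a x y => // z u IH a x y Ia hs.
case/and4P: (hs) => hx hy hz hu.
rewrite (below_exch_right Ia hx hy hz).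
have -> : (pass y (z :: u)).1 = (exch y z).1 :: (pass (exch y z).2 u).1.
  by rewrite pass_cons.
have -> : (pass y (z :: u)).2 = (pass (exch y z).2 u).2 by rewrite pass_cons.
rewrite pass_cons [RHS]/=.
have h1 : std_after a [:: x, (exch y z).1, (exch y z).2 & u].
  by case/andP: hs => _ hs'; apply/andP; split; last exact: std_after_exch.
case/andP: (std_after_exch h1) => h2 h3.
exact: IH (ideal_cons Ia h2) h3.
Qed.

Lemma std_head h s : std (h :: s) -> h = (0, 0).
Proof.
by case: h => h1 h2 /andP[/and3P[_]]; rewrite !in_nil !orbF /= => /eqP-> /eqP->.
Qed.

Lemma des_evac_word w : std w -> des (evac_word w) = rev (des w).
Proof.
elim/evac_word_ind: w => // h s IH hs; rewrite evac_word_cons.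
case: s IH hs => [//|y u] IH hs.
have e0 : adj h y.
  have eh := std_head hs; rewrite eh in hs *; case/and3P: hs => _ + _; case: y {IH} => y1 y2.
  by rewrite /adj /addable !inE !xpair_eqE /=; lia.
move: (IH (std_pass hs)); rewrite (@des_pass [::] h (y :: u)) // => {IH}.
rewrite pass_cons /exch e0 /= evac_word_cons => IH.
rewrite des_rcons ?size_rcons // IH last_rcons -(@below_pass2 [::] h y u) //.
by rewrite des_cons rev_cons.
Qed.

(** * Tableaux as words of boxes *)

Lemma mem_boxes lam (b : box) : (b \in boxes lam) = (b.2 < nth 0 lam b.1).
Proof.
apply/allpairsPdep/idP => [[i [j [hi hj ->]]] /=|lt].
  by move: hj; rewrite mem_iota.
exists b.1, b.2; split; last exact: surjective_pairing.
  by rewrite mem_iota add0n /=; apply: contraLR lt; rewrite -!leqNgt => h; rewrite nth_default.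
by rewrite mem_iota.
Qed.

Lemma boxes_uniq lam : uniq (boxes lam).
Proof.
apply: allpairs_uniq_dep; first exact: iota_uniq.
  by move=> i _; apply: iota_uniq.
by move=> [i j] [k l] _ _ /= [-> ->].
Qed.

Lemma nth_shape (A : Type) (T : seq (seq A)) i : nth 0 (shape T) i = size (nth [::] T i).
Proof.
have [lt|ge] := ltnP i (size T); first by rewrite (nth_map [::]).
by rewrite !nth_default // size_map.
Qed.

Lemma flatten_fill lam f : flatten (fill lam f) = map f (boxes lam).
Proof.
rewrite /boxes /fill map_flatten -map_comp; congr flatten; apply: eq_map => i /=.
by rewrite -map_comp.
Qed.

Lemma shape_fill lam f : shape (fill lam f) = lam.
Proof.
apply: (@eq_from_nth _ 0); first by rewrite !size_map size_iota.
move=> i; rewrite !size_map size_iota => lt.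
by rewrite nth_shape (nth_map 0) ?size_iota // nth_iota // size_map size_iota.
Qed.

Lemma entry_fill lam f b : b \in boxes lam -> entry (fill lam f) b = f b.
Proof.
rewrite mem_boxes => lt; have lt1 : b.1 < size lam.
  by apply: contraLR lt; rewrite -!leqNgt => h; rewrite nth_default.
rewrite /entry (nth_map 0) ?size_iota // nth_iota // (nth_map 0) ?size_iota //.
by rewrite nth_iota // !add0n -surjective_pairing.
Qed.

Lemma entry_out M b : b \notin boxes (shape M) -> entry M b = 0.
Proof. by rewrite mem_boxes nth_shape -leqNgt => h; rewrite /entry nth_default. Qed.

Lemma fill_entry M : fill (shape M) (entry M) = M.
Proof.
apply: (@eq_from_nth _ [::]); first by rewrite !size_map size_iota.
move=> i; rewrite !size_map size_iota => lt.
rewrite (nth_map 0) ?size_iota ?size_map // nth_iota ?size_map // nth_shape.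
apply: (@eq_from_nth _ 0); first by rewrite size_map size_iota.
move=> j; rewrite size_map size_iota => ltj.
by rewrite (nth_map 0) ?size_iota // nth_iota.
Qed.

Lemma eq_fill lam f g : {in boxes lam, f =1 g} -> fill lam f = fill lam g.
Proof.
move=> e; rewrite -[LHS]fill_entry -[RHS]fill_entry !shape_fill /fill.
apply/eq_in_map => i; rewrite mem_iota => hi; apply/eq_in_map => j; rewrite mem_iota => hj.
have b : (i, j) \in boxes lam by rewrite mem_boxes.
by rewrite !entry_fill // e.
Qed.

Lemma size_boxes lam : size (boxes lam) = sumn lam.
Proof.
by rewrite -[RHS](congr1 sumn (shape_fill lam (fun=> 0))) -size_flatten flatten_fill size_map.
Qed.

Lemma entry_set M b e x : entry (set_entry M b e) x = if x == b then e else entry M x.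
Proof.
rewrite /entry /set_entry nth_set_nth /=.
have [->|n] := eqVneq x b; first by rewrite eqxx nth_set_nth /= eqxx.
case: eqP => // e1; rewrite nth_set_nth /= e1; case: eqP => // e2.
by case/negP: n; apply/eqP; case: x b e1 e2 => ? ? [? ?] /= -> ->.
Qed.

Lemma shape_set M b e : b \in boxes (shape M) -> shape (set_entry M b e) = shape M.
Proof.
rewrite mem_boxes nth_shape => lt; have lt1 : b.1 < size M.
  by apply: contraLR lt; rewrite -!leqNgt => h; rewrite nth_default.
apply: (@eq_from_nth _ 0); first by rewrite !size_map size_set_nth; apply/maxn_idPr.
move=> i _; rewrite !nth_shape nth_set_nth /=; case: eqP => // ->.
by rewrite size_set_nth; apply/maxn_idPr.
Qed.

Lemma shape_set_new M b e : b.2 = nth 0 (shape M) b.1 ->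
  shape (set_entry M b e) = incr_nth (shape M) b.1.
Proof.
move=> h; apply: (@eq_from_nth _ 0).
  rewrite size_map size_set_nth size_incr_nth size_map.
  by case: ifP => hb; lia.
move=> i _; rewrite nth_incr_nth !nth_shape nth_set_nth /= eq_sym; case: eqP => // e1.
by rewrite e1 size_set_nth h nth_shape e1; apply/maxn_idPl.
Qed.

Lemma eq_filling M N : shape M = shape N ->
  {in boxes (shape M), entry M =1 entry N} -> M = N.
Proof. by move=> e h; rewrite -[M]fill_entry -[N]fill_entry -e; apply: eq_fill. Qed.

Lemma is_partP lam : reflect
  ((forall i, nth 0 lam i.+1 <= nth 0 lam i) /\ (forall i, i < size lam -> 0 < nth 0 lam i))
  (is_part lam).
Proof.
apply: (iffP andP) => [[so n0]|[h1 h2]]; split.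
- move=> i; have [lt|ge] := ltnP i.+1 (size lam); last by rewrite nth_default.
  by have /(_ i lt) := sortedP 0 so.
- by move=> i lt; rewrite lt0n; apply: contraNneq n0 => <-; apply: mem_nth.
- by apply/(sortedP 0) => i _; apply: h1.
by apply/negP => /(nthP 0)[i /h2 lt e]; rewrite e in lt.
Qed.

Lemma part_le lam i j : is_part lam -> i <= j -> nth 0 lam j <= nth 0 lam i.
Proof.
case/is_partP=> h _; elim: j => [|j IH]; first by rewrite leqn0 => /eqP->.
by rewrite leq_eqVlt => /orP[/eqP->//|/IH]; apply: leq_trans.
Qed.

Lemma ideal_boxes lam : is_part lam -> ideal (boxes lam).
Proof.
move=> hl b i j; rewrite !mem_boxes /= => hb hi hj.
by apply: leq_ltn_trans hj _; apply: leq_trans hb _; apply: part_le.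
Qed.

Lemma boxes_inj lam mu : is_part lam -> is_part mu -> boxes lam =i boxes mu -> lam = mu.
Proof.
move=> /is_partP[_ hl] /is_partP[_ hm] e.
have en i : nth 0 lam i = nth 0 mu i.
  apply/eqP; rewrite eqn_leq; apply/andP; split; rewrite leqNgt; apply/negP=> lt.
    by have := e (i, nth 0 mu i); rewrite !mem_boxes /= lt ltnn.
  by have := e (i, nth 0 lam i); rewrite !mem_boxes /= lt ltnn.
apply: (@eq_from_nth _ 0) => //.
apply/eqP; rewrite eqn_leq; apply/andP; split; rewrite leqNgt; apply/negP=> lt.
  by move/hl: (lt); rewrite en nth_default.
by move/hm: (lt); rewrite -en nth_default.
Qed.

Lemma EC_addable lam v : is_part lam -> EC lam v = addable (boxes lam) v.
Proof.
move=> hl; apply/andP/and3P => [[/eqP e /is_partP[h1 h2]]|[nb l u]].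
  rewrite !mem_boxes /= e ltnn; split=> //.
    by case: (nth 0 lam v.1) => //= k; rewrite ltnSn.
  case: eqP => //= n0; have := h1 v.1.-1; rewrite !nth_incr_nth.
  by rewrite prednK ?lt0n; [rewrite eqxx; case: eqP => //; lia|apply/eqP].
rewrite !mem_boxes /= -leqNgt in nb l u.
have e : v.2 = nth 0 lam v.1 by case/orP: l => [/eqP|]; lia.
split; first exact/eqP.
apply/is_partP; split=> i.
  rewrite !nth_incr_nth; have h := part_le hl (leqnSn i).
  case: eqP => [ei|_]; last by case: (v.1 == i); lia.
  move: u; rewrite ei /= => u; rewrite e in u.
  by rewrite (gtn_eqF (ltnSn i)); move: u; rewrite ei; lia.
rewrite size_incr_nth nth_incr_nth; case/is_partP: (hl) => _ hp.
case: ifP => [_ /hp|]; first by case: eqP; lia.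
move/negbT; rewrite -leqNgt => sz.
case: eqP => [->//|ne] lt; have {}lt : i < v.1 by lia.
rewrite add0n; case: (v.1 =P 0) => [e0|n0]; first by rewrite e0 in lt.
move: u => /orP[/eqP|u]; first by lia.
by apply: leq_trans (part_le hl (_ : i <= v.1.-1)); [exact: leq_ltn_trans u|lia].
Qed.

Lemma perm_boxes_incr lam v : is_part lam -> EC lam v ->
  perm_eq (boxes (incr_nth lam v.1)) (v :: boxes lam).
Proof.
move=> hl hv; apply: uniq_perm; rewrite /= ?boxes_uniq //.
  by move: hv; rewrite EC_addable // => /and3P[->].
case/andP: hv => /eqP e _ => b; rewrite inE !mem_boxes nth_incr_nth.
case: b v e => b1 b2 [v1 v2] /= ->; rewrite xpair_eqE eq_sym.
by case: eqP => //= ->; lia.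
Qed.

Lemma std_part w : std w -> exists2 lam, is_part lam & perm_eq w (boxes lam).
Proof.
elim/last_ind: w => [|w v IH]; first by exists [::].
rewrite std_rcons => /andP[/IH[lam hl pl] hv].
have hE : EC lam v by rewrite EC_addable // -(addable_eq _ (perm_mem pl)).
exists (incr_nth lam v.1); first by case/andP: hE.
rewrite perm_sym; apply: perm_trans (perm_boxes_incr hl hE) _.
by rewrite perm_sym perm_rcons perm_cons.
Qed.

Definition tab lam (w : seq box) := fill lam (fun b => (index b w).+1).

Lemma std_after_pairwise (a w : seq box) : ideal a -> std_after a w ->
  pairwise (fun x y => ~~ adj y x) w.
Proof.
elim: w a => //= x w IH a Ia /andP[hx hw].
have I1 := ideal_cons Ia hx.
rewrite (IH _ I1 hw) andbT; apply/allP=> y yw; apply/negP => ad.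
have := ideal_std_after I1 hw; move: hw; case/splitPr: yw => w1 w2.
rewrite std_after_cat /= => /and3P[h1 hy _] _.
have := addable_nle (ideal_std_after I1 h1) hy (_ : x \in _).
rewrite mem_cat mem_head orbT => /(_ isT).
by move: ad => /orP[]/eqP -> /=; rewrite ?leqnn ?leqnSn.
Qed.

Lemma adj_irr h : adj h h = false.
Proof. by case: h => h1 h2; rewrite /adj !xpair_eqE /=; lia. Qed.

Lemma slide_pass s k (T : tableau) h : uniq (h :: s) ->
  {subset h :: s <= boxes (shape T)} ->
  (forall b, b \in s -> 0 < entry T b) -> sorted ltn (map (entry T) s) ->
  pairwise (fun x y => ~~ adj y x) (h :: s) ->
  (forall p c, p \in h :: s -> adj p c -> entry T c != 0 -> c \in h :: s) ->
  size s <= k ->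
  [/\ (slide k T h).2 = (pass h s).2, shape (slide k T h).1 = shape T
    & forall x, entry (slide k T h).1 x =
      if x == (pass h s).2 then 0
      else if x \in (pass h s).1 then entry T (nth (0, 0) s (index x (pass h s).1))
      else entry T x].
Proof.
elim: s k T h => [|p s IH] k T h u sub pos so pw cl sz.
  have e c : adj h c -> entry T c = 0.
    move=> ad; apply/eqP/negPn/negP=> /(cl h c (mem_head _ _) ad).
    by rewrite inE => /eqP ec; rewrite ec adj_irr in ad.
  have -> : slide k T h = (set_entry T h 0, h).
    case: k {sz} => //= k; rewrite !e ?eqxx // /adj eqxx ?orbT //.
  split=> //= [|x]; last by rewrite entry_set.
  by apply: shape_set; apply: sub; rewrite inE.
have nhp : h != p by move: u; rewrite /= inE negb_or => /andP[/andP[]].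
have us : uniq (p :: s) by case/andP: u.
have uhs : uniq (h :: s).
  by move: u; rewrite /= inE negb_or => /andP[/andP[_ ->] /andP[_ ->]].
have pp : 0 < entry T p by apply: pos; rewrite mem_head.
have [/allP pwh /andP[/allP pwp pws]] : all (fun y => ~~ adj y h) (p :: s) /\
  (all (fun y => ~~ adj y p) s && pairwise (fun x y => ~~ adj y x) s).
  by case/andP: pw.
have lts c : c \in s -> entry T p < entry T c.
  move=> cs; have := so; rewrite /= (path_sortedE ltn_trans) => /andP[/allP h1 _].
  by apply: h1; apply: map_f.
have so' : sorted ltn (map (entry T) s) by apply: path_sorted so.
have [ad|nad] := boolP (adj h p); last first.
  have [|b bs|||p0 c p0s a0 n0||e1 e2 e3] := IH k T h uhs.
  - by move=> b; rewrite inE => /orP[/eqP->|bs]; apply: sub; rewrite !inE ?eqxx // bs !orbT.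
  - by apply: pos; rewrite inE bs orbT.
  - exact: so'.
  - rewrite /= pws andbT; apply/allP=> y ys; apply: pwh; by rewrite inE ys orbT.
  - have : c \in [:: h, p & s].
      by apply: (cl p0) => //; move: p0s; rewrite !inE => /orP[->|->]; rewrite ?orbT.
    rewrite !inE => /or3P[->//|/eqP ec|->]; last by rewrite orbT.
    move: p0s; rewrite inE => /orP[/eqP ep|p0s]; first by rewrite -ec -ep a0 in nad.
    by have := pwp _ p0s; rewrite -ec a0.
  - by apply: ltnW.
  have np : p \notin rcons (pass h s).1 (pass h s).2.
    by rewrite (perm_mem (perm_pass _ _)) inE negb_or eq_sym nhp; case/andP: us.
  rewrite /= (negbTE nad) /=; split=> // x; rewrite e3 inE (eq_sym x p).
  have [ex|nx] := eqVneq x (pass h s).2; first by [].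
  have [<-|nxp] := eqVneq p x.
    have /negbTE -> // : p \notin (pass h s).1.
    by apply: contra np => pm; rewrite mem_rcons inE pm orbT.
  by rewrite ?(negbTE nxp).
case: k sz => // k sz.
have -> : slide k.+1 T h = slide k (set_entry T h (entry T p)) p.
  have big c : adj h c -> c != p -> (entry T c == 0) || (entry T p < entry T c).
    move=> ac nc; have [//|n0] := eqVneq (entry T c) 0.
    have := cl h c (mem_head _ _) ac n0; rewrite !inE (negbTE nc) /= => /orP[/eqP ec|].
      by rewrite ec adj_irr in ac.
    exact: lts.
  have b1 := big (h.1, h.2.+1); have b2 := big (h.1.+1, h.2).
  rewrite /adj !eqxx orbT /= in b1 b2.
  move/(_ isT) in b1; move/(_ isT) in b2.
  case/orP: ad => /eqP ep /=; rewrite -ep in b1 b2 *.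
    move: b2; rewrite ep xpair_eqE; rewrite (gtn_eqF (ltnSn h.1)) /= -ep => /(_ isT) b2.
    by rewrite (gtn_eqF pp) /= b2.
  move: b1; rewrite ep xpair_eqE (ltn_eqF (ltnSn h.1)) /= -ep => /(_ isT) b1.
  rewrite (gtn_eqF pp) andbF /=; case: ifP => // /andP[/negbTE r0 rlt].
  by move: b1; rewrite r0 /= => /ltnW; rewrite leqNgt rlt.
set T1 := set_entry T h _.
have eT1 c : c != h -> entry T1 c = entry T c by move=> n; rewrite entry_set (negbTE n).
have sT1 : shape T1 = shape T by apply: shape_set; apply: sub; rewrite mem_head.
have nhs c : c \in s -> c != h.
  by move=> cs; apply: contraTneq cs => ->; case/andP: uhs.
have [|b bs|||p0 c p0s a0 n0||e1 e2 e3] := IH k T1 p us.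
- by move=> b bs; rewrite sT1; apply: sub; rewrite inE bs orbT.
- by rewrite eT1 ?nhs //; apply: pos; rewrite inE bs orbT.
- by rewrite (_ : map _ s = map (entry T) s) //; apply/eq_in_map => c cs; rewrite eT1 ?nhs.
- by apply/andP; split=> //; apply/allP.
- have nc : c != h.
    by apply: contraTneq a0 => ->; apply: pwh.
  rewrite eT1 // in n0.
  have : c \in [:: h, p & s] by apply: (cl p0) => //; rewrite inE p0s orbT.
  by rewrite inE (negbTE nc).
- by [].
have nh : h \notin rcons (pass p s).1 (pass p s).2.
  by rewrite (perm_mem (perm_pass _ _)); case/andP: u.
rewrite /= ad /= e2 sT1; split=> // x; rewrite e3 inE (eq_sym x h).
have [ex|nx] := eqVneq x (pass p s).2; first by [].
have [<-|nxp] := eqVneq h x.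
  have /negbTE -> : h \notin (pass p s).1.
    by apply: contra nh => pm; rewrite mem_rcons inE pm orbT.
  by rewrite /= entry_set eqxx.
rewrite /=; case: ifP => xs; apply: eT1; last by rewrite eq_sym.
by apply: nhs; apply: mem_nth; rewrite -(size_pass p) index_mem.
Qed.

Lemma evac_rec_spec w (T U : tableau) : std w ->
  {subset w <= boxes (shape T)} -> {subset w <= boxes (shape U)} ->
  (forall b, b \in w -> 0 < entry T b) -> sorted ltn (map (entry T) w) ->
  (forall b, b \notin w -> entry T b = 0) ->
  shape (evac_rec (size w) T U) = shape U /\
  forall x, entry (evac_rec (size w) T U) x =
    if x \in w then (index x (evac_word w)).+1 else entry U x.
Proof.
elim/evac_word_ind: w T U => // h s IH T U hw sT sU pos so out.
have h0 := std_head hw; rewrite /= -h0.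
have uhs := std_uniq hw.
have [||b bs|||p0 c p0s a0 n0||e1 e2 e3] := @slide_pass s (size (flatten T)) T h.
- exact: uhs.
- exact: sT.
- by apply: pos; rewrite inE bs orbT.
- exact: path_sorted so.
- exact: std_after_pairwise ideal0 hw.
- by apply: contraR n0 => /out ->.
- have := uniq_leq_size uhs sT; rewrite size_boxes -size_flatten /= => /ltnW.
  by [].
have pp := perm_pass h s; have pm := perm_mem pp.
have ur : uniq (rcons (pass h s).1 (pass h s).2) by rewrite (perm_uniq pp).
have ns : (pass h s).2 \notin (pass h s).1 by move: ur; rewrite rcons_uniq => /andP[].
case: (slide _ T h) e1 e2 e3 => T1 b /= e1 e2 e3.
rewrite -(size_pass h s).
have bw : b \in h :: s by rewrite e1 -pm mem_rcons mem_head.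
have sub1 : {subset (pass h s).1 <= h :: s}.
  by move=> x xs; rewrite -pm mem_rcons inE xs orbT.
have em : map (entry T1) (pass h s).1 = map (entry T) s.
  apply: (@eq_from_nth _ 0); first by rewrite !size_map size_pass.
  move=> i; rewrite size_map => lt; rewrite (nth_map (0, 0)) // e3 mem_nth //.
  rewrite (_ : (_ == _) = false); last first.
    by apply: contraNF ns => /eqP<-; apply: mem_nth.
  rewrite index_uniq //; last by move: ur; rewrite rcons_uniq => /andP[].
  by rewrite (nth_map (0, 0)) // -(size_pass h).
have sU1 : shape (set_entry U b (size s).+1) = shape U by apply: shape_set; apply: sU.
have [||x xs|x xs||x xs|f1 f2] := IH T1 (set_entry U b (size s).+1).
- exact: std_pass hw.
- by move=> x xs; rewrite e2; apply: sT; apply: sub1.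
- by rewrite sU1; apply: sU; apply: sub1.
- have : entry T1 x \in map (entry T) s by rewrite -em map_f.
  by case/mapP=> c cs ->; apply: pos; rewrite inE cs orbT.
- by rewrite em; apply: path_sorted so.
- rewrite e3 (negbTE xs); case: eqP => // /eqP nx; apply: out.
  by rewrite -pm mem_rcons inE negb_or nx.
rewrite (size_pass h) in f1 f2 *; rewrite f1; split=> // x.
rewrite f2 evac_word_cons -(pm x) mem_rcons inE entry_set -cats1 index_cat (perm_mem (perm_evac_word _)).
rewrite size_evac_word size_pass -e1.
have [xs|xs] := boolP (x \in (pass h s).1); first by rewrite orbT.
by rewrite orbF; case: eqP => //= ->; rewrite eqxx addn0.
Qed.

Lemma ev_tab lam w : is_part lam -> std w -> perm_eq w (boxes lam) ->
  ev (tab lam w) = tab lam (evac_word w).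
Proof.
move=> hl hw pw; have pm := perm_mem pw.
have uw := std_uniq hw.
have et i : i < size w -> entry (tab lam w) (nth (0, 0) w i) = i.+1.
  by move=> lt; rewrite entry_fill -?pm ?mem_nth // index_uniq.
rewrite /ev flatten_fill size_map -(perm_size pw).
have [||b bw||b bw|e1 e2] := @evac_rec_spec w (tab lam w) (tab lam w) hw.
- by move=> b; rewrite shape_fill pm.
- by move=> b; rewrite shape_fill pm.
- by rewrite entry_fill -?pm.
- have -> : map (entry (tab lam w)) w = iota 1 (size w).
    apply: (@eq_from_nth _ 0); rewrite size_map ?size_iota // => i lt.
    by rewrite (nth_map (0, 0)) // et // nth_iota.
  exact: iota_ltn_sorted.
- by apply: entry_out; rewrite shape_fill -pm.
apply: eq_filling; rewrite e1 ?shape_fill // => b bl.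
by rewrite e2 pm bl entry_fill.
Qed.

(** * Semistandard tableaux and the operations hat_add *)

Definition fill_word lam (w : seq box) (e : seq nat) := fill lam (fun b => nth 0 e (index b w)).

Definition coded lam (w : seq box) (e : seq nat) :=
  [/\ is_part lam, std w, perm_eq w (boxes lam), size e = size w
    & forall i, i.+1 < size w -> nth 0 e i + nth false (des w) i <= nth 0 e i.+1].

Lemma std_nle w i j : std w -> i < j < size w ->
  ~~ (((nth (0, 0) w j).1 <= (nth (0, 0) w i).1) && ((nth (0, 0) w j).2 <= (nth (0, 0) w i).2)).
Proof.
move=> hw /andP[ij lt].
have := hw; rewrite -[w in std w](cat_take_drop j) (drop_nth (0, 0)) // -cat_rcons.
move/std_prefix; rewrite std_rcons => /andP[h1 h2].
apply: addable_nle (std_ideal h1) h2 _.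
by rewrite -(nth_take (n0 := j)) //; apply: mem_nth; rewrite size_take lt.
Qed.

Lemma coded_mono lam w e i j : coded lam w e -> i <= j < size w ->
  nth 0 e i <= nth 0 e j /\ (nth 0 e i = nth 0 e j ->
    (nth (0, 0) w j).1 <= (nth (0, 0) w i).1 /\
    (i < j -> (nth (0, 0) w i).2 < (nth (0, 0) w j).2)).
Proof.
case=> hl hw pw se hd; elim: j => [|j IH]; first by rewrite leqn0 => /andP[/eqP-> _].
rewrite leq_eqVlt => /andP[/orP[/eqP->|ij] lt]; first by rewrite ltnn.
have [|IH1 IH2] := IH; first by rewrite -ltnS ij ltnW.
have := hd j lt; rewrite nth_des // => hj.
split; first by apply: leq_trans IH1 _; apply: leq_trans (leq_addr _ _) hj.
move=> e1; have e2 : nth 0 e i = nth 0 e j by lia.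
have [IH3 IH4] := IH2 e2.
have nb : below (nth (0, 0) w j) (nth (0, 0) w j.+1) = false by move: hj; case: below => //; lia.
have := @std_nle w j j.+1 hw; rewrite ltnSn lt => /(_ isT).
move/negbT: nb; rewrite /below -leqNgt => nb; rewrite nb /= -ltnNge => lt2.
split; first exact: leq_trans nb IH3.
move=> _; case: (ltngtP i j) => [/IH4 h|h|->//]; first exact: ltn_trans h lt2.
by move: ij; rewrite ltnS leqNgt h.
Qed.

Lemma count_prefix (T : Type) (x0 : T) (P : pred T) s k : k <= size s ->
  (forall j, j < size s -> P (nth x0 s j) = (j < k)) -> count P s = k.
Proof.
elim: s k => [|x s IH] [|k] //= lt h.
- rewrite (h 0) // add0n; apply: (IH 0) => // j hj; have := h j.+1 hj; by rewrite !ltn0.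
- by rewrite (h 0) // (IH k) // => j hj; have := h j.+1 hj.
Qed.

Lemma coded_size lam w e : coded lam w e -> size w = sumn lam.
Proof. by case=> _ _ pw _ _; rewrite (perm_size pw) size_boxes. Qed.

Lemma entry_fill_word lam w e i : coded lam w e -> i < size w ->
  entry (fill_word lam w e) (nth (0, 0) w i) = nth 0 e i.
Proof.
case=> _ hw pw _ _ lt; rewrite entry_fill ?index_uniq ?std_uniq //.
by rewrite -(perm_mem pw) mem_nth.
Qed.

Lemma standardize_fill_word lam w e : coded lam w e -> standardize (fill_word lam w e) = tab lam w.
Proof.
move=> c; have [hl hw pw se hd] := c; rewrite /standardize shape_fill.
apply: eq_fill => b bl; congr S.
have bw : b \in w by rewrite (perm_mem pw).
rewrite -(seq.permP pw); apply: (count_prefix (x0 := (0, 0))); first exact: index_size.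
have bi : index b w < size w by rewrite index_mem.
move=> j lt; rewrite entry_fill_word // -[in RHS](nth_index (0, 0) bw).
rewrite -{1 2 3}(nth_index (0, 0) bw) entry_fill_word //.
rewrite nth_index //; case: (ltngtP j (index b w)) => h.
- have := @coded_mono _ _ _ j (index b w) c; rewrite bi ltnW // => /(_ isT)[h1 h2].
  rewrite leq_eqVlt in h1; case/orP: h1 => [/eqP h1|->//].
  have [_ /(_ h)] := h2 h1; rewrite nth_index // => ->.
  by rewrite h1 eqxx orbT.
- have := @coded_mono _ _ _ (index b w) j c; rewrite lt ltnW // => /(_ isT)[h1 h2].
  rewrite ltnNge h1 /=.
  case: eqP => // e1; have [_ /(_ h)] := h2 (esym e1); rewrite nth_index // => h3.
  by rewrite ltnNge (ltnW h3).
- by rewrite h nth_index // !ltnn andbF.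
Qed.

Lemma perm_fill_word lam w e : coded lam w e -> perm_eq (flatten (fill_word lam w e)) e.
Proof.
case=> hl hw pw se hd; rewrite flatten_fill.
apply: perm_trans (_ : perm_eq (map (fun b => nth 0 e (index b w)) w) _).
  by rewrite perm_sym perm_map.
rewrite (_ : map _ w = e) //; apply: (@eq_from_nth _ 0); rewrite size_map // => i lt.
by rewrite (nth_map (0, 0)) // index_uniq // std_uniq.
Qed.

Lemma SSYT_shape lam M : SSYT lam M -> shape M = lam.
Proof. by case/and3P=> /eqP. Qed.

Lemma SSYT_row lam M i j k : SSYT lam M -> j <= k -> k < nth 0 lam i ->
  entry M (i, j) <= entry M (i, k).
Proof.
case/and3P=> /eqP sM so _ jk lt; rewrite /entry /=.
have sr : k < size (nth [::] M i) by rewrite -nth_shape sM.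
have lti : i < size M by rewrite ltnNge; apply/negP=> h; rewrite nth_default in sr.
have := allP so _ (mem_nth [::] lti) => so'.
by apply: (sorted_leq_nth leq_trans leqnn) => //; rewrite inE // (leq_ltn_trans jk).
Qed.

Lemma SSYT_col lam M i j k : is_part lam -> SSYT lam M -> i < j -> k < nth 0 lam j ->
  entry M (i, k) < entry M (j, k).
Proof.
move=> hl /and3P[_ _ /allP h]; elim: j => // j IH; rewrite ltnS leq_eqVlt => ij lt.
have h1 : entry M (j, k) < entry M (j.+1, k) by have /= := h (j.+1, k); apply; rewrite mem_boxes.
case/orP: ij => [/eqP->//|ij]; apply: ltn_trans h1; apply: IH => //.
by apply: leq_trans lt _; apply: part_le.
Qed.

Lemma SSYT_fill_word lam w e : coded lam w e -> SSYT lam (fill_word lam w e).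
Proof.
move=> c; have [hl hw pw se hd] := c.
have lt_idx b c' : b \in boxes lam -> c' \in boxes lam -> b != c' ->
    b.1 <= c'.1 -> b.2 <= c'.2 -> index b w < index c' w.
  rewrite -!(perm_mem pw) => bw cw ne h1 h2.
  case: (ltngtP (index b w) (index c' w)) => // h.
    have := @std_nle w (index c' w) (index b w) hw; rewrite h index_mem bw => /(_ isT).
    by rewrite !nth_index // h1 h2.
  by case/negP: ne; rewrite -(nth_index (0, 0) bw) h nth_index.
apply/and3P; split; first by rewrite shape_fill.
  apply/allP => r /(nthP [::])[i]; rewrite size_map size_iota => lti <-.
  apply/(sortedP 0) => j ltj; have eq k : nth 0 (nth [::] (fill_word lam w e) i) k = entry (fill_word lam w e) (i, k) by [].
  rewrite -nth_shape shape_fill in ltj.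
  have b1 : (i, j) \in boxes lam by rewrite mem_boxes /= ltnW.
  have b2 : (i, j.+1) \in boxes lam by rewrite mem_boxes.
  rewrite !eq !entry_fill //.
  have lt : index (i, j) w < index (i, j.+1) w.
    by apply: lt_idx => //=; rewrite xpair_eqE eqxx /= ltn_eqF.
  have := @coded_mono _ _ _ _ _ c; move/(_ (index (i, j) w) (index (i, j.+1) w)).
  by rewrite index_mem (perm_mem pw) b2 ltnW // => /(_ isT)[].
apply/allP=> -[i j] b2 /=; apply/implyP=> i0.
have b1 : (i.-1, j) \in boxes lam by apply: (ideal_boxes hl b2) => //=; apply: leq_pred.
rewrite !entry_fill //.
have lt : index (i.-1, j) w < index (i, j) w.
  by apply: lt_idx => //=; rewrite ?leq_pred // xpair_eqE eqxx andbT; lia.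
have := @coded_mono _ _ _ _ _ c; move/(_ (index (i.-1, j) w) (index (i, j) w)).
rewrite index_mem (perm_mem pw) b2 ltnW // => /(_ isT)[h1 h2].
rewrite ltn_neqAle h1 andbT; apply/negP => /eqP /h2 [_ /(_ lt)].
by rewrite !nth_index ?(perm_mem pw) //= ltnn.
Qed.

Lemma SSYT_coded lam M : is_part lam -> SSYT lam M ->
  exists w e, coded lam w e /\ M = fill_word lam w e.
Proof.
move=> hl hM; have sM := SSYT_shape hM.
pose lexo (b c : box) := (entry M b < entry M c) || (entry M b == entry M c) && (b.2 <= c.2).
have tot : total lexo by move=> b c; rewrite /lexo; lia.
have tr : transitive lexo by move=> c b d; rewrite /lexo; lia.
pose w := sort lexo (boxes lam).
have pw : perm_eq w (boxes lam) by rewrite perm_sort.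
have so : sorted lexo w by apply: sort_sorted.
clearbody w.
have uw : uniq w by rewrite (perm_uniq pw) boxes_uniq.
have sw i j : i <= j < size w -> lexo (nth (0, 0) w i) (nth (0, 0) w j).
  move=> /andP[ij lt].
  apply: (sorted_leq_nth tr _ (0, 0) so) => //; rewrite ?inE //.
    by move=> x; rewrite /lexo leqnn eqxx orbT.
  exact: leq_ltn_trans lt.
have early b c : b \in boxes lam -> c \in boxes lam -> ~~ lexo c b -> index b w < index c w.
  rewrite -!(perm_mem pw) => bw cw; apply: contraR; rewrite -leqNgt => h.
  by have := sw _ _ (introT andP (conj h _)); rewrite !nth_index // index_mem; apply.
have hw : std w.
  have gen k : k <= size w -> std (take k w).
    elim: k => [|k IH] lt; first by rewrite take0.
    rewrite (take_nth (0, 0)) // std_rcons (IH (ltnW lt)) /=.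
    have bw := mem_nth (0, 0) lt; set b := nth _ w k in bw *.
    have ib : index b w = k by rewrite index_uniq.
    have bl : b \in boxes lam by rewrite -(perm_mem pw).
    have tk c : c \in boxes lam -> index c w < k -> c \in take k w.
      by rewrite -(perm_mem pw) => cw h; rewrite in_take.
    have blt : b.2 < nth 0 lam b.1 by rewrite -mem_boxes.
    apply/and3P; split.
    - by rewrite in_take // ib ltnn.
    - case: (posnP b.2) => //= b0; apply: tk.
        by apply: (ideal_boxes hl bl) => //=; apply: leq_pred.
      rewrite -ib; apply: early => //.
        by apply: (ideal_boxes hl bl) => //=; apply: leq_pred.
      have := @SSYT_row lam M b.1 b.2.-1 b.2 hM (leq_pred _) blt.
      by rewrite /lexo -surjective_pairing /=; lia.
    - case: (posnP b.1) => //= b0; apply: tk.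
        by apply: (ideal_boxes hl bl) => //=; apply: leq_pred.
      rewrite -ib; apply: early => //.
        by apply: (ideal_boxes hl bl) => //=; apply: leq_pred.
      have := @SSYT_col lam M b.1.-1 b.1 b.2 hl hM _ blt.
      by rewrite /lexo -surjective_pairing /=; lia.
  by have := gen _ (leqnn _); rewrite take_size.
exists w, (map (entry M) w); split; last first.
  rewrite -[LHS]fill_entry sM; apply: eq_fill => b bl.
  by rewrite (nth_map (0, 0)) ?nth_index ?index_mem ?(perm_mem pw).
split=> //; first by rewrite size_map.
move=> i lt; have lt' := ltnW lt; rewrite nth_des // !(nth_map (0, 0)) //.
have := sw i i.+1; rewrite leqnSn lt => /(_ isT).
have := mem_nth (0, 0) lt; rewrite (perm_mem pw).
case: (nth _ w i) => a1 a2; case: (nth _ w i.+1) => b1 b2.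
rewrite /lexo /below mem_boxes /= => bl.
have [ab|] := ltnP a1 b1; last by lia.
move=> h; have h1 := @SSYT_col lam M a1 b1 _ hl hM ab bl.
case/orP: h => [|/andP[e1 h]]; first by lia.
have lt1 : b2 < nth 0 lam a1 by apply: leq_trans bl _; apply: part_le => //; apply: ltnW.
by have := @SSYT_row lam M a1 a2 b2 hM h lt1; lia.
Qed.

Lemma tab_inj lam w w' : std w -> std w' -> perm_eq w (boxes lam) -> perm_eq w' (boxes lam) ->
  tab lam w = tab lam w' -> w = w'.
Proof.
move=> hw hw' pw pw' e.
have sz : size w = size w' by rewrite (perm_size pw) (perm_size pw').
apply: (@eq_from_nth _ (0, 0)) => // i lt.
have bw := mem_nth (0, 0) lt; have bl := bw; rewrite (perm_mem pw) in bl.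
have := congr1 (fun T => entry T (nth (0, 0) w i)) e.
rewrite !entry_fill // index_uniq ?std_uniq // => - [ei].
by rewrite [in RHS]ei nth_index // (perm_mem pw').
Qed.

Lemma fill_word_inj lam w e lam' w' e' : coded lam w e -> coded lam' w' e' ->
  fill_word lam w e = fill_word lam' w' e' -> [/\ lam = lam', w = w' & e = e'].
Proof.
move=> c c' E; have el : lam = lam' by move/(congr1 shape): E; rewrite !shape_fill.
subst lam'; have [hl hw pw se hd] := c; have [_ hw' pw' se' hd'] := c'.
have ew : w = w'.
  apply: (tab_inj hw hw' pw pw').
  by rewrite -(standardize_fill_word c) -(standardize_fill_word c') E.
subst w'; split=> //.
apply: (@eq_from_nth _ 0); first by rewrite se se'.
by move=> i; rewrite se => lt; rewrite -(entry_fill_word c lt) E (entry_fill_word c' lt).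
Qed.

Lemma count_lt_le e p h : sorted leq e -> p < size e ->
  (count (fun x => x < h) e <= p) = (h <= nth 0 e p).
Proof.
move=> so lt; have mono i j : i <= j < size e -> nth 0 e i <= nth 0 e j.
  by move=> /andP[ij lj]; apply: (sorted_leq_nth leq_trans leqnn 0 so); rewrite ?inE ?(leq_ltn_trans ij).
rewrite -{1}(cat_take_drop p e) count_cat.
have [le|gt] := leqP h (nth 0 e p).
  rewrite (_ : count _ (drop p e) = 0) ?addn0.
    by apply: leq_trans (count_size _ _) _; rewrite size_take lt.
  apply/eqP; rewrite -leqn0 leqNgt -has_count; apply/hasP => -[x /(nthP 0)[i]].
  rewrite size_drop nth_drop => li <-; rewrite /= ltnNge => /negP; apply.
  by apply: leq_trans le _; apply: mono; rewrite leq_addr /= -ltn_subRL.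
apply/negbTE; rewrite -ltnNge (_ : count _ (take p e) = p); last first.
  transitivity (size (take p e)); last by rewrite size_take lt.
  apply/eqP; rewrite -all_count; apply/allP => x /(nthP 0)[i].
  rewrite size_take lt => li <-; rewrite nth_take //.
  by apply: leq_ltn_trans gt; apply: mono; rewrite (ltnW li).
by rewrite (drop_nth 0) //= gt; lia.
Qed.

Lemma count_iota_le a m : a <= m -> count (fun h => h <= a) (iota 1 m) = a.
Proof.
move=> le; rewrite -{1}(subnKC le) iotaD count_cat.
rewrite (_ : count _ (iota 1 a) = a); last first.
  transitivity (size (iota 1 a)); last by rewrite size_iota.
  by apply/eqP; rewrite -all_count; apply/allP => x; rewrite mem_iota; lia.
rewrite (_ : count _ _ = 0) ?addn0 //.
by apply/eqP; rewrite -leqn0 leqNgt -has_count; apply/hasP => -[x]; rewrite mem_iota; lia.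
Qed.

Lemma coded_sorted lam w e : coded lam w e -> sorted leq e.
Proof.
case=> _ _ _ se hd; apply/(sortedP 0) => i; rewrite se => /hd.
by apply: leq_trans; apply: leq_addr.
Qed.

Lemma count_J_of lam w e p : coded lam w e -> p < size w ->
  count (fun j => j < p.+1) (J_of (fill_word lam w e)) = nth 0 e p.
Proof.
move=> c lt; have pe := perm_fill_word c; have [_ _ _ se _] := c.
rewrite /J_of count_map -[RHS](@count_iota_le _ (\max_(x <- flatten (fill_word lam w e)) x)); last first.
  rewrite (perm_big _ pe) /=; apply: leq_bigmax_seq => //.
  by apply: mem_nth; rewrite se.
apply: eq_count => h /=; rewrite ltnS (seq.permP pe) count_lt_le ?se //.
exact: coded_sorted c.
Qed.

Lemma ct_tab J lam w : ct J (tab lam w) = fill lam (fun b => count (fun j => j < (index b w).+1) J).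
Proof.
rewrite /ct /tab /fill -map_comp; apply: eq_map => i /=; rewrite -map_comp.
exact: eq_map.
Qed.

Lemma add_box_tab lam w v : is_part lam -> std w -> perm_eq w (boxes lam) -> EC lam v ->
  add_box (tab lam w) v = tab (incr_nth lam v.1) (rcons w v).
Proof.
move=> hl hw pw hv; have /andP[/eqP e2 _] := hv.
have sz : size (flatten (tab lam w)) = size w.
  by rewrite flatten_fill size_map (perm_size pw).
have nv : v \notin boxes lam by move: hv; rewrite EC_addable // => /and3P[].
have ss : shape (add_box (tab lam w) v) = incr_nth lam v.1.
  by rewrite /add_box shape_set_new shape_fill.
apply: eq_filling; rewrite ss ?shape_fill // => b.
rewrite (perm_mem (perm_boxes_incr hl hv)) inE => hb.
rewrite /add_box sz entry_set [in RHS]entry_fill ?(perm_mem (perm_boxes_incr hl hv)) //.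
rewrite /= -cats1 index_cat (perm_mem pw).
case/orP: hb => [/eqP->|hb]; first by rewrite eqxx (negbTE nv) /= eqxx addn0.
rewrite hb; have [ev|_] := eqVneq b v; first by rewrite -ev hb in nv.
by rewrite entry_fill.
Qed.

Lemma row_of_fill lam f b : is_part lam -> {in boxes lam &, injective f} -> b \in boxes lam ->
  row_of (fill lam f) (f b) = b.1.
Proof.
move=> hl inj bl; have lt : b.1 < size (fill lam f).
  rewrite size_map size_iota; move: bl; rewrite mem_boxes; apply: contraLR.
  by rewrite -!leqNgt => h; rewrite nth_default.
have rowE i : i < size lam -> nth [::] (fill lam f) i = [seq f (i, j) | j <- iota 0 (nth 0 lam i)].
  by move=> li; rewrite (nth_map 0) ?size_iota // nth_iota.
have mr i : i < size lam -> f b \in nth [::] (fill lam f) i -> i = b.1.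
  move=> li; rewrite rowE // => /mapP[j]; rewrite mem_iota add0n /= => lj /inj e.
  by rewrite e // mem_boxes.
have inb : f b \in nth [::] (fill lam f) b.1.
  rewrite rowE; last by rewrite size_map size_iota in lt.
  by apply/mapP; exists b.2; rewrite -?surjective_pairing // mem_iota add0n -mem_boxes.
have hs : has (fun r => f b \in r) (fill lam f).
  by apply/hasP; exists (nth [::] (fill lam f) b.1) => //; apply: mem_nth.
apply: mr; last exact: (nth_find [::] hs).
by rewrite -[size lam](size_iota 0) -(size_map (fun i => [seq f (i, j) | j <- iota 0 (nth 0 lam i)])) -has_find.
Qed.

Definition hat_word (w : seq box) v := evac_word (rcons (evac_word w) v).

Section Hat.
Variables (lam : seq nat) (w : seq box) (e : seq nat) (v : box).
Hypotheses (c : coded lam w e) (hv : EC lam v) (w0 : 0 < size w).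

Let hl : is_part lam. Proof. by case: c. Qed.
Let hw : std w. Proof. by case: c. Qed.
Let pw : perm_eq w (boxes lam). Proof. by case: c. Qed.
Let pe : perm_eq (evac_word w) (boxes lam). Proof. exact: perm_trans (perm_evac_word w) pw. Qed.
Let hl1 : is_part (incr_nth lam v.1). Proof. by case/andP: hv. Qed.

Let he : std (rcons (evac_word w) v).
Proof.
rewrite std_rcons std_evac_word //= (addable_eq _ (perm_mem pe)) -EC_addable //.
Qed.

Let p1 : perm_eq (rcons (evac_word w) v) (boxes (incr_nth lam v.1)).
Proof.
by rewrite perm_rcons perm_sym (permPl (perm_boxes_incr hl hv)) perm_cons perm_sym.
Qed.

Lemma std_hat_word : std (hat_word w v). Proof. exact: std_evac_word. Qed.

Lemma perm_hat_word : perm_eq (hat_word w v) (boxes (incr_nth lam v.1)).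
Proof. exact: perm_trans (perm_evac_word _) p1. Qed.

Lemma delta_fill_word : delta (fill_word lam w e) v = ~~ below (last (0, 0) (evac_word w)) v.
Proof.
rewrite /delta (standardize_fill_word c) ev_tab // flatten_fill size_map -(perm_size pw).
have sz : size (evac_word w) = size w := size_evac_word w.
have bl : last (0, 0) (evac_word w) \in boxes lam.
  rewrite -(perm_mem pe); case: (evac_word w) sz => [sz|x s _ /=]; last exact: mem_last.
  by move: w0; rewrite -sz.
have eI : (index (last (0, 0) (evac_word w)) (evac_word w)).+1 = size w.
  by rewrite -nth_last sz index_uniq ?std_uniq ?std_evac_word ?sz ?prednK.
rewrite -{1}eI row_of_fill //; first by rewrite /below -leqNgt.
move=> x y; rewrite -!(perm_mem pe) => hx hy [exy].
by rewrite -(nth_index (0, 0) hx) exy nth_index.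
Qed.

Lemma des_hat_word : des (hat_word w v) = ~~ delta (fill_word lam w e) v :: des w.
Proof.
rewrite /hat_word des_evac_word // des_rcons ?size_evac_word // rev_rcons des_evac_word // revK.
by rewrite delta_fill_word negbK.
Qed.

Definition hat_entries := 0 :: (if delta (fill_word lam w e) v then e else map S e).

Lemma hat_coded : coded (incr_nth lam v.1) (hat_word w v) hat_entries.
Proof.
have [_ _ _ se hd] := c.
have sz : size (hat_word w v) = (size w).+1 by rewrite /hat_word size_evac_word size_rcons size_evac_word.
split; rewrite ?perm_hat_word ?std_hat_word //.
  by rewrite sz /hat_entries /=; case: ifP => _; rewrite ?size_map se.
rewrite sz des_hat_word /hat_entries => -[_|i] /=.
  by case: ifP => //= _; rewrite (nth_map 0) ?se.
rewrite !ltnS => lt; case: ifP => _; first exact: hd.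
by rewrite !(nth_map 0) ?se ?addSn ?ltnS; [apply: hd| |apply: ltnW].
Qed.

Lemma hat_add_fill_word :
  hat_add (fill_word lam w e) v = fill_word (incr_nth lam v.1) (hat_word w v) hat_entries.
Proof.
rewrite /hat_add (standardize_fill_word c) /tilde_add ev_tab // add_box_tab ?std_evac_word //.
rewrite ev_tab // ct_tab; apply: eq_fill => b bl.
have [_ _ _ se _] := c.
have ib : index b (hat_word w v) < (size w).+1.
  by rewrite -(size_evac_word w) -(size_rcons _ v) -size_evac_word index_mem (perm_mem perm_hat_word).
rewrite -/(hat_word w v).
case: (index b (hat_word w v)) ib => [_|p]; rewrite ?ltnS /hat_entries.
  by case: ifP => _ /=; rewrite count_map; apply/eqP; rewrite -leqn0 leqNgt -has_count;
    apply/hasP => -[].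
move=> lt; have ej := count_J_of c lt.
rewrite /=; case: ifP => _ /=; rewrite count_map.
  by rewrite -ej; apply: eq_count.
by rewrite (nth_map 0) ?se // -ej add1n; congr S; apply: eq_count.
Qed.

End Hat.

Definition all_SSYT n : pred tableau := fun M => is_part_of n (shape M) && SSYT (shape M) M.

Lemma all_SSYT_coded n M : all_SSYT n M ->
  exists lam w e, [/\ coded lam w e, M = fill_word lam w e & size w = n].
Proof.
case/andP=> /andP[hl /eqP hn] /(SSYT_coded hl)[w [e [c E]]]; exists (shape M), w, e.
by split=> //; rewrite (coded_size c).
Qed.

Lemma coded_all_SSYT n lam w e : coded lam w e -> size w = n -> all_SSYT n (fill_word lam w e).
Proof.
move=> c sw; rewrite /all_SSYT shape_fill (SSYT_fill_word c) andbT /is_part_of.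
by case: (c) => -> *; rewrite -(coded_size c) sw /=.
Qed.

Lemma hat_add_SSYT n M v : 0 < n -> all_SSYT n M -> EC (shape M) v ->
  all_SSYT n.+1 (hat_add M v) /\
  perm_eq (flatten (hat_add M v))
          (0 :: (if delta M v then flatten M else map S (flatten M))).
Proof.
move=> n0 /all_SSYT_coded[lam [w [e [c -> sw]]]]; rewrite shape_fill => hv.
rewrite -sw in n0; rewrite (hat_add_fill_word c hv).
have c' := hat_coded c hv n0; split.
  by apply: coded_all_SSYT c' _; rewrite /hat_word size_evac_word size_rcons size_evac_word sw.
apply: perm_trans (perm_fill_word c') _; rewrite /hat_entries perm_cons.
by case: ifP => _; [|apply: perm_map]; rewrite perm_sym; apply: perm_fill_word.
Qed.

Lemma hat_add_inj n M M' v v' : 0 < n -> all_SSYT n M -> all_SSYT n M' ->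
  EC (shape M) v -> EC (shape M') v' -> hat_add M v = hat_add M' v' ->
  M = M' /\ v = v'.
Proof.
move=> n0 /all_SSYT_coded[lam [w [e [c -> sw]]]] /all_SSYT_coded[lam' [w' [e' [c' -> sw']]]].
rewrite !shape_fill => hv hv'.
have n1 : 0 < size w by rewrite sw.
have n1' : 0 < size w' by rewrite sw'.
rewrite (hat_add_fill_word c hv) (hat_add_fill_word c' hv').
case/(fill_word_inj (hat_coded c hv n1) (hat_coded c' hv' n1')) => el ew ee.
have hw : std w by case: c. have hw' : std w' by case: c'.
have pw : perm_eq w (boxes lam) by case: c.
have pw' : perm_eq w' (boxes lam') by case: c'.
have hl : is_part lam by case: c. have hl' : is_part lam' by case: c'.
have hr t l u : std t -> perm_eq t (boxes l) -> is_part l -> EC l u -> std (rcons (evac_word t) u).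
  move=> ht pt lp eu; rewrite std_rcons std_evac_word //=.
  by rewrite (addable_eq _ (perm_mem (perm_trans (perm_evac_word t) pt))) -EC_addable.
have := evac_word_inj (hr _ _ _ hw pw hl hv) (hr _ _ _ hw' pw' hl' hv') ew.
move/eqP; rewrite eqseq_rcons => /andP[/eqP eW /eqP eV]; split=> //.
have {}eW := evac_word_inj hw hw' eW; subst w' v'.
have eL : lam = lam'.
  by apply: boxes_inj => // b; rewrite -(perm_mem pw) (perm_mem pw').
subst lam'; congr (fill_word _ _ _).
move: ee; rewrite /hat_entries (delta_fill_word v c n1) (delta_fill_word v c' n1).
by case: ifP => _ [] // /(inj_map succn_inj).
Qed.

Lemma hat_add_surj n N : 0 < n -> all_SSYT n.+1 N -> 0 \in flatten N ->
  exists M v, [/\ all_SSYT n M, EC (shape M) v & N = hat_add M v].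
Proof.
move=> n0 /all_SSYT_coded[lam' [w' [e' [c' -> sw']]]].
rewrite (perm_mem (perm_fill_word c')) => z.
have [hl' hw' pw' se' hd'] := c'.
have [t ht et] := evac_word_surj hw'.
case/lastP: t ht et => [|t0 v] ht et.
  by move/(congr1 size): et; rewrite size_evac_word sw'.
have [ht0 hv] : std t0 /\ addable t0 v by move: ht; rewrite std_rcons => /andP.
have [w hw ew] := evac_word_surj ht0.
have [lam hl pl] := std_part ht0.
have hE : EC lam v by rewrite EC_addable // -(addable_eq _ (perm_mem pl)).
have ww : hat_word w v = w' by rewrite /hat_word ew.
have sw : size w = n.
  by have := sw'; rewrite -ww /hat_word size_evac_word size_rcons size_evac_word => - [].
have n1 : 0 < size w by rewrite sw.
have hd : des w' = below (last (0, 0) t0) v :: des w.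
  by rewrite -et des_evac_word // des_rcons -?ew ?size_evac_word // rev_rcons des_evac_word // revK.
have e0 : nth 0 e' 0 = 0.
  have i0 : index 0 e' < size w' by rewrite -se' index_mem.
  have := @coded_mono _ _ _ 0 (index 0 e') c'; rewrite i0 => /(_ isT)[].
  by rewrite nth_index // leqn0 => /eqP.
have se : size (behead e') = size w by rewrite size_behead se' sw' sw.
pose e := if below (last (0, 0) t0) v then map predn (behead e') else behead e'.
have nb i : nth 0 (behead e') i = nth 0 e' i.+1 by rewrite nth_behead.
have pos i : i < size w -> below (last (0, 0) t0) v -> 0 < nth 0 e' i.+1.
  move=> lt b; have := hd' 0; rewrite hd b e0 sw' /= ltnS -sw => /(_ n1) h1.
  have := @coded_mono _ _ _ 1 i.+1 c'; rewrite sw' -sw !ltnS lt => /(_ isT)[h _].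
  exact: leq_trans h1 h.
have pw : perm_eq w (boxes lam).
  by apply: perm_trans pl; rewrite -ew perm_sym perm_evac_word.
have c : coded lam w e.
  split=> //; first by rewrite /e; case: ifP => _; rewrite ?size_map.
  move=> i lt; have := hd' i.+1; rewrite sw' -sw hd /= ltnS lt => /(_ isT) h.
  rewrite /e; case: ifP => b; last by rewrite !nb.
  rewrite !(nth_map 0) ?se // ?(ltnW lt) // !nb.
  by move: (pos i (ltnW lt) b) h; clear; lia.
exists (fill_word lam w e), v; split.
- exact: coded_all_SSYT c sw.
- by rewrite shape_fill.
rewrite (hat_add_fill_word c hE) ww.
have pE := perm_boxes_incr hl hE.
have -> : lam' = incr_nth lam v.1.
  apply: boxes_inj => //; first by case/andP: hE.
  move=> b; rewrite -(perm_mem pw') -ww (perm_mem (perm_hat_word c hE)) //.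
congr (fill_word _ _ _); rewrite /hat_entries (delta_fill_word v c n1) ew.
have ee : e' = 0 :: behead e' by case: (e') e0 se' => [|x s] /= => [_|->]; rewrite ?sw'.
rewrite {1}ee; congr cons; rewrite /e; case b: (below _ v) => //=.
rewrite -map_comp; apply: (@eq_from_nth _ 0) => [|i lt]; first by rewrite size_map.
rewrite (nth_map 0) //= prednK // nb; apply: pos => //.
by rewrite -se.
Qed.

Import GRing.Theory Num.Theory Order.TTheory.

Local Open Scope ring_scope.

(** * Row and column symmetrizers *)

Section Operators.
Variable m : nat.
Implicit Types (f g : 'I_m -> nat) (p q : {mpoly rat[m]}) (s t : 'S_m).

Definition stab f : {set 'S_m} := [set t : 'S_m | [forall i, f (t i) == f i]].

Lemma stabP f s : reflect (forall i, f (s i) = f i) (s \in stab f).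
Proof. by rewrite inE; apply: (iffP forallP) => h i; apply/eqP. Qed.

Lemma stab1 f : 1%g \in stab f.
Proof. by apply/stabP => i; rewrite perm1. Qed.

Lemma stabM f s t : s \in stab f -> t \in stab f -> (s * t)%g \in stab f.
Proof. by move=> /stabP hs /stabP ht; apply/stabP => i; rewrite permM ht hs. Qed.

Lemma stabV f s : (s^-1%g \in stab f) = (s \in stab f).
Proof.
have aux t : t \in stab f -> t^-1%g \in stab f.
  by move=> /stabP ht; apply/stabP => i; rewrite -{2}(permKV t i) ht.
by apply/idP/idP => /aux //; rewrite invgK.
Qed.

Lemma stabMl f s t : s \in stab f -> ((s * t)%g \in stab f) = (t \in stab f).
Proof.
move=> hs; apply/idP/idP => [h|]; last exact: stabM.
by rewrite -(mulKg s t); apply: stabM; rewrite ?stabV.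
Qed.

Lemma stabMr f s t : s \in stab f -> ((t * s)%g \in stab f) = (t \in stab f).
Proof.
move=> hs; apply/idP/idP => [h|h]; last exact: stabM.
by rewrite -(mulgK s t); apply: stabM; rewrite ?stabV.
Qed.

Lemma tperm_stab f u v : f u = f v -> tperm u v \in stab f.
Proof. by move=> e; apply/stabP => i; case: tpermP => [->|->|]. Qed.

Definition Sym f p := \sum_(t in stab f) msym t p.
Definition Asym f p := \sum_(s in stab f) (-1) ^+ s *: msym s p.

Fact Sym_is_linear f : linear (Sym f).
Proof.
move=> c p q; rewrite /Sym scaler_sumr -big_split /=; apply: eq_bigr => t _.
by rewrite msymD msymZ.
Qed.

Fact Asym_is_linear f : linear (Asym f).
Proof.
move=> c p q; rewrite /Asym scaler_sumr -big_split /=; apply: eq_bigr => t _.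
by rewrite msymD msymZ scalerDr !scalerA mulrC.
Qed.

HB.instance Definition _ f :=
  GRing.isLinear.Build rat {mpoly rat[m]} {mpoly rat[m]} *:%R (Sym f) (Sym_is_linear f).
HB.instance Definition _ f :=
  GRing.isLinear.Build rat {mpoly rat[m]} {mpoly rat[m]} *:%R (Asym f) (Asym_is_linear f).

Lemma eq_stab f g : f =1 g -> stab f = stab g.
Proof.
by move=> e; apply/setP => s; apply/stabP/stabP => h i; [rewrite -!e|rewrite !e].
Qed.

Lemma eq_Sym f g p : f =1 g -> Sym f p = Sym g p.
Proof. by move=> e; rewrite /Sym (eq_stab e). Qed.

Lemma eq_Asym f g p : f =1 g -> Asym f p = Asym g p.
Proof. by move=> e; rewrite /Asym (eq_stab e). Qed.

Lemma Sym_msym f t p : t \in stab f -> Sym f (msym t p) = Sym f p.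
Proof.
move=> ht; rewrite /Sym [RHS](reindex_inj (mulgI t)) /=.
by apply: eq_big => s; rewrite ?stabMl // msymMm.
Qed.

Lemma msym_Sym f t p : t \in stab f -> msym t (Sym f p) = Sym f p.
Proof.
move=> ht; rewrite /Sym raddf_sum /= [RHS](reindex_inj (mulIg t)) /=.
by apply: eq_big => s; rewrite ?stabMr // msymMm.
Qed.

Lemma Asym_msym f s p : s \in stab f -> Asym f (msym s p) = (-1) ^+ s *: Asym f p.
Proof.
move=> hs; rewrite /Asym [in RHS](reindex_inj (mulgI s)) /= scaler_sumr.
apply: eq_big => t; rewrite ?stabMl // msymMm => _.
by rewrite scalerA odd_permM signr_addb mulrA -signr_addb addbb mul1r.
Qed.

Lemma msym_Asym f s p : s \in stab f -> msym s (Asym f p) = (-1) ^+ s *: Asym f p.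
Proof.
move=> hs; rewrite /Asym [in RHS](reindex_inj (mulIg s)) /= scaler_sumr raddf_sum.
apply: eq_big => t; rewrite ?stabMr // msymMm => _.
by rewrite /= msymZ scalerA odd_permM signr_addb mulrCA -signr_addb addbb mulr1.
Qed.

Lemma stabJ f (g s : 'S_m) : (s \in stab (fun i => f (g^-1%g i))) = ((g * s * g^-1)%g \in stab f).
Proof.
apply/stabP/stabP => h i; rewrite ?permM.
  by rewrite h permK.
by have := h (g^-1%g i); rewrite !permM permKV.
Qed.

Lemma msym_SymJ f (g : 'S_m) p : msym g (Sym f p) = Sym (fun i => f (g^-1%g i)) (msym g p).
Proof.
rewrite /Sym raddf_sum /= [LHS](reindex_inj (conjg_inj g^-1%g)) /=.
apply: eq_big => s; first by rewrite stabJ conjgE invgK mulgA.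
by rewrite conjgE invgK -!msymMm !mulgA mulgKV.
Qed.

Lemma msym_AsymJ f (g : 'S_m) p : msym g (Asym f p) = Asym (fun i => f (g^-1%g i)) (msym g p).
Proof.
rewrite /Asym raddf_sum /= [LHS](reindex_inj (conjg_inj g^-1%g)) /=.
apply: eq_big => s; first by rewrite stabJ conjgE invgK mulgA.
rewrite msymZ conjgE invgK -!msymMm !mulgA mulgKV !odd_permM odd_permV.
by rewrite addbAC addbb.
Qed.

Lemma Sym_Sym f p : Sym f (Sym f p) = #|stab f|%:R *: Sym f p.
Proof.
rewrite {1}/Sym (eq_bigr (fun=> Sym f p)) => [|t ht]; last exact: msym_Sym.
by rewrite sumr_const scaler_nat.
Qed.

Lemma eq_opp_mpoly0 p : p = - p -> p = 0.
Proof.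
move=> e; apply/mpolyP => a; rewrite mcoeff0.
have := congr1 (mcoeff a) e; rewrite mcoeffN => /eqP.
by rewrite -addr_eq0 -mulr2n mulrn_eq0 => /eqP.
Qed.

Lemma Asym_anti f p (u v : 'I_m) : u != v -> f u = f v -> msym (tperm u v) p = p -> Asym f p = 0.
Proof.
move=> uv fuv e; apply: eq_opp_mpoly0.
by rewrite -{1}e Asym_msym ?tperm_stab // odd_tperm uv expr1 scaleN1r.
Qed.

Lemma Asym_Sym0 f g p (u v : 'I_m) : u != v -> f u = f v -> g u = g v ->
  Asym f (Sym g p) = 0.
Proof. by move=> uv fuv guv; apply: (Asym_anti uv fuv); rewrite msym_Sym ?tperm_stab. Qed.

Lemma Sym_Asym0 f g p (u v : 'I_m) : u != v -> f u = f v -> g u = g v ->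
  Sym g (Asym f p) = 0.
Proof.
move=> uv fuv guv; apply: eq_opp_mpoly0.
rewrite -{1}(@Sym_msym g (tperm u v)) ?tperm_stab //.
by rewrite msym_Asym ?tperm_stab // odd_tperm uv expr1 scaleN1r raddfN.
Qed.

Definition dot b p q : rat := \sum_(a : 'X_{1..m < b}) p@_a * q@_a.

Lemma dotC b p q : dot b p q = dot b q p.
Proof. by apply: eq_bigr => a _; rewrite mulrC. Qed.

Lemma dot0l b q : dot b 0 q = 0.
Proof. by rewrite /dot big1 // => a _; rewrite mcoeff0 mul0r. Qed.

Lemma dotDl b p1 p2 q : dot b (p1 + p2) q = dot b p1 q + dot b p2 q.
Proof. by rewrite /dot -big_split; apply: eq_bigr => a _; rewrite mcoeffD mulrDl. Qed.

Lemma dotZl b c p q : dot b (c *: p) q = c * dot b p q.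
Proof. by rewrite /dot mulr_sumr; apply: eq_bigr => a _; rewrite mcoeffZ mulrA. Qed.

Lemma dotZr b c p q : dot b p (c *: q) = c * dot b p q.
Proof. by rewrite dotC dotZl dotC. Qed.

Lemma dot_suml b I (r : seq I) (P : pred I) F q :
  dot b (\sum_(i <- r | P i) F i) q = \sum_(i <- r | P i) dot b (F i) q.
Proof.
elim/big_rec2: _ => [|i y1 y2 _ <-]; first exact: dot0l.
exact: dotDl.
Qed.

Lemma dot_sumr b I (r : seq I) (P : pred I) F q :
  dot b q (\sum_(i <- r | P i) F i) = \sum_(i <- r | P i) dot b q (F i).
Proof. by rewrite dotC dot_suml; apply: eq_bigr => i _; rewrite dotC. Qed.

Lemma dot_msym b s p q : dot b (msym s p) q = dot b p (msym s^-1%g q).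
Proof.
have hb (a : 'X_{1..m < b}) : (mdeg [multinom (a : 'X_{1..m}) (s^-1%g i) | i < m] < b)%N.
  by rewrite mdeg_mperm bmdeg.
rewrite /dot (reindex_inj (h := fun a => BMultinom (hb a))) /=.
  by apply: eq_bigr => a _; rewrite !mcoeff_sym mpermK.
by move=> a a' /(congr1 (@bmnm _ _)) /= /mperm_inj h; apply: val_inj.
Qed.

Lemma dot_Sym b f p q : dot b (Sym f p) q = dot b p (Sym f q).
Proof.
rewrite /Sym dot_suml dot_sumr [RHS](reindex_inj invg_inj) /=.
by apply: eq_big => s; rewrite ?stabV // dot_msym.
Qed.

Lemma dot_Asym b f p q : dot b (Asym f p) q = dot b p (Asym f q).
Proof.
rewrite /Asym dot_suml dot_sumr [RHS](reindex_inj invg_inj) /=.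
by apply: eq_big => s; rewrite ?stabV // dotZl dotZr odd_permV dot_msym.
Qed.

Lemma dot_eq0 b p : (msize p <= b)%N -> dot b p p = 0 -> p = 0.
Proof.
move=> sz /eqP; rewrite psumr_eq0 => [/allP h|a _]; last by rewrite -expr2 sqr_ge0.
apply/mpolyP => a; rewrite mcoeff0; apply/eqP; apply: contraT => nz.
have lt : (mdeg a < b)%N by apply: leq_trans sz; apply: msize_mdeg_lt; rewrite mcoeff_msupp.
by have /= := h (BMultinom lt) (mem_index_enum _); rewrite mulf_eq0 orbb (negbTE nz).
Qed.

Lemma msize_msym s p : (msize (msym s p) <= msize p)%N.
Proof.
rewrite [X in (X <= _)%N]msizeE; apply/bigmax_leqP_seq => a; rewrite mcoeff_msupp mcoeff_sym => h _.
by rewrite -(mdeg_mperm a s); apply: msize_mdeg_lt; rewrite mcoeff_msupp.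
Qed.

Lemma msize_le_sum b I (r : seq I) (P : pred I) (F : I -> {mpoly rat[m]}) :
  (forall i, P i -> (msize (F i) <= b)%N) -> (msize (\sum_(i <- r | P i) F i) <= b)%N.
Proof.
move=> h; elim/big_rec: _ => [|i p Pi hp]; first by rewrite msize0.
by apply: leq_trans (msizeD_le _ _) _; rewrite geq_max h.
Qed.

Lemma msize_Sym f p : (msize (Sym f p) <= msize p)%N.
Proof. by apply: msize_le_sum => s _; apply: msize_msym. Qed.

Lemma msize_Asym f p : (msize (Asym f p) <= msize p)%N.
Proof.
apply: msize_le_sum => s _; apply: leq_trans (msizeZ_le _ _) _; exact: msize_msym.
Qed.

End Operators.

Local Open Scope nat_scope.

Definition young m (r c : 'I_m -> nat) :=
  (forall u v, r u = r v -> c u = c v -> u = v) /\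
  (forall u i j, i <= r u -> j <= c u -> exists v, r v = i /\ c v = j).

Lemma card_le_inj m (S : {set 'I_m}) (h : 'I_m -> nat) k :
  {in S &, injective h} -> (forall u, u \in S -> h u < k) -> #|S| <= k.
Proof.
move=> inj lt; rewrite cardE -(size_map h) -(size_iota 0 k).
apply: uniq_leq_size.
  by rewrite map_inj_in_uniq ?enum_uniq // => u v; rewrite !mem_enum; apply: inj.
by move=> _ /mapP[u + ->]; rewrite mem_enum mem_iota => /lt.
Qed.

Lemma young_column m (r c : 'I_m -> nat) u i : young r c ->
  i < #|[set v | c v == c u]| -> exists v, c v = c u /\ r v = i.
Proof.
move=> [inj dn] lt.
have [/existsP[v /andP[/eqP cv rv]]|/existsPn no] :=
    boolP [exists v, (c v == c u) && (i <= r v)].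
  by have [w [rw cw]] := dn v i (c v) rv (leqnn _); exists w; rewrite cw.
suff : #|[set v | c v == c u]| <= i by rewrite leqNgt lt.
apply: (@card_le_inj _ _ r) => [x y|x]; rewrite !inE.
  by move=> /eqP cx /eqP cy e; apply: inj; rewrite ?cx ?cy.
by move=> cx; have := no x; rewrite cx /= -ltnNge.
Qed.

Lemma young_sort m (r c r' : 'I_m -> nat) : young r c ->
  (forall u v, u != v -> c u = c v -> r' u != r' v) ->
  exists2 s : 'S_m, s \in stab c &
    (forall u v, c u = c v -> r u < r v -> r' (s u) < r' (s v)) /\
    (forall u, r u <= r' (s u)).
Proof.
move=> yo ne; have [inj dn] := yo.
pose lo u := [set v | (c v == c u) && (r' v < r' u)].
have k_le u : #|lo u| <= r' u.
  apply: (@card_le_inj _ _ r') => [x y|x]; rewrite !inE; last by case/andP.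
  move=> /andP[/eqP cx _] /andP[/eqP cy _] e; apply/eqP; apply: contraT => xy.
  by have := ne x y xy; rewrite cx cy e eqxx => /(_ erefl).
have k_lt u : #|lo u| < #|[set v | c v == c u]|.
  apply: proper_card; apply/properP; split.
    by apply/subsetP => v; rewrite !inE => /andP[].
  by exists u; rewrite !inE ?eqxx ?ltnn.
pose f u := odflt u [pick v | (c v == c u) && (r v == #|lo u|)].
have fP u : c (f u) = c u /\ r (f u) = #|lo u|.
  rewrite /f; case: pickP => [v /andP[/eqP ? /eqP ?]//|no].
  have [v [cv rv]] := young_column yo (k_lt u).
  by have := no v; rewrite cv rv !eqxx.
have aux x y : c x = c y -> r' x < r' y -> #|lo x| < #|lo y|.
  move=> cxy lt; apply: proper_card; apply/properP; split.
    apply/subsetP => z; rewrite !inE cxy => /andP[-> h] /=; exact: ltn_trans lt.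
  by exists x; rewrite !inE ?cxy ?eqxx ?ltnn.
have finj : injective f.
  move=> u v e; have [cu ru] := fP u; have [cv rv] := fP v.
  have cuv : c u = c v by rewrite -cu e cv.
  have kuv : #|lo u| = #|lo v| by rewrite -ru e rv.
  apply/eqP; apply: contraT => uv; have := ne u v uv cuv.
  rewrite neq_ltn => /orP[] h; first by have := aux _ _ cuv h; rewrite kuv ltnn.
  by have := aux _ _ (esym cuv) h; rewrite kuv ltnn.
pose s := (perm finj)^-1%g.
have sK u : f (s u) = u by rewrite -(permE finj) permKV.
have hs : s \in stab c by rewrite stabV; apply/stabP => u; rewrite permE; have [] := fP u.
have ks u : #|lo (s u)| = r u by have [_ <-] := fP (s u); rewrite sK.
exists s => //; split=> [u v cuv lt|u]; last by rewrite -ks.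
have csuv : c (s u) = c (s v) by move/stabP: hs => hs; rewrite !hs.
rewrite ltnNge leq_eqVlt negb_or -leqNgt; apply/andP; split.
  rewrite eq_sym; apply: ne => //; rewrite (inj_eq perm_inj).
  by apply: contraTneq lt => ->; rewrite ltnn.
by rewrite leqNgt; apply/negP => /(aux _ _ (esym csuv)); rewrite !ks ltnNge ltnW.
Qed.

(* The i-th smallest value of r' on a column is at least i; sorting each column
   by r' settles the case of equality. *)
Lemma young_sum_row m (r c r' : 'I_m -> nat) : young r c ->
  (forall u v, u != v -> c u = c v -> r' u != r' v) ->
  \sum_u r u <= \sum_u r' u /\ (\sum_u r u = \sum_u r' u ->
    exists2 s : 'S_m, s \in stab c & forall u, r' (s u) = r u).
Proof.
move=> yo ne; have [s hs [_ le]] := young_sort yo ne.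
have e : \sum_u r' u = \sum_u r' (s u) by rewrite (reindex_inj (@perm_inj _ s)).
rewrite e; split; first by apply: leq_sum => u _; apply: le.
move=> e'; exists s => // u; apply/eqP; rewrite eqn_leq le andbT leqNgt; apply/negP => lt.
suff : \sum_u r u < \sum_u r' (s u) by rewrite e' ltnn.
rewrite (bigD1 u) //= [X in _ < X](bigD1 u) //= -addSn leq_add //.
by apply: leq_sum => v _; apply: le.
Qed.

Lemma uniq_flatten_nth (A : eqType) (T : seq (seq A)) i j u : uniq (flatten T) ->
  u \in nth [::] T i -> u \in nth [::] T j -> i = j.
Proof.
elim: T i j => [|r T' IH] i j; first by rewrite nth_nil.
rewrite /= cat_uniq => /and3P[_ /hasPn no uT'].
have nin k : u \in nth [::] T' k -> u \notin r.
  move=> uk; apply: no; apply/flattenP; exists (nth [::] T' k) => //.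
  by apply: mem_nth; rewrite ltnNge; apply/negP => h; rewrite nth_default in uk.
case: i j => [|i] [|j] //=.
- by move=> ur /nin; rewrite ur.
- by move=> /nin ur ur'; rewrite ur' in ur.
by move=> h1 h2; rewrite (IH i j).
Qed.

Lemma uniq_nth_flatten (A : eqType) (T : seq (seq A)) i :
  uniq (flatten T) -> uniq (nth [::] T i).
Proof.
elim: T i => [|r T' IH] i; first by rewrite nth_nil.
by rewrite /= cat_uniq => /and3P[ur _ uT']; case: i => //= i; apply: IH.
Qed.

Section Filling.
Variables (m : nat) (lam : seq nat) (T : seq (seq 'I_m)).
Hypotheses (hl : is_part lam) (hT : is_filling lam T).

Let sh : shape T = lam. Proof. by case/andP: hT => /eqP. Qed.
Let pT : perm_eq (flatten T) (enum 'I_m). Proof. by case/andP: hT. Qed.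

Lemma row_size i : size (nth [::] T i) = nth 0 lam i.
Proof. by rewrite -nth_shape sh. Qed.

Lemma has_row u : has (fun r => u \in r) T.
Proof.
have : u \in flatten T by rewrite (perm_mem pT) mem_enum.
by case/flattenP => r rT ur; apply/hasP; exists r.
Qed.

Lemma mem_row u : u \in nth [::] T (row_of T u).
Proof. exact: (nth_find [::] (has_row u)). Qed.

Lemma col_lt u : col_of T u < nth 0 lam (row_of T u).
Proof. by rewrite -row_size index_mem mem_row. Qed.

Lemma nth_box u x0 : nth x0 (nth [::] T (row_of T u)) (col_of T u) = u.
Proof. exact: nth_index (mem_row u). Qed.

Let uT : uniq (flatten T). Proof. by rewrite (perm_uniq pT) enum_uniq. Qed.

Lemma box_nth i j x0 : j < nth 0 lam i ->
  row_of T (nth x0 (nth [::] T i) j) = i /\ col_of T (nth x0 (nth [::] T i) j) = j.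
Proof.
rewrite -row_size => lt; have ui := mem_nth x0 lt.
have er := uniq_flatten_nth uT (mem_row _) ui; split=> //.
by rewrite /col_of er index_uniq // uniq_nth_flatten.
Qed.

Lemma box_exists i j : j < nth 0 lam i -> exists u, row_of T u = i /\ col_of T u = j.
Proof.
move=> lt; have lt' := lt; rewrite -row_size in lt'.
case e : (nth [::] T i) lt' => [//|x0 r] _.
by exists (nth x0 (nth [::] T i) j); apply: box_nth.
Qed.

Lemma young_filling : young (row_of T) (col_of T).
Proof.
split=> [u v er ec|u i j hi hj].
  by rewrite -(nth_box u u) -(nth_box v u) er ec.
apply: box_exists; apply: leq_ltn_trans hj _; apply: leq_trans (col_lt u) _.
exact: part_le.
Qed.

Lemma card_row i : #|[set u | row_of T u == i]| = nth 0 lam i.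
Proof.
have -> : [set u | row_of T u == i] = [set u in nth [::] T i].
  apply/setP => u; rewrite !inE; apply/eqP/idP => [<-|h]; first exact: mem_row.
  exact: uniq_flatten_nth uT (mem_row u) h.
by rewrite cardsE -row_size; apply/card_uniqP; apply: uniq_nth_flatten.
Qed.

End Filling.

Lemma filling_perm m lam (T T' : seq (seq 'I_m)) : is_part lam ->
  is_filling lam T -> is_filling lam T' ->
  exists p : 'S_m, forall u, row_of T' (p u) = row_of T u /\ col_of T' (p u) = col_of T u.
Proof.
move=> hl hT hT'.
pose f u := nth u (nth [::] T' (row_of T u)) (col_of T u).
have fP u : row_of T' (f u) = row_of T u /\ col_of T' (f u) = col_of T u.
  exact: (box_nth hT') (col_lt hT u).
have finj : injective f.
  move=> u v e; have [r1 c1] := fP u; have [r2 c2] := fP v.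
  by apply: (young_filling hl hT).1; rewrite -?r1 -?c1 e.
by exists (perm finj) => u; rewrite permE.
Qed.

Lemma part_eq_rows m lam mu (T T' : seq (seq 'I_m)) (s : 'S_m) : is_part lam -> is_part mu ->
  is_filling lam T -> is_filling mu T' -> (forall u, row_of T' (s u) = row_of T u) -> lam = mu.
Proof.
move=> hl hm hT hT' e; apply: boxes_inj => // -[i j]; rewrite !mem_boxes /=.
rewrite -(card_row hT) -(card_row hT').
rewrite (_ : [set u | row_of T u == i] = s @^-1: [set u | row_of T' u == i]).
  by rewrite card_preimset //; apply: perm_inj.
by apply/setP => u; rewrite !inE e.
Qed.

Lemma count_iota_down (P : pred nat) K j : (forall i, P i.+1 -> P i) ->
  (j < count P (iota 0 K)) = (j < K) && P j.
Proof.
move=> dn; elim: K => // K IH.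
rewrite -{1}(addn1 K) iotaD count_cat /= add0n addn0 ltnS.
have dn' i k : i <= k -> P k -> P i.
  by move/subnK <-; elim: (k - i) => // d IHd /dn /IHd.
have [PK|nPK] := boolP (P K).
  have -> : count P (iota 0 K) = K.
    transitivity (size (iota 0 K)); last by rewrite size_iota.
    apply/eqP; rewrite -all_count; apply/allP => i; rewrite mem_iota add0n => /andP[_ h].
    exact: dn' (ltnW h) PK.
  rewrite addn1 ltnS; case: leqP => // h; exact/esym/(dn' _ _ h).
rewrite addn0 IH [in RHS]leq_eqVlt; have [->|_] := eqVneq j K; last by [].
by rewrite ltnn (negbTE nPK).
Qed.

Lemma filling_of_columns m (c : 'I_m -> nat) :
  (forall j, #|[set u | c u == j.+1]| <= #|[set u | c u == j]|) ->
  exists lam T, [/\ is_part_of m lam, is_filling lam T & forall u, col_of T u = c u].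
Proof.
move=> dec; case: m c dec => [|m] c dec.
  exists [::], [::]; split=> //; last by case.
  by rewrite /is_filling /= (size0nil (size_enum_ord 0)).
pose col j := enum [set u | c u == j].
have szc j : size (col j) = #|[set u | c u == j]| by rewrite cardE.
pose K := (\max_u c u).+1.
have cK u : c u < K by rewrite ltnS leq_bigmax.
pose len i := count (fun j => i < size (col j)) (iota 0 K).
have lenE i j : (j < len i) = (j < K) && (i < size (col j)).
  by apply: count_iota_down => k; rewrite !szc => h; apply: leq_trans h (dec k).
pose el i j := nth ord0 (col j) i.
pose T := [seq [seq el i j | j <- iota 0 (len i)] | i <- iota 0 (size (col 0))].
have elc i j : i < size (col j) -> c (el i j) = j.
  by move=> lt; have := mem_nth ord0 lt; rewrite mem_enum inE => /eqP.
have uc j : uniq (col j) by rewrite enum_uniq.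
have dec' i j : i <= j -> size (col j) <= size (col i).
  by move/subnK <-; elim: (j - i) => // d; apply: leq_trans; rewrite !szc addSn.
have rowT i : nth [::] T i = [seq el i j | j <- iota 0 (len i)].
  have [lt|ge] := ltnP i (size (col 0)); first by rewrite (nth_map 0) ?size_iota // nth_iota.
  rewrite nth_default ?size_map ?size_iota //.
  suff -> : len i = 0 by [].
  apply/eqP; rewrite -leqn0 leqNgt lenE; apply/negP => /andP[_ h].
  by have := leq_trans h ge; rewrite ltnn.
have shT i : nth 0 (shape T) i = len i by rewrite nth_shape rowT size_map size_iota.
have colu u : u \in col (c u) by rewrite mem_enum inE.
have pT : perm_eq (flatten T) (enum 'I_m.+1).
  apply: uniq_perm; rewrite ?enum_uniq //.
    apply: allpairs_uniq_dep; first exact: iota_uniq.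
      by move=> i _; apply: iota_uniq.
    move=> [i j] [k l] /allpairsPdep[i1 [j1 [_ + [-> ->]]]] /allpairsPdep[k1 [l1 [_ + [-> ->]]]] /=.
    rewrite !mem_iota !add0n !lenE => /andP[_ /andP[_ h1]] /andP[_ /andP[_ h2]] e.
    have ej : j1 = l1 by rewrite -(elc _ _ h1) e elc.
    rewrite -ej in h2 e *; congr existT.
    by move/eqP: e; rewrite /el nth_uniq // => /eqP->.
  move=> u; rewrite mem_enum; apply/flattenP.
  exists (nth [::] T (index u (col (c u)))).
    apply: mem_nth; rewrite size_map size_iota; apply: leq_trans (dec' 0 (c u) _) => //.
    by rewrite index_mem.
  rewrite rowT; apply/mapP; exists (c u); last by rewrite /el nth_index.
  by rewrite mem_iota add0n lenE cK index_mem colu.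
have hl : is_part (shape T).
  apply/is_partP; split=> i.
    rewrite !shT leqNgt; apply/negP; rewrite lenE => /andP[lK h].
    have : len i < len i by rewrite {2}/len lenE lK ltnW.
    by rewrite ltnn.
  by rewrite !size_map size_iota shT lenE => ->.
have hT : is_filling (shape T) T by rewrite /is_filling eqxx.
exists (shape T), T; split=> //.
  by rewrite /is_part_of hl -size_flatten (perm_size pT) size_enum_ord eqxx.
move=> u; have iu : index u (col (c u)) < size (col (c u)) by rewrite index_mem.
have lt : c u < len (index u (col (c u))) by rewrite lenE cK.
have := @box_nth _ _ T hT (index u (col (c u))) (c u) ord0.
rewrite shT => /(_ lt); rewrite rowT (nth_map 0) ?size_iota // nth_iota // add0n.
by rewrite /el nth_index // => -[].
Qed.

Local Open Scope ring_scope.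

(** * Exchange relations and straightening *)

Definition anti m (c : 'I_m -> nat) (f : {mpoly rat[m]}) :=
  forall s : 'S_m, s \in stab c -> msym s f = (-1) ^+ s *: f.

Definition exchange_rel m (c : 'I_m -> nat) (f : {mpoly rat[m]}) :=
  forall j y, (j < c y)%N -> \sum_(x | c x == j) msym (tperm x y) f = f.

Definition recolumn m (c : 'I_m -> nat) y j := fun u => if u == y then j else c u.

Lemma anti_Asym m (c : 'I_m -> nat) f : anti c (Asym c f).
Proof. by move=> s; apply: msym_Asym. Qed.

Lemma anti_tperm m (c : 'I_m -> nat) f u v : anti c f -> u != v -> c u = c v ->
  msym (tperm u v) f = - f.
Proof. by move=> h uv cuv; rewrite h ?tperm_stab // odd_tperm uv expr1 scaleN1r. Qed.

(* Coset decomposition of the stabilizer of the new columns: s is determined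
   up to a permutation fixing y by the element s y. *)
Lemma Asym_recolumn m (c : 'I_m -> nat) f y j : anti c f -> j != c y ->
  Asym (recolumn c y j) f =
  #|[set s in stab (recolumn c y j) | s y == y]|%:R *:
    (f - \sum_(x | c x == j) msym (tperm x y) f).
Proof.
move=> hf ne; set c' := recolumn c y j; set H := [set s in _ | _].
have cy : c' y = j by rewrite /c' /recolumn eqxx.
have cn u : u != y -> c' u = c u by rewrite /c' /recolumn => /negbTE->.
have HE s : (s \in H) = (s \in stab c') && (s y == y) by rewrite /H in_set.
have Hc s : s \in H -> s \in stab c.
  rewrite HE => /andP[/stabP hs /eqP sy]; apply/stabP => u.
  have [->|nu] := eqVneq u y; first by rewrite sy.
  rewrite -(cn u nu) -hs cn //.
  by apply: contraNneq nu => e; apply/eqP/(@perm_inj _ s); rewrite e sy.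
rewrite /Asym (partition_big (fun s : 'S_m => s y) (fun x => c' x == j)) /=; last first.
  by move=> s /stabP hs; rewrite hs cy.
have fib x : c' x == j -> \sum_(s in stab c' | s y == x) (-1) ^+ s *: msym s f =
    #|H|%:R *: ((-1) ^+ (tperm x y) *: msym (tperm x y) f).
  move=> /eqP cx; rewrite (reindex_inj (mulIg (tperm x y))) /=.
  transitivity (\sum_(s in H) (-1) ^+ (tperm x y) *: msym (tperm x y) f); last first.
    by rewrite sumr_const scaler_nat.
  apply: eq_big => [s|s].
    rewrite stabMr ?tperm_stab ?cx ?cy // HE permM; congr (_ && _).
    by rewrite -{2}[x](tpermR x y) (inj_eq perm_inj).
  case/andP=> hs hy; have /Hc hc : s \in H.
    move: hs hy; rewrite stabMr ?tperm_stab ?cx ?cy // HE permM => -> /=.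
    by rewrite -{2}[x](tpermR x y) (inj_eq perm_inj).
  rewrite msymMm hf // msymZ scalerA odd_permM signr_addb.
  by rewrite mulrAC -signr_addb addbb mul1r.
rewrite (eq_bigr _ fib) -scaler_sumr; congr (_ *: _).
rewrite (bigD1 y) ?cy //= tperm1 odd_perm1 expr0 scale1r msym1m; congr (_ + _).
rewrite -sumrN; apply: eq_big => x.
  have [->|nx] := eqVneq x y; first by rewrite andbF eq_sym (negbTE ne).
  by rewrite andbT cn.
by case/andP=> _ nx; rewrite odd_tperm nx expr1 scaleN1r.
Qed.

Lemma exchange_of_recolumn m (c : 'I_m -> nat) f : anti c f ->
  (forall y j, (j < c y)%N -> Asym (recolumn c y j) f = 0) -> exchange_rel c f.
Proof.
move=> hf h0 j y lt; have := h0 y j lt; rewrite Asym_recolumn ?(ltn_eqF lt) //.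
move/eqP; rewrite scaler_eq0 pnatr_eq0 => /orP[|]; last by rewrite subr_eq0 => /eqP.
rewrite cards_eq0 => /eqP/setP/(_ 1%g); rewrite !inE perm1 eqxx andbT.
by move=> /forallP; case=> u; rewrite perm1.
Qed.

Lemma anti0 m (c : 'I_m -> nat) : anti c 0.
Proof. by move=> s _; rewrite msym0 scaler0. Qed.

Lemma antiD m (c : 'I_m -> nat) f g : anti c f -> anti c g -> anti c (f + g).
Proof. by move=> hf hg s hs; rewrite msymD hf // hg // scalerDr. Qed.

Lemma antiZ m (c : 'I_m -> nat) k f : anti c f -> anti c (k *: f).
Proof. by move=> hf s hs; rewrite msymZ hf // !scalerA mulrC. Qed.

Lemma exchange0 m (c : 'I_m -> nat) : exchange_rel c 0.
Proof. by move=> j y _; rewrite big1 // => x _; rewrite msym0. Qed.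

Lemma exchangeD m (c : 'I_m -> nat) f g :
  exchange_rel c f -> exchange_rel c g -> exchange_rel c (f + g).
Proof.
move=> hf hg j y h; rewrite -{2}(hf j y h) -{2}(hg j y h) -big_split /=.
by apply: eq_bigr => x _; rewrite msymD.
Qed.

Lemma exchangeZ m (c : 'I_m -> nat) k f : exchange_rel c f -> exchange_rel c (k *: f).
Proof.
move=> hf j y h; rewrite -{2}(hf j y h) scaler_sumr.
by apply: eq_bigr => x _; rewrite msymZ.
Qed.

Lemma exchange_epsilon m (r c : 'I_m -> nat) p : young r c ->
  exchange_rel c (Asym c (Sym r p)).
Proof.
move=> [inj dn]; apply: exchange_of_recolumn; first exact: anti_Asym.
move=> y j lt; rewrite [X in Asym _ X]/Asym linear_sum big1 // => s /stabP hs.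
rewrite linearZ /= msym_SymJ.
have hs' u : c (s^-1%g u) = c u by rewrite -{2}(permKV s u) hs.
have [|x [rx cx]] := dn (s^-1%g y) (r (s^-1%g y)) j (leqnn _).
  by rewrite hs' ltnW.
rewrite (@Asym_Sym0 _ _ _ _ y (s x)) ?scaler0 //.
- by apply: contraTneq lt => ->; rewrite hs cx ltnn.
- rewrite /recolumn eqxx; case: eqP => // _; by rewrite hs cx.
by rewrite permK rx.
Qed.

Section Exchange.
Variables (m : nat) (c : 'I_m -> nat) (f : {mpoly rat[m]}) (j j' : nat).
Hypotheses (fa : anti c f) (fr : exchange_rel c f) (jj' : (j < j')%N).

Fixpoint uniq_words (X : seq 'I_m) k : seq (seq 'I_m) :=
  if k is k'.+1 then [seq x :: xs | xs <- uniq_words X k', x <- [seq x <- X | x \notin xs]]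
  else [:: [::]].

Lemma uniq_wordsP X k xs : xs \in uniq_words X k ->
  [/\ uniq xs, size xs = k & {subset xs <= X}].
Proof.
elim: k xs => [|k IH] xs; first by rewrite inE => /eqP->.
case/allpairsPdep => ys [x [/IH[uy sy hy] + ->]].
rewrite mem_filter => /andP[nx xX]; split; rewrite /= ?nx ?sy //.
by move=> z; rewrite inE => /orP[/eqP->|/hy].
Qed.

Definition tperms (xs ys : seq 'I_m) : 'S_m :=
  foldr (fun p g => tperm p.1 p.2 * g)%g 1%g (zip xs ys).

Lemma tperm3 (x y z : 'I_m) : x != y -> x != z -> y != z ->
  (tperm x y * tperm x z = tperm y z * tperm x y)%g.
Proof.
move=> xy xz yz; apply/permP => u; rewrite !permM.
case: (tpermP x y u) => [->|->|ux uy].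
- by rewrite [tperm y z x]tpermD 1?eq_sym // tpermL tpermD // eq_sym.
- by rewrite tpermL tpermL tpermD // eq_sym.
- case: (tpermP y z u) => [e|->|_ uz] //.
    by rewrite tpermR tpermR.
  by rewrite !tpermD // eq_sym; apply/eqP.
Qed.

Lemma tpermC (x y z t : 'I_m) : x != z -> x != t -> y != z -> y != t ->
  (tperm x y * tperm z t = tperm z t * tperm x y)%g.
Proof.
move=> xz xt yz yt; have := tpermJ z t (tperm x y).
rewrite !tpermD // 1?eq_sym // conjgE => e.
by rewrite -[RHS](mulKVg (tperm x y)) e.
Qed.

Lemma tperms_replace (xs ys : seq 'I_m) y i : size xs = size ys -> (i < size xs)%N ->
  uniq xs -> uniq (y :: ys) -> (forall x, x \in xs -> x \notin y :: ys) ->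
  (tperm (nth y xs i) y * tperms xs ys =
   tperm y (nth y ys i) * tperms xs (set_nth y ys i y))%g.
Proof.
rewrite /tperms; elim: xs ys i => [|x xs IH] [|z ys] // [|i] /= [sz] lt /andP[nx ux] /and3P[ny nz uy] dis.
  have := dis x (mem_head _ _); rewrite !inE !negb_or => /and3P[xy xz _].
  move: ny; rewrite inE negb_or => /andP[yz _].
  by rewrite !mulgA tperm3.
have lt' : (i < size ys)%N by rewrite -sz.
have := dis x (mem_head _ _); rewrite !inE !negb_or => /and3P[xy xz xys].
move: ny; rewrite inE negb_or => /andP[yz nyy].
have di u : u \in xs -> u \notin y :: ys.
  move=> ux'; have := dis u; rewrite !inE ux' orbT => /(_ isT); rewrite !negb_or.
  by case/and3P=> -> _ ->.
have ni : nth y xs i \in xs by apply: mem_nth.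
have := dis (nth y xs i); rewrite !inE ni orbT => /(_ isT); rewrite !negb_or => /and3P[_ niz _].
have nix : nth y xs i != x by apply: contraNneq nx => <-.
have nyi : nth y ys i \in ys by apply: mem_nth.
rewrite mulgA tpermC // 1?eq_sym // -mulgA (IH ys i) //; last by rewrite /= nyy.
rewrite mulgA tpermC 1?mulgA // 1?eq_sym //.
  by apply: contraNneq xys => <-.
by apply: contraNneq nz => <-.
Qed.

(* Fulton's quadratic relation: f is the sum of all exchanges of ys with equally
   many letters of column j, each of which occurs k! times on the left. *)
Lemma exchange_words (ys : seq 'I_m) : uniq ys -> (forall y, y \in ys -> c y = j') ->
  \sum_(xs <- uniq_words (enum [set x | c x == j]) (size ys)) msym (tperms xs ys) f
  = (size ys)`!%:R *: f.
Proof.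
set X := enum _; have uX : uniq X by apply: enum_uniq.
have XE x : (x \in X) = (c x == j) by rewrite mem_enum inE.
have [k] := ubnP (size ys); elim: k ys => // k IH [|y ys] /=.
  by rewrite big_seq1 /tperms /= msym1m fact0 scale1r.
rewrite ltnS => szk /andP[ny uy] hc.
have cy : c y = j' by apply: hc; rewrite mem_head.
have cys z : z \in ys -> c z = j' by move=> h; apply: hc; rewrite inE h orbT.
have step xs : xs \in uniq_words X (size ys) ->
    \sum_(x <- [seq x <- X | x \notin xs]) msym (tperms (x :: xs) (y :: ys)) f =
    msym (tperms xs ys) f + \sum_(i < size ys) msym (tperms xs (set_nth y ys i y)) f.
  move=> hxs; have [uxs sxs sub] := uniq_wordsP hxs.
  have e1 : \sum_(x <- X) msym (tperm x y) f = f.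
    by rewrite /X big_enum /=; under eq_bigl do rewrite inE; apply: fr; rewrite cy.
  have e2 : \sum_(x <- [seq x <- X | x \notin xs]) msym (tperm x y) f =
      f - \sum_(x <- xs) msym (tperm x y) f.
    rewrite big_filter -[in X in X - _]e1 [X in _ = X - _](bigID (mem xs)) /=.
    rewrite [X in X + _ - _](_ : _ = \sum_(x <- xs) msym (tperm x y) f).
      by rewrite addrAC subrr add0r.
    rewrite -big_filter; apply: perm_big; apply: uniq_perm => //; first exact: filter_uniq.
    by move=> x; rewrite mem_filter andb_idr //; apply: sub.
  rewrite (eq_bigr (fun x => msym (tperms xs ys) (msym (tperm x y) f))); last first.
    by move=> x _; rewrite /tperms /= msymMm.
  rewrite -raddf_sum e2 raddfB; congr (_ + _).
  rewrite (raddf_sum (msym (tperms xs ys))) -sumrN (big_nth y) big_mkord sxs; apply: eq_bigr => i _ /=.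
  have dis x : x \in xs -> x \notin y :: ys.
    move/sub; rewrite XE => /eqP cx; apply: contraTN jj'.
    by rewrite inE => /orP[/eqP ex|/cys]; rewrite -cx ?ex ?cy ?ltnn // => ->; rewrite ltnn.
  rewrite -msymMm tperms_replace ?sxs //=; last by rewrite ny.
  rewrite msymMm (anti_tperm fa) ?raddfN ?opprK //.
    by apply: contraNneq ny => ->; apply: mem_nth.
  by rewrite cy cys // mem_nth.
rewrite big_allpairs_dep /= big_seq (eq_bigr _ step) -big_seq big_split /= IH //.
rewrite exchange_big /= (eq_bigr (fun=> (size ys)`!%:R *: f)) => [|i _].
  rewrite sumr_const card_ord factS -scaler_nat scalerA -scalerDl; congr (_ *: _).
  by rewrite mulSn natrD natrM.
have szi : size (set_nth y ys i y) = size ys by rewrite size_set_nth; apply/maxn_idPr.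
move: (IH (set_nth y ys i y)); rewrite szi; apply=> //.
  apply/(uniqP y) => a b; rewrite !inE szi => la lb; rewrite !nth_set_nth /=.
  case: eqP => [->|na]; case: eqP => [->|nb] // e.
  - by move: ny; rewrite e mem_nth.
  - by move: ny; rewrite -e mem_nth.
  - by apply/eqP; rewrite -(nth_uniq y la lb uy) e.
move=> z /(nthP y)[a]; rewrite szi nth_set_nth /= => la <-.
by case: eqP => // _; rewrite cys // mem_nth.
Qed.

End Exchange.

Local Open Scope nat_scope.

Local Notation "N # s" := [multinom N (s i) | i < _]
  (at level 40, left associativity, format "N # s").

Section Monomials.
Variable m : nat.
Implicit Types (r c : 'I_m -> nat) (N a : 'X_{1..m}) (s t : 'S_m).

Definition row_mono r c N := forall u v, r u = r v -> c u <= c v -> N u <= N v.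

Definition semistandard r c N :=
  row_mono r c N /\ (forall u v, c u = c v -> r u < r v -> N u < N v).

Definition semistandardb r c N :=
  [forall u, forall v, (r u == r v) && (c u <= c v) ==> (N u <= N v)] &&
  [forall u, forall v, (c u == c v) && (r u < r v) ==> (N u < N v)].

Lemma semistandardP r c N : reflect (semistandard r c N) (semistandardb r c N).
Proof.
apply: (iffP andP) => [[/forallP h1 /forallP h2]|[h1 h2]]; split.
- by move=> u v e le; have /forallP/(_ v) := h1 u; rewrite e eqxx le.
- by move=> u v e lt; have /forallP/(_ v) := h2 u; rewrite e eqxx lt.
- by apply/forallP => u; apply/forallP => v; apply/implyP => /andP[/eqP e le]; apply: h1.
by apply/forallP => u; apply/forallP => v; apply/implyP => /andP[/eqP e lt]; apply: h2.
Qed.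

Lemma row_mono_dec r c N : row_mono r c N \/
  exists u v, [/\ r u = r v, c u <= c v & N v < N u].
Proof.
have [/forallP h|] := boolP [forall u, forall v, (r u == r v) && (c u <= c v) ==> (N u <= N v)].
  by left=> u v e le; have /forallP/(_ v) := h u; rewrite e eqxx le.
rewrite negb_forall => /existsP[u]; rewrite negb_forall => /existsP[v].
rewrite negb_imply -ltnNge => /andP[/andP[/eqP e le] lt].
by right; exists u, v.
Qed.

Lemma row_mono_uniq r c N t : t \in stab r -> row_mono r c N -> row_mono r c (N#t) ->
  N#t = N.
Proof.
have half N1 t1 : t1 \in stab r -> row_mono r c N1 -> row_mono r c (N1#t1) ->
    forall u, N1 u <= N1 (t1 u).
  move=> /stabP ht hN hNt u; rewrite leqNgt; apply/negP => lt.
  pose S := [set v | (r v == r u) && (N1 v <= N1 (t1 u))].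
  pose L := [set v | (r v == r u) && (c v < c u)].
  have SL : S \subset L.
    apply/subsetP => v; rewrite !inE => /andP[/eqP e le]; rewrite e eqxx /= ltnNge.
    by apply/negP => h; have := hN u v (esym e) h; rewrite leqNgt (leq_ltn_trans le lt).
  have LS : L \proper t1 @^-1: S.
    apply/properP; split.
      apply/subsetP => v; rewrite !inE ht => /andP[/eqP e le]; rewrite e eqxx /=.
      by have := hNt v u e (ltnW le); rewrite !mnmE.
    by exists u; rewrite !inE ?ht ?eqxx ?ltnn ?leqnn.
  have := proper_card LS; rewrite card_preimset; last exact: perm_inj.
  by rewrite ltnNge subset_leq_card.
move=> ht hN hNt; apply/mnmP => u; apply/eqP; rewrite eqn_leq mnmE (half N t) // andbT.
have eN : N#t#t^-1%g = N by apply/mnmP => v; rewrite !mnmE permKV.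
have h2 : row_mono r c (N#t#t^-1%g) by rewrite eN.
have := half (N#t) t^-1%g _ hNt h2 u.
by rewrite stabV !mnmE permKV; apply.
Qed.

(* The base exceeds the number of variables, so that the largest exponents in a
   column decide. *)
Definition weight c N := \sum_u c u * m.+1 ^ N u.

Lemma weight_tperm c N (u v : 'I_m) : u != v ->
  weight c (N#tperm u v) + (c u * m.+1 ^ N u + c v * m.+1 ^ N v) =
  weight c N + (c u * m.+1 ^ N v + c v * m.+1 ^ N u).
Proof.
move=> uv; rewrite /weight (bigD1 u) //= (bigD1 v) /=; last by rewrite eq_sym.
rewrite [in RHS](bigD1 u) //= [in RHS](bigD1 v) /=; last by rewrite eq_sym.
rewrite !mnmE tpermL tpermR.
rewrite (eq_bigr (fun w => c w * m.+1 ^ N w)) => [|w /andP[wu wv]]; first by lia.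
by rewrite mnmE tpermD // eq_sym.
Qed.

Lemma weight_col c N s : s \in stab c -> weight c (N#s) = weight c N.
Proof.
move/stabP=> hs; rewrite [RHS]/weight (reindex_inj (@perm_inj _ s)) /=.
by apply: eq_bigr => u _; rewrite mnmE hs.
Qed.

Lemma weight_row r c N t : (forall u v, r u = r v -> c u = c v -> u = v) ->
  row_mono r c N -> t \in stab r ->
  weight c (N#t) <= weight c N /\ (weight c (N#t) = weight c N -> N#t = N).
Proof.
move=> inj hN ht.
have key t1 : t1 \in stab r -> row_mono r c (N#t1) \/
    exists2 t2, t2 \in stab r & weight c (N#t1) < weight c (N#t2).
  move=> h1; have [|[u [v [ruv cuv lt]]]] := row_mono_dec r c (N#t1); [by left|right].
  have uv : u != v by apply: contraTneq lt => ->; rewrite ltnn.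
  have {}cuv : c u < c v.
    rewrite ltn_neqAle cuv andbT; apply: contraNneq uv => e; apply/eqP; exact: inj.
  exists (tperm u v * t1)%g; first by apply: stabM => //; apply: tperm_stab.
  rewrite mpermM; have := weight_tperm c (N#t1) uv.
  have : m.+1 ^ (N#t1) v < m.+1 ^ (N#t1) u.
    by rewrite ltn_exp2l // ltnS (leq_ltn_trans (leq0n _) (ltn_ord u)).
  move=> xy e; have : 0 < (c v - c u) * (m.+1 ^ (N#t1) u - m.+1 ^ (N#t1) v).
    by rewrite muln_gt0 !subn_gt0 cuv.
  rewrite mulnBl !mulnBr; have h3 := leq_mul (leqnn (c u)) (ltnW xy).
  have h4 := leq_mul (leqnn (c v)) (ltnW xy); move: e h3 h4.
  move: (weight _ _) (weight _ _) (c u * _) (c u * _) (c v * _) (c v * _) => *; lia.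
have [t0 ht0 mx] := @arg_maxnP _ (1%g : 'S_m) (mem (stab r)) (fun t => weight c (N#t)) (stab1 r).
have mx' t1 : t1 \in stab r -> weight c (N#t1) <= weight c (N#t0) := mx t1.
have top t1 : t1 \in stab r -> weight c (N#t1) = weight c (N#t0) -> N#t1 = N.
  move=> h1 e1; apply: (row_mono_uniq h1 hN); have [//|[t2 h2]] := key _ h1.
  by rewrite e1 ltnNge (mx' _ h2).
have e0 := top _ ht0 erefl; rewrite e0 in mx' top.
by split; [apply: mx'|apply: top].
Qed.

Lemma col_strict_stab1 r c N s : young r c -> semistandard r c N ->
  s \in stab c -> N#s = N -> s = 1%g.
Proof.
move=> [inj _] [_ hc] /stabP hs e; apply/permP => u; rewrite perm1.
have eN : N (s u) = N u by move/mnmP: e => /(_ u); rewrite mnmE.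
apply: inj; last exact: hs.
apply/eqP; rewrite eqn_leq; apply/andP; split; rewrite leqNgt; apply/negP => lt.
  by have := hc _ _ (esym (hs u)) lt; rewrite eN ltnn.
by have := hc _ _ (hs u) lt; rewrite eN ltnn.
Qed.

Lemma semistandard_col_mono r c N : young r c -> semistandard r c N -> row_mono c r N.
Proof.
move=> [inj _] [_ hc] u v cuv; rewrite leq_eqVlt => /orP[/eqP e|/(hc _ _ cuv)/ltnW//].
by rewrite (inj u v).
Qed.

Local Open Scope ring_scope.

Lemma mcoeff_Asym c (p : {mpoly rat[m]}) N :
  (Asym c p)@_N = \sum_(s in stab c) (-1) ^+ s * p@_(N#s).
Proof. by rewrite raddf_sum; apply: eq_bigr => s _; rewrite /= mcoeffZ mcoeff_sym. Qed.

Lemma mcoeff_Sym r (p : {mpoly rat[m]}) N :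
  (Sym r p)@_N = \sum_(t in stab r) p@_(N#t).
Proof. by rewrite raddf_sum; apply: eq_bigr => s _; rewrite /= mcoeff_sym. Qed.

Definition symX r c a : {mpoly rat[m]} := Asym c (Sym r 'X_[a]).

Lemma symX_supp r c a N : (symX r c a)@_N != 0 ->
  exists s t, [/\ s \in stab c, t \in stab r & N#s#t = a].
Proof.
rewrite mcoeff_Asym => h.
have /existsP[s /andP[hs]] : [exists s : 'S_m, (s \in stab c) && ((Sym r 'X_[a])@_(N#s) != 0)].
  apply: contraNT h; rewrite negb_exists => /forallP h; apply/eqP; rewrite big1 // => s hs.
  by have := h s; rewrite hs negbK => /eqP->; rewrite mulr0.
rewrite mcoeff_Sym => {}h.
have /existsP[t /andP[ht]] : [exists t : 'S_m, (t \in stab r) && (('X_[rat, a])@_(N#s#t) != 0)].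
  apply: contraNT h; rewrite negb_exists => /forallP h; apply/eqP; rewrite big1 // => t ht.
  by have := h t; rewrite ht negbK => /eqP->.
rewrite mcoeffX; case: (a =P _) => [e _|_]; last by rewrite eqxx.
by exists s, t; split.
Qed.

Lemma symX_weight r c a N : young r c -> semistandard r c a -> (symX r c a)@_N != 0 ->
  (weight c N <= weight c a)%N /\ (semistandard r c N -> weight c N = weight c a -> N = a).
Proof.
move=> yo ha /symX_supp[s [t [hs ht e]]].
have e' : N#s = a#t^-1%g by rewrite -e; apply/mnmP => u; rewrite !mnmE permKV.
have ht' : t^-1%g \in stab r by rewrite stabV.
have [le eq] := weight_row yo.1 ha.1 ht'.
rewrite -(weight_col N hs) e'; split; first exact: le.
move=> hN ew; have ea : a#t^-1%g = a by apply: eq ew.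
rewrite ea in e'.
have h1 := semistandard_col_mono yo hN; have h2 := semistandard_col_mono yo ha.
by rewrite -e'; apply/esym; apply: row_mono_uniq hs h1 _; rewrite e'.
Qed.

Lemma symX_diag r c a : young r c -> semistandard r c a ->
  (symX r c a)@_a = #|[set t in stab r | a#t == a]|%:R.
Proof.
move=> yo ha; rewrite mcoeff_Asym (bigD1 1%g) ?stab1 //= [X in _ + X]big1 => [|s /andP[hs s1]].
  rewrite addr0 odd_perm1 expr0 mul1r mcoeff_Sym mperm1.
  rewrite -sum1_card natr_sum (bigID (fun t => a#t == a)) /=.
  rewrite [X in _ + X]big1 ?addr0 => [|t /andP[_ n]]; last by rewrite mcoeffX eq_sym (negbTE n).
  by apply: eq_big => [t|t /andP[_ e]]; [rewrite !inE|rewrite mcoeffX eq_sym e].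
rewrite mcoeff_Sym big1 ?mulr0 // => t ht; rewrite mcoeffX; case: eqP => // e.
have e' : a#s = a#t^-1%g by rewrite {2}e; apply/mnmP => u; rewrite !mnmE permKV.
have ht' : t^-1%g \in stab r by rewrite stabV.
have [_ eq] := weight_row yo.1 ha.1 ht'.
have ea : a#t^-1%g = a by apply: eq; rewrite -e' weight_col.
by case/eqP: s1; apply: (col_strict_stab1 yo ha hs); rewrite e'.
Qed.

Lemma symX_diag_neq0 r c a : young r c -> semistandard r c a -> (symX r c a)@_a != 0.
Proof.
move=> yo ha; rewrite symX_diag // pnatr_eq0 -lt0n card_gt0; apply/set0Pn.
by exists 1%g; rewrite inE stab1 mperm1 eqxx.
Qed.

Lemma symX_free r c (I : eqType) (Is : seq I) (a : I -> 'X_{1..m}) (k : I -> rat) :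
  young r c -> uniq Is -> (forall i, i \in Is -> semistandard r c (a i)) ->
  {in Is &, injective a} ->
  \sum_(i <- Is) k i *: symX r c (a i) = 0 -> forall i, i \in Is -> k i = 0.
Proof.
move=> yo uI ha inj e i0 hi0; apply/eqP; apply: contraT => k0.
have exmax (s : seq I) : s != [::] ->
    exists2 x, x \in s & forall y, y \in s -> (weight c (a y) <= weight c (a x))%N.
  elim: s => // x s IH _; have [->|/IH[z zs hz]] := eqVneq s [::].
    by exists x; rewrite ?mem_head // => y; rewrite inE => /eqP->.
  have [le|lt] := leqP (weight c (a z)) (weight c (a x)).
    exists x; rewrite ?mem_head // => y; rewrite inE => /orP[/eqP->//|/hz h].
    exact: leq_trans h le.
  exists z; rewrite ?inE ?zs ?orbT // => y; rewrite inE => /orP[/eqP->|/hz//].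
  exact: ltnW.
have [|i hi mx] := exmax [seq i <- Is | k i != 0].
  apply/eqP => e0; have : i0 \in [seq i <- Is | k i != 0] by rewrite mem_filter k0.
  by rewrite e0.
move: hi; rewrite mem_filter => /andP[ki hi].
have := congr1 (mcoeff (a i)) e; rewrite mcoeff0 raddf_sum (bigD1_seq i) //= big_seq_cond big1.
  move/eqP; rewrite addr0 mcoeffZ mulf_eq0 (negbTE ki) /=.
  by rewrite (negbTE (symX_diag_neq0 yo (ha _ hi))).
move=> j /andP[hj ji]; rewrite mcoeffZ; have [->|kj] := eqVneq (k j) 0; first by rewrite mul0r.
have [->|nz] := eqVneq ((symX r c (a j))@_(a i)) 0; first by rewrite mulr0.
have [le eq] := symX_weight yo (ha _ hj) nz.
have le' : (weight c (a j) <= weight c (a i))%N by apply: mx; rewrite mem_filter kj.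
case/eqP: ji; apply: inj => //; apply/esym; apply: eq; first exact: ha.
by apply/eqP; rewrite eqn_leq le le'.
Qed.

Lemma tperms_fix (xs ys : seq 'I_m) u : u \notin xs -> u \notin ys -> tperms xs ys u = u.
Proof.
rewrite /tperms; elim: xs ys => [|x xs IH] [|y ys] /=; rewrite ?perm1 //.
rewrite !inE !negb_or => /andP[ux uxs] /andP[uy uys].
by rewrite permM tpermD 1?eq_sym // IH.
Qed.

Lemma weight_tperms c N (xs ys : seq 'I_m) j d : size xs = size ys -> uniq xs -> uniq ys ->
  (forall x, x \in xs -> x \notin ys) ->
  (forall x, x \in xs -> c x = j) -> (forall y, y \in ys -> c y = (j + d)%N) ->
  (weight c (N#tperms xs ys) + d * \sum_(y <- ys) m.+1 ^ N y =
   weight c N + d * \sum_(x <- xs) m.+1 ^ N x)%N.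
Proof.
rewrite /tperms; elim: xs ys => [|x xs IH] [|y ys] //=.
  by move=> *; rewrite mperm1 !big_nil.
move=> [sz] /andP[nx ux] /andP[ny uy] dis hx hy.
have := dis x (mem_head _ _); rewrite inE negb_or => /andP[xy nxy].
have nyx : y \notin xs by apply/negP => h; have := dis y; rewrite !inE h eqxx orbT => /(_ isT).
have fx : (N#tperms xs ys) x = N x by rewrite mnmE tperms_fix.
have fy : (N#tperms xs ys) y = N y by rewrite mnmE tperms_fix.
rewrite mpermM -/(tperms xs ys).
have := weight_tperm c (N#tperms xs ys) xy; rewrite fx fy.
rewrite (hx x) ?mem_head // (hy y) ?mem_head // !big_cons.
have := IH ys sz ux uy; rewrite -/(tperms xs ys) => {}IH.
have h1 z : z \in xs -> z \notin ys.
  by move=> zx; apply/negP => h; have := dis z; rewrite !inE zx h !orbT => /(_ isT).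
have h2 z : z \in xs -> c z = j by move=> zx; apply: hx; rewrite inE zx orbT.
have h3 z : z \in ys -> c z = (j + d)%N by move=> zy; apply: hy; rewrite inE zy orbT.
have := IH h1 h2 h3.
rewrite !mulnDr !mulnDl; move: (weight _ _) (weight _ _) (weight _ _) => w1 w2 w3; lia.
Qed.

End Monomials.

Local Open Scope ring_scope.

Section Straightening.
Variables (m : nat) (r c : 'I_m -> nat).
Hypothesis yo : young r c.

Lemma anti_coeff (f : {mpoly rat[m]}) (N : 'X_{1..m}) s : anti c f -> s \in stab c ->
  f@_(N#s) = (-1) ^+ s * f@_N.
Proof. by move=> hf hs; rewrite -mcoeff_sym hf // mcoeffZ. Qed.

Lemma anti_supp_inj (f : {mpoly rat[m]}) (N : 'X_{1..m}) u v : anti c f -> f@_N != 0 ->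
  u != v -> c u = c v -> N u != N v.
Proof.
move=> hf nz uv cuv; apply: contraNneq nz => e.
have := anti_coeff N hf (tperm_stab cuv); rewrite odd_tperm uv expr1 mulN1r.
have -> : N#tperm u v = N.
  by apply/mnmP => w; rewrite mnmE; case: tpermP => [->|->|].
by move/eqP; rewrite -addr_eq0 -mulr2n mulrn_eq0.
Qed.

Lemma anti_supp_sorted (f : {mpoly rat[m]}) (N : 'X_{1..m}) : anti c f -> f@_N != 0 ->
  exists2 s, s \in stab c & f@_(N#s) != 0 /\
    (forall u v, c u = c v -> (r u < r v)%N -> ((N#s) u < (N#s) v)%N).
Proof.
move=> hf nz; have [|s hs [h _]] := @young_sort m r c (fun u => N u) yo.
  by move=> u v uv cuv; apply: anti_supp_inj hf nz uv cuv.
exists s => //; rewrite anti_coeff // mulf_eq0 signr_eq0 (negbTE nz); split=> //.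
by move=> u v cuv lt; rewrite !mnmE; apply: h.
Qed.

Lemma max_supp_semistandard (f : {mpoly rat[m]}) (N : 'X_{1..m}) :
  anti c f -> exchange_rel c f -> f@_N != 0 ->
  (forall N', f@_N' != 0 -> (weight c N' <= weight c N)%N) ->
  (forall u v, c u = c v -> (r u < r v)%N -> (N u < N v)%N) ->
  semistandard r c N.
Proof.
move=> hf hr nz mx hN; split=> //.
have [//|[u [v [ruv cuv lt]]]] := row_mono_dec r c N.
have [inj dn] := yo.
have {}cuv : (c u < c v)%N.
  by rewrite ltn_neqAle cuv andbT; apply: contraTneq lt => /(inj _ _ ruv) ->; rewrite ltnn.
pose ys := enum [set y | (c y == c v) && (r y <= r v)%N].
have uys : uniq ys by apply: enum_uniq.
have ysP y : y \in ys -> c y = c v /\ (r y <= r v)%N.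
  by rewrite mem_enum inE => /andP[/eqP].
have szys : (r u < size ys)%N.
  rewrite -(size_iota 0 (r u).+1) -(size_map r); apply: uniq_leq_size (iota_uniq _ _) _.
  move=> i; rewrite mem_iota add0n ltnS ruv => /andP[_ hi].
  have [y [ry cy]] := dn v i (c v) hi (leqnn _).
  by apply/mapP; exists y => //; rewrite mem_enum inE cy eqxx ry hi.
have := exchange_words hf hr cuv uys (fun y hy => (ysP y hy).1).
move/(congr1 (mcoeff N)); rewrite mcoeffZ raddf_sum /= big_seq big1.
  by move/esym/eqP; rewrite mulf_eq0 (negbTE nz) orbF pnatr_eq0 eqn0Ngt fact_gt0.
move=> xs hxs; have [uxs sxs sub] := uniq_wordsP hxs.
have xsP x : x \in xs -> c x = c u by move/sub; rewrite mem_enum inE => /eqP.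
rewrite mcoeff_sym; apply/eqP; apply: contraT => /mx; rewrite leqNgt => /negP[].
have dis x : x \in xs -> x \notin ys.
  by move/xsP => cx; apply/negP => /ysP[cy _]; move: cuv; rewrite -cx -cy ltnn.
have ysc y : y \in ys -> c y = (c u + (c v - c u))%N by move/ysP=> [-> _]; rewrite subnKC // ltnW.
have := weight_tperms N sxs uxs uys dis xsP ysc.
have d0 : (0 < c v - c u)%N by rewrite subn_gt0.
have [x hx rx] : exists2 x, x \in xs & (r u <= r x)%N.
  apply/hasP; apply: contraLR szys; rewrite -leqNgt -sxs => /hasPn h.
  rewrite -(size_iota 0 (r u)) -(size_map r); apply: uniq_leq_size.
    rewrite map_inj_in_uniq // => x y hx hy e; apply: inj => //.
    by rewrite (xsP x) ?(xsP y).
  by move=> i /mapP[x hx ->]; rewrite mem_iota add0n /= ltnNge; apply: h.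
have b1 : (1 < m.+1)%N by rewrite ltnS (leq_ltn_trans (leq0n _) (ltn_ord u)).
have lex : (N u <= N x)%N.
  move: rx; rewrite leq_eqVlt => /orP[/eqP e|h]; first by rewrite (inj u x) // xsP.
  by apply: ltnW; apply: hN => //; rewrite xsP.
have ltsum : (\sum_(y <- ys) m.+1 ^ N y < \sum_(x <- xs) m.+1 ^ N x)%N.
  apply: (@leq_trans (m.+1 ^ N x)); last by rewrite (bigD1_seq x) //= leq_addr.
  apply: (@leq_trans (m.+1 ^ (N v).+1)); last by rewrite leq_exp2l // (leq_trans lt).
  apply: (@leq_ltn_trans (\sum_(y <- ys) m.+1 ^ N v)).
    rewrite [X in (X <= _)%N]big_seq [X in (_ <= X)%N]big_seq; apply: leq_sum => y /ysP[cy].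
    rewrite leq_exp2l // leq_eqVlt => /orP[/eqP e|h]; first by rewrite (inj y v).
    by apply: ltnW; apply: hN.
  rewrite big_const_seq count_predT iter_addn_0 expnSr ltn_pmul2l ?expn_gt0 // ltnS.
  by rewrite -[m in (_ <= m)%N]size_enum_ord; apply: uniq_leq_size => // y _; rewrite mem_enum.
move: ltsum; rewrite -(ltn_pmul2l d0).
move: (_ * _)%N (_ * _)%N (weight _ _) (weight _ _) => x1 x2 x3 x4; lia.
Qed.

Lemma straighten b g (f : {mpoly rat[m]}) w : anti c f -> exchange_rel c f ->
  (forall N, f@_N != 0 -> (weight c N < w)%N) ->
  (forall a, semistandard r c a -> dot b (symX r c a) g = 0) ->
  dot b f g = 0.
Proof.
elim: w f => [|w IH] f fa fr fw hg.
  have -> : f = 0 by apply/mpolyP => N; rewrite mcoeff0; apply/eqP; apply: contraT => /fw.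
  exact: dot0l.
pose L := [seq a <- msupp f | semistandardb r c a && (weight c a == w)].
pose k a := - (f@_a / (symX r c a)@_a).
have LP a : a \in L -> semistandard r c a /\ weight c a = w.
  by rewrite mem_filter => /andP[/andP[/semistandardP ha /eqP]].
pose h := \sum_(a <- L) k a *: symX r c a.
have ha : anti c h /\ exchange_rel c h.
  rewrite /h; elim/big_rec: _ => [|a p _ [pa pr]]; first by split; [exact: anti0|exact: exchange0].
  split; first by apply: antiD pa; apply: antiZ; apply: anti_Asym.
  by apply: exchangeD pr; apply: exchangeZ; apply: exchange_epsilon.
have hL N : h@_N != 0 -> exists2 a, a \in L & (symX r c a)@_N != 0.
  rewrite raddf_sum => nz; have /hasP[a aL] : has (fun a => (symX r c a)@_N != 0) L.
    apply: contraNT nz => /hasPn z; rewrite big_seq big1 // => a /z.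
    by rewrite negbK /= mcoeffZ => /eqP->; rewrite mulr0.
  by exists a.
have -> : f = (f + h) - h by rewrite addrK.
rewrite -scaleN1r dotDl dotZl [dot b h g](_ : _ = 0); last first.
  rewrite /h dot_suml big_seq big1 // => a /LP[sa _]; by rewrite dotZl hg // mulr0.
rewrite mulr0 addr0; apply: IH => //.
- exact: antiD ha.1.
- exact: exchangeD ha.2.
have le N : (f + h)@_N != 0 -> (weight c N <= w)%N.
  rewrite mcoeffD; have [->|/fw //] := eqVneq (f@_N) 0; rewrite add0r => /hL[a /LP[sa <-]].
  by move/(symX_weight yo sa) => [].
move=> N nz; rewrite ltn_neqAle le // andbT; apply/eqP => eN.
have fha := antiD fa ha.1.
have [s hs [nz' so]] := anti_supp_sorted fha nz.
have wN : weight c (N#s) = w by rewrite weight_col.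
have ss : semistandard r c (N#s).
  apply: (max_supp_semistandard fha (exchangeD fr ha.2)) => // N' /le.
  by rewrite wN.
case/eqP: nz'; rewrite mcoeffD raddf_sum /=.
have z a : a \in L -> a != N#s -> k a * (symX r c a)@_(N#s) = 0.
  move=> /LP[sa wa] ne; have [->|n0] := eqVneq ((symX r c a)@_(N#s)) 0; first by rewrite mulr0.
  have [_ /(_ ss)] := symX_weight yo sa n0; rewrite wN wa => /(_ erefl) e.
  by rewrite e eqxx in ne.
have [inL|nL] := boolP ((N#s) \in L).
  rewrite (bigD1_seq (N#s)) //=; last by rewrite filter_uniq // msupp_uniq.
  rewrite big_seq_cond big1 ?addr0 => [|a /andP[aL ne]]; last by rewrite mcoeffZ z.
  by rewrite mcoeffZ /k mulNr divfK ?subrr // symX_diag_neq0.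
rewrite big_seq big1 => [|a aL]; last first.
  by rewrite mcoeffZ z //; apply: contraNneq nL => <-.
rewrite addr0; apply/eqP; apply: contraR nL => n0.
by rewrite mem_filter wN eqxx andbT mcoeff_msupp n0 andbT; apply/semistandardP.
Qed.

End Straightening.

Definition expo m (M : tableau) (T : seq (seq 'I_m)) : 'X_{1..m} :=
  [multinom entry M (box_of T i) | i < m].

Lemma p_monE m M (T : seq (seq 'I_m)) : p_mon M T = 'X_[expo M T].
Proof. by rewrite /p_mon mpolyXE_id; apply: eq_bigr => i _; rewrite mnmE. Qed.

Lemma epsilonE m (T : seq (seq 'I_m)) p : epsilon T p = Asym (col_of T) (Sym (row_of T) p).
Proof.
rewrite /epsilon /Asym; apply: eq_bigr => s _.
by rewrite /Sym (raddf_sum (msym s)) scaler_sumr.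
Qed.

Lemma F_polE m M (T : seq (seq 'I_m)) :
  F_pol M T = (s_num M T)%:R^-1 *: symX (row_of T) (col_of T) (expo M T).
Proof. by rewrite /F_pol epsilonE p_monE. Qed.

Lemma s_num_neq0 m M (T : seq (seq 'I_m)) : (s_num M T)%:R != 0 :> rat.
Proof.
rewrite pnatr_eq0 -lt0n card_gt0; apply/set0Pn; exists 1%g.
by rewrite !inE msym1m eqxx andbT; apply/forallP => i; rewrite perm1.
Qed.

Lemma symX_F_pol m M (T : seq (seq 'I_m)) :
  symX (row_of T) (col_of T) (expo M T) = (s_num M T)%:R *: F_pol M T.
Proof. by rewrite F_polE scalerA divff ?scale1r // s_num_neq0. Qed.

Lemma row_of_map m (s : 'S_m) (T : seq (seq 'I_m)) u :
  row_of (map (map s) T) (s u) = row_of T u.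
Proof.
rewrite /row_of find_map; apply: eq_find => x /=.
by rewrite mem_map //; apply: perm_inj.
Qed.

Lemma col_of_map m (s : 'S_m) (T : seq (seq 'I_m)) u :
  col_of (map (map s) T) (s u) = col_of T u.
Proof.
rewrite /col_of row_of_map.
have [lt|ge] := ltnP (row_of T u) (size T).
  by rewrite (nth_map [::]) // index_map //; apply: perm_inj.
by rewrite !nth_default ?size_map.
Qed.

Lemma filling_map m (s : 'S_m) lam (T : seq (seq 'I_m)) :
  is_filling lam T -> is_filling lam (map (map s) T).
Proof.
case/andP=> /eqP sT pT; apply/andP; split.
  by rewrite -sT /shape -map_comp; apply/eqP; apply: eq_map => x /=; rewrite size_map.
rewrite -map_flatten; apply: uniq_perm; rewrite ?enum_uniq //.
  by rewrite map_inj_uniq ?(perm_uniq pT) ?enum_uniq //; apply: perm_inj.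
move=> u; rewrite mem_enum; apply/mapP; exists (s^-1%g u); last by rewrite permKV.
by rewrite (perm_mem pT) mem_enum.
Qed.

Lemma msym_symX m (s : 'S_m) M (T : seq (seq 'I_m)) :
  msym s (symX (row_of T) (col_of T) (expo M T)) =
  symX (row_of (map (map s) T)) (col_of (map (map s) T)) (expo M (map (map s) T)).
Proof.
set T' := map _ T; rewrite /symX msym_AsymJ msym_SymJ msymX.
have er u : row_of T (s^-1%g u) = row_of T' u by rewrite -{2}(permKV s u) row_of_map.
have ec u : col_of T (s^-1%g u) = col_of T' u by rewrite -{2}(permKV s u) col_of_map.
rewrite (eq_Asym _ ec) (eq_Sym _ er); do 3!congr (_ _).
by apply/mnmP => u; rewrite !mnmE /box_of er ec.
Qed.

Section FillingExpo.
Variables (m : nat) (lam : seq nat) (T : seq (seq 'I_m)).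
Hypotheses (hl : is_part lam) (hT : is_filling lam T).

Lemma box_in u : box_of T u \in boxes lam.
Proof. by rewrite mem_boxes /=; apply: col_lt. Qed.

Lemma SSYT_semistandard M : SSYT lam M ->
  semistandard (row_of T) (col_of T) (expo M T).
Proof.
move=> hM; split=> u v e h; rewrite !mnmE /box_of e.
  by apply: (SSYT_row hM) h _; rewrite -e; have := box_in v; rewrite mem_boxes /= e.
by apply: (SSYT_col hl hM) h _; have := box_in v; rewrite mem_boxes.
Qed.

Lemma shape_map_map (f : 'I_m -> nat) : shape (map (map f) T) = lam.
Proof.
case/andP: hT => /eqP <- _; rewrite /shape -map_comp; apply: eq_map => x /=.
by rewrite size_map.
Qed.

Lemma entry_map_map (f : 'I_m -> nat) u : entry (map (map f) T) (box_of T u) = f u.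
Proof.
have lt : (row_of T u < size T)%N by rewrite -has_find (has_row hT).
rewrite /entry /= (nth_map [::]) // (nth_map u) ?(nth_box hT) //.
by rewrite index_mem (mem_row hT).
Qed.

Lemma filling_entry M M' : shape M = lam -> shape M' = lam ->
  expo M T = expo M' T -> M = M'.
Proof.
move=> sM sM' /mnmP e; apply: eq_filling; first by rewrite sM'.
rewrite sM => -[i j]; rewrite mem_boxes /= => /(box_exists hT)[u [<- <-]].
by have := e u; rewrite !mnmE.
Qed.

Lemma semistandard_SSYT a : semistandard (row_of T) (col_of T) a ->
  SSYT lam (map (map a) T) /\ expo (map (map a) T) T = a.
Proof.
move=> [h1 h2]; split; last by apply/mnmP => u; rewrite mnmE entry_map_map.
apply/and3P; split; first by rewrite shape_map_map.
  apply/allP => r /(nthP [::])[i]; rewrite size_map => lti <-.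
  apply/(sortedP 0%N) => j ltj.
  have ltj' : (j.+1 < nth 0%N lam i)%N by rewrite -(shape_map_map a) nth_shape.
  have [u [ru cu]] := box_exists hT (ltnW ltj'); have [v [rv cv]] := box_exists hT ltj'.
  have -> : nth 0%N (nth [::] (map (map a) T) i) j = a u.
    by rewrite -(entry_map_map a u) /entry /= ru cu.
  have -> : nth 0%N (nth [::] (map (map a) T) i) j.+1 = a v.
    by rewrite -(entry_map_map a v) /entry /= rv cv.
  by apply: h1; rewrite ?ru ?rv ?cu ?cv.
apply/allP=> -[i j] b2 /=; apply/implyP=> i0.
have b1 : (i.-1, j) \in boxes lam by apply: (ideal_boxes hl b2) => //=; apply: leq_pred.
rewrite mem_boxes /= in b1; rewrite mem_boxes /= in b2.
have [u [ru cu]] := box_exists hT b1; have [v [rv cv]] := box_exists hT b2.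
have := h2 u v; rewrite ru rv cu cv prednK // leqnn => /(_ erefl isT).
by rewrite -(entry_map_map a u) -(entry_map_map a v) /box_of ru rv cu cv.
Qed.

Lemma map_expo M : shape M = lam -> map (map (expo M T)) T = M.
Proof.
move=> sM; apply: filling_entry => //; first exact: shape_map_map.
by apply/mnmP => u; rewrite mnmE entry_map_map.
Qed.

Lemma expo_content M : shape M = lam -> perm_eq (expo M T) (flatten M).
Proof.
move=> sM; rewrite -[in flatten M](map_expo sM) -map_flatten.
have -> : (expo M T : seq nat) = map (expo M T) (enum 'I_m).
  by rewrite -[LHS]map_tnth_enum; apply: eq_map => i; rewrite -multinomE.
by apply: perm_map; rewrite perm_sym; case/andP: hT.
Qed.

End FillingExpo.

Lemma perm_mnm m (N : 'X_{1..m}) (s : 'S_m) : perm_eq (N#s) N.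
Proof.
have e (a : 'X_{1..m}) : (a : seq nat) = map a (enum 'I_m).
  by rewrite -[LHS]map_tnth_enum; apply: eq_map => i; rewrite -multinomE.
rewrite e (e N) (eq_map (g := N \o s)) => [|i]; last by rewrite mnmE.
rewrite map_comp; apply: perm_map; apply: uniq_perm; rewrite ?enum_uniq //.
  by rewrite map_inj_uniq ?enum_uniq //; apply: perm_inj.
move=> u; rewrite mem_enum; apply/mapP; exists (s^-1%g u); last by rewrite permKV.
by rewrite mem_enum.
Qed.

Lemma symX_content m (r c : 'I_m -> nat) a N : (symX r c a)@_N != 0 -> perm_eq N a.
Proof.
case/symX_supp => s [t [_ _ <-]]; rewrite perm_sym.
by apply: perm_trans (perm_mnm _ _) _; apply: perm_mnm.
Qed.

Section Orthogonal.
Variables (m b : nat).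

Definition orthogonal_F (g : {mpoly rat[m]}) :=
  forall lam M (T : seq (seq 'I_m)), is_part_of m lam -> SSYT lam M -> is_filling lam T ->
    dot b (F_pol M T) g = 0.

Lemma orthogonal_F_msym g s : orthogonal_F g -> orthogonal_F (msym s g).
Proof.
move=> hg lam M T hl hM hT; rewrite -[s]invgK -dot_msym F_polE msymZ msym_symX symX_F_pol.
by rewrite 2!dotZl (hg lam) ?mulr0 //; apply: filling_map.
Qed.

Lemma orthogonal_F_Asym g (c : 'I_m -> nat) : orthogonal_F g -> orthogonal_F (Asym c g).
Proof.
move=> hg lam M T hl hM hT; rewrite /Asym dot_sumr big1 // => s _.
by rewrite dotZr (orthogonal_F_msym s hg hl) ?mulr0.
Qed.

Lemma sum_swap_lt (c : 'I_m -> nat) j :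
  (#|[set u | c u == j]| < #|[set u | c u == j.+1]|)%N ->
  (\sum_u (if c u == j then j.+1 else if c u == j.+1 then j else c u) < \sum_u c u)%N.
Proof.
move=> h.
have e (f : 'I_m -> nat) : (\sum_u f u = \sum_(u | c u == j) f u + (\sum_(u | c u == j.+1) f u +
    \sum_(u | (c u != j) && (c u != j.+1)) f u))%N.
  rewrite (bigID (fun u => c u == j)) /=; congr (_ + _)%N.
  rewrite (bigID (fun u => c u == j.+1)) /=; congr (_ + _)%N.
  by apply: eq_bigl => u; case: (c u =P j) => // ->; rewrite (ltn_eqF (ltnSn j)).
rewrite (e c) [X in (X < _)%N]e.
rewrite (eq_bigr (fun=> j.+1)) => [|u ->] //.
rewrite [X in (_ + (X + _) < _)%N](eq_bigr (fun=> j)) => [|u /eqP->]; last first.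
  by rewrite eqxx (gtn_eqF (ltnSn j)).
rewrite [X in (_ + (_ + X) < _)%N](eq_bigr c) => [|u /andP[/negbTE-> /negbTE->]] //.
rewrite [X in (_ < X + _)%N](eq_bigr (fun=> j)) => [|u /eqP->] //.
rewrite [X in (_ < _ + (X + _))%N](eq_bigr (fun=> j.+1)) => [|u /eqP->] //.
rewrite !sum_nat_cond_const; move: h; move: #|_| #|_| (bigop _ _ _) => x y z.
by rewrite !mulnS; lia.
Qed.

Lemma orthogonal_F_Asym0 (c : 'I_m -> nat) g : (msize g <= b)%N -> orthogonal_F g ->
  Asym c g = 0.
Proof.
have [n] := ubnP (\sum_u c u)%N; elim: n c g => // n IH c g lt sg hg.
have sf : (msize (Asym c g) <= b)%N by apply: leq_trans (msize_Asym _ _) sg.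
have hf := orthogonal_F_Asym c hg.
have [/existsP[u hu]|/existsPn dec] := boolP [exists u : 'I_m,
    if c u is j.+1 then (#|[set v | c v == j]| < #|[set v | c v == j.+1]|)%N else false].
  case ej : (c u) hu => [//|j] hu.
  pose c' v := if c v == j then j.+1 else if c v == j.+1 then j else c v.
  have lt' : (\sum_v c' v < \sum_v c v)%N := sum_swap_lt hu.
  have <- : Asym c' g = Asym c g.
    rewrite /Asym; apply: eq_bigl => s; apply/stabP/stabP => h v; have := h v; rewrite /c'.
      by case: (c (s v) =P j) => ?; case: (c v =P j) => ?;
        case: (c (s v) =P j.+1) => ?; case: (c v =P j.+1) => ?; lia.
    by move->.
  by apply: IH => //; apply: leq_trans lt' lt.
have [j|lam [T [hp hT hc]]] := @filling_of_columns m c.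
  have [e0|] := posnP #|[set u | c u == j.+1]|; first by rewrite e0.
  rewrite card_gt0 => /set0Pn[u]; rewrite inE => /eqP cu.
  by have := dec u; rewrite cu -leqNgt.
have hl : is_part lam by case/andP: hp.
have yo : young (row_of T) c.
  have [h1 h2] := young_filling hl hT; split=> [u v|u i j]; first by rewrite -!hc; apply: h1.
  by rewrite -hc => hi hj; have [v [rv cv]] := h2 u i j hi hj; exists v; rewrite -hc.
have ha := @anti_Asym _ c g.
have he : exchange_rel c (Asym c g).
  apply: exchange_of_recolumn => // y j ltj; apply: IH => //.
  rewrite ltnS in lt; apply: leq_trans lt; rewrite /recolumn (bigD1 y) //= eqxx [X in (_ < X)%N](bigD1 y) //=.
  rewrite -addSn leq_add //; apply: leq_sum => u /negbTE->; exact: leqnn.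
apply: (dot_eq0 sf); apply: (straighten yo (w := (\max_(N <- msupp (Asym c g)) weight c N).+1) ha he).
  by move=> N nz; rewrite ltnS; apply: leq_bigmax_seq; rewrite ?mcoeff_msupp.
move=> a sa; have sa' : semistandard (row_of T) (col_of T) a.
  by case: sa => h1 h2; split=> u v; rewrite ?hc; [apply: h1|apply: h2].
have [hM ea] := semistandard_SSYT hl hT sa'.
have -> : symX (row_of T) c a = symX (row_of T) (col_of T) a.
  by rewrite /symX; apply: eq_Asym => u; rewrite hc.
by rewrite -ea symX_F_pol dotZl (hf lam) ?mulr0.
Qed.

Lemma orthogonal_F_eq0 g : (msize g <= b)%N -> orthogonal_F g -> g = 0.
Proof.
move=> sg hg; rewrite -[RHS](@orthogonal_F_Asym0 (fun u => u : nat) g sg hg).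
rewrite /Asym (big_pred1 1%g) => [|s]; first by rewrite odd_perm1 expr0 scale1r msym1m.
apply/stabP/eqP => [h|-> u]; last by rewrite perm1.
by apply/permP => u; rewrite perm1; apply/val_inj/h.
Qed.

End Orthogonal.

(** * The Specht decomposition *)

Section Subspaces.
Variable m : nat.
Implicit Types (W : {mpoly rat[m]} -> Prop).

Definition is_subspace W :=
  [/\ W 0, forall p q, W p -> W q -> W (p + q) & forall k p, W p -> W (k *: p)].

Lemma span_subspace G : is_subspace (@Defs.span m G).
Proof.
split=> [|p q [k [c [g [hg ->]]]] [l [d [h [hh ->]]]]|a p [k [c [g [hg ->]]]]].
- by exists 0%N, (fun _ => 0), (fun _ => 0); split=> [[]//|]; rewrite big_ord0.
- exists (k + l)%N, (fun i => match split i with inl u => c u | inr u => d u end),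
    (fun i => match split i with inl u => g u | inr u => h u end).
  split=> [i|]; first by case: split.
  rewrite big_split_ord /=; congr (_ + _); apply: eq_bigr => i _.
    by case: split_ordP => j /eqP; rewrite ?eq_lshift ?eq_lrshift // => /eqP->.
  by case: split_ordP => j /eqP; rewrite ?eq_rshift ?eq_rlshift // => /eqP->.
by exists k, (fun i => a * c i), g; split=> //; rewrite scaler_sumr; apply: eq_bigr => i _; rewrite scalerA.
Qed.

Lemma span_mem (G : {mpoly rat[m]} -> Prop) p : G p -> Defs.span G p.
Proof. by move=> h; exists 1%N, (fun=> 1), (fun=> p); split=> //; rewrite big_ord1 scale1r. Qed.

Section Sums.
Variables (I : eqType) (Q : I -> Prop) (W : I -> {mpoly rat[m]} -> Prop).
Hypothesis hW : forall i, is_subspace (W i).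

(* sum_of for a Prop-valued set of indices. *)
Definition sumP (p : {mpoly rat[m]}) := exists (s : seq I) (f : I -> {mpoly rat[m]}),
  [/\ uniq s, forall i, i \in s -> Q i /\ W i (f i) & p = \sum_(i <- s) f i].

Lemma sumP0 : sumP 0.
Proof. by exists [::], (fun=> 0); split=> //; rewrite big_nil. Qed.

Lemma sumP_cons p q i : sumP p -> Q i -> W i q -> sumP (p + q).
Proof.
move=> [s [f [us hf ->]]] Qi hq; pose g j := (if j \in s then f j else 0) + (if j == i then q else 0).
exists (if i \in s then s else i :: s), g; split.
- by case: ifP => //= ->.
- move=> j hj; have [V0 VD _] := hW j.
  have Wg : W j (g j).
    rewrite /g; apply: VD; first by case: ifP => [/hf[]|].
    by case: eqP => [->|].
  split=> //; move: hj; case: ifP => _; first by case/hf.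
  by rewrite inE => /orP[/eqP->//|/hf[]].
have e : \sum_(j <- s) g j = \sum_(j <- s) f j + (if i \in s then q else 0).
  rewrite /g big_split /=; congr (_ + _).
    by rewrite big_seq [RHS]big_seq; apply: eq_bigr => j ->.
  rewrite -big_mkcond /=; case: ifP => [si|si].
    by rewrite -big_filter filter_pred1_uniq // big_seq1.
  by rewrite big_seq_cond big1 // => j /andP[js /eqP e]; rewrite -e js in si.
case: ifP => si; first by rewrite e si.
by rewrite big_cons e si addr0 /g si eqxx add0r addrC.
Qed.

Lemma sumP_mem i p : Q i -> W i p -> sumP p.
Proof. by move=> Qi hp; rewrite -[p]add0r; apply: sumP_cons hp; first exact: sumP0. Qed.

Lemma sumP_subspace : is_subspace sumP.
Proof.
split; first exact: sumP0.
  move=> p _ hp [s [f [us hf ->]]]; elim: s hf {us} => [|i s IH] hf.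
    by rewrite big_nil addr0.
  rewrite big_cons addrCA addrC; have [Qi Wi] := hf i (mem_head _ _).
  by apply: sumP_cons Qi Wi; apply: IH => j js; apply: hf; rewrite inE js orbT.
move=> k _ [s [f [us hf ->]]]; exists s, (fun i => k *: f i); split=> //.
  by move=> i /hf[Qi Wi]; split=> //; case: (hW i) => _ _; apply.
by rewrite scaler_sumr.
Qed.

End Sums.

Lemma subspace_sum (U : {mpoly rat[m]} -> Prop) (J : eqType)
    (s : seq J) (P : pred J) (F : J -> {mpoly rat[m]}) : is_subspace U ->
  (forall j, j \in s -> P j -> U (F j)) -> U (\sum_(j <- s | P j) F j).
Proof.
move=> [h0 hD _] h; rewrite big_seq_cond.
by elim/big_rec: _ => [//|j p /andP[js Pj] hp]; apply: hD => //; apply: h.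
Qed.

Lemma sumP_sub (I : eqType) (Q : I -> Prop) (W : I -> {mpoly rat[m]} -> Prop)
    (U : {mpoly rat[m]} -> Prop) p : is_subspace U ->
  (forall i q, Q i -> W i q -> U q) -> sumP Q W p -> U p.
Proof.
move=> hU h [s [f [_ hf ->]]]; apply: subspace_sum => // i /hf[Qi Wi] _; exact: h Qi Wi.
Qed.

Lemma sum_ofP (I : eqType) (A : pred I) (W : I -> {mpoly rat[m]} -> Prop) p :
  sum_of A W p <-> sumP A W p.
Proof.
split=> [[s [f [us sub hf ->]]]|[s [f [us hf ->]]]]; exists s, f; split=> //.
- by move=> i si; split; [apply: sub|apply: hf].
- by move=> i /hf[].
by move=> i /hf[].
Qed.

Lemma sum_of_subspace (I : eqType) (A : pred I) (W : I -> {mpoly rat[m]} -> Prop) :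
  (forall i, is_subspace (W i)) -> is_subspace (sum_of A W).
Proof.
move=> hW; have [h0 hD hZ] := sumP_subspace A hW.
split=> [|p q|k p]; rewrite !sum_ofP; [exact: h0|exact: hD|exact: hZ].
Qed.

End Subspaces.

Lemma V_subspace m M : is_subspace (V m M).
Proof. exact: span_subspace. Qed.

Section Spanning.
Variables (m b : nat).

(* The F_{M,T} are enumerated by a finite type, to make linear algebra available:
   the shape padded with zeros, the order of the entries of T, the exponents. *)
Definition gen_index : Type := ((m.-tuple 'I_m.+1) * {perm 'I_m} * 'X_{1..m < b})%type.

Definition gen_shape (j : gen_index) := [seq x <- map val j.1.1 | x != 0%N].
Definition gen_filling (j : gen_index) :=
  reshape (gen_shape j) [seq j.1.2 i | i <- enum 'I_m].
Definition gen_tableau (j : gen_index) : tableau := map (map (j.2 : 'X_{1..m})) (gen_filling j).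
Definition gen_ok (j : gen_index) :=
  [&& is_part_of m (gen_shape j), is_filling (gen_shape j) (gen_filling j)
    & SSYT (gen_shape j) (gen_tableau j)].
Definition gen (j : gen_index) : {mpoly rat[m]} :=
  if gen_ok j then F_pol (gen_tableau j) (gen_filling j) else 0.

Lemma gen_supp j N : (gen j)@_N != 0 -> perm_eq N (j.2 : 'X_{1..m}).
Proof.
rewrite /gen; case: ifP => [/and3P[hp hT _]|_]; last by rewrite mcoeff0 eqxx.
rewrite F_polE mcoeffZ mulf_eq0 negb_or => /andP[_ /symX_content h].
apply: perm_trans h _; rewrite (_ : expo _ _ = j.2) //.
by apply/mnmP => u; rewrite mnmE (entry_map_map hT).
Qed.

Lemma perm_mdeg (N a : 'X_{1..m}) : perm_eq N a -> mdeg N = mdeg a.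
Proof.
by move=> h; rewrite /mdeg; apply: perm_big.
Qed.

Lemma gen_cover lam M (T : seq (seq 'I_m)) : is_part_of m lam -> SSYT lam M ->
  is_filling lam T -> (mdeg (expo M T) < b)%N -> exists2 j, gen_ok j & gen j = F_pol M T.
Proof.
move=> hp hM hT lt; have /andP[hl /eqP hn] := hp.
have /andP[/eqP sT pT] := hT.
have lpos x : x \in lam -> x != 0%N.
  by move=> xl; apply: contraTneq xl => ->; case/andP: hl.
have szl : (size lam <= m)%N.
  rewrite -hn sumnE -sum1_size [X in (X <= _)%N]big_seq [X in (_ <= X)%N]big_seq.
  by apply: leq_sum => i /lpos; rewrite lt0n.
have lem x : x \in lam -> (x < m.+1)%N.
  by move=> xl; rewrite ltnS -hn sumnE (big_rem x) //= leq_addr.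
pose tl := [seq inord x | x <- lam ++ nseq (m - size lam) 0%N] : seq 'I_m.+1.
have stl : size tl == m by rewrite size_map size_cat size_nseq subnKC.
have etl : map val tl = lam ++ nseq (m - size lam) 0%N.
  rewrite -map_comp -[RHS]map_id; apply/eq_in_map => x; rewrite mem_cat mem_nseq => h /=.
  by rewrite inordK //; case/orP: h => [/lem//|/andP[_ /eqP->]].
have uT : uniq (flatten T) by rewrite (perm_uniq pT) enum_uniq.
have szT : size (flatten T) = m by rewrite (perm_size pT) size_enum_ord.
pose f (u : 'I_m) := nth u (flatten T) u.
have fE u : f u = nth u (flatten T) u by [].
have finj : injective f.
  move=> u v; rewrite /f (set_nth_default v) ?szT //.
  by move/eqP; rewrite nth_uniq ?szT // => /eqP/val_inj.
have ef : [seq perm finj i | i <- enum 'I_m] = flatten T.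
  case: m T hT sT pT uT szT f fE finj {hM lt hp hn szl lem tl stl etl hl lpos}
    => [|m'] T hT sT pT uT szT f fE finj.
    by rewrite (size0nil szT) (size0nil (size_enum_ord 0)).
  apply: (@eq_from_nth _ ord0); first by rewrite size_map size_enum_ord szT.
  move=> i; rewrite size_map size_enum_ord => lti.
  rewrite (nth_map ord0) ?size_enum_ord // permE fE nth_enum_ord //.
  by apply: set_nth_default; rewrite szT.
pose j : gen_index := (Tuple stl, perm finj, BMultinom lt).
have ej : gen_shape j = lam.
  rewrite /gen_shape /= etl filter_cat (_ : [seq x <- lam | x != 0%N] = lam); last first.
    by apply/all_filterP/allP.
  by elim: (m - size lam)%N => [|k IH] /=; rewrite ?cats0.
have eT : gen_filling j = T by rewrite /gen_filling ej /= ef -sT flattenK.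
have eM : gen_tableau j = M.
  by rewrite /gen_tableau eT /= (map_expo hT) //; apply: SSYT_shape hM.
have ok : gen_ok j by rewrite /gen_ok ej eT eM hp hT hM.
by exists j; rewrite // /gen ok eT eM.
Qed.

Lemma F_span_gen (p : {mpoly rat[m]}) : (msize p <= b)%N ->
  exists D : gen_index -> rat, p = \sum_j D j *: gen j.
Proof.
move=> sp.
pose X := ('X_{1..m < b} : finType); pose J := (gen_index : finType).
pose A : 'M[rat]_(#|J|, #|X|) :=
  \matrix_(i, k) (gen (enum_val i))@_(enum_val k : 'X_{1..m < b}).
pose v : 'rV[rat]_#|X| := \row_k p@_(enum_val k : 'X_{1..m < b}).
have [/submxP[D eD]|] := boolP (v <= A)%MS.
  exists (fun j => D 0 (enum_rank (j : J))); apply/mpolyP => N.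
  rewrite raddf_sum /=; have [lt|ge] := ltnP (mdeg N) b.
    have /(congr1 (fun w : 'rV_#|X| => w 0 (enum_rank (BMultinom lt : X)))) := eD.
    rewrite !mxE enum_rankK /= => ->; rewrite (reindex (enum_val : 'I_#|J| -> J)) /=.
      by apply: eq_bigr => i _; rewrite !mxE enum_rankK mcoeffZ enum_valK.
    by exists enum_rank => x _; [apply: enum_valK|apply: enum_rankK].
  rewrite (memN_msupp_eq0 (msize_mdeg_ge (leq_trans sp ge))) big1 // => j _.
  rewrite mcoeffZ; have [->|/gen_supp/perm_mdeg e] := eqVneq ((gen j)@_N) 0; first by rewrite mulr0.
  by move: ge; rewrite e leqNgt bmdeg.
rewrite submxE => /eqP/matrixP nz.
have [k nk] : exists k, (v *m cokermx A) 0 k != 0.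
  have [/existsP[k hk]|/existsPn h] := boolP [exists k, (v *m cokermx A) 0 k != 0].
    by exists k.
  by case: nz => i k; rewrite ord1 [RHS]mxE; apply/eqP; have := h k; rewrite negbK.
pose g : {mpoly rat[m]} := \sum_(N : X) cokermx A (enum_rank N) k *: 'X_[(N : 'X_{1..m < b})].
have gE (N : X) : g@_(N : 'X_{1..m < b}) = cokermx A (enum_rank N) k.
  rewrite raddf_sum (bigD1 N) //= mcoeffZ mcoeffX eqxx mulr1 big1 ?addr0 // => N' ne.
  by rewrite mcoeffZ mcoeffX -bmeqP (negbTE ne) mulr0.
have dotE q : dot b q g = \sum_(i < #|X|) q@_(enum_val i : 'X_{1..m < b}) * cokermx A i k.
  rewrite /dot (reindex (enum_val : 'I_#|X| -> X)) /=.
    by apply: eq_bigr => i _; rewrite gE enum_valK.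
  by exists enum_rank => x _; [apply: enum_valK|apply: enum_rankK].
have g0 : g = 0.
  apply: (@orthogonal_F_eq0 m b).
    apply: msize_le_sum => N _; apply: leq_trans (msizeZ_le _ _) _.
    by rewrite msizeX bmdeg.
  move=> lam M T hp hM hT; have [lt|ge] := ltnP (mdeg (expo M T)) b.
    have [j _ <-] := gen_cover hp hM hT lt; rewrite dotE.
    transitivity ((A *m cokermx A) (enum_rank (j : J)) k); last by rewrite mulmx_coker mxE.
    by rewrite [RHS]mxE; apply: eq_bigr => i _; congr (_ * _); rewrite mxE enum_rankK.
  rewrite /dot big1 // => N _; rewrite F_polE mcoeffZ.
  have [->|/symX_content/perm_mdeg e] := eqVneq ((symX (row_of T) (col_of T) (expo M T))@_N) 0.
    by rewrite mulr0 mul0r.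
  by move: ge; rewrite -e leqNgt bmdeg.
case/eqP: nk; rewrite mxE -[RHS](dot0l b p) dotC -g0 dotE.
by apply: eq_bigr => i _; congr (_ * _); rewrite mxE.
Qed.

End Spanning.

Lemma V_content m M (p : {mpoly rat[m]}) N : V m M p -> p@_N != 0 -> perm_eq N (flatten M).
Proof.
move=> [k [d [f [hf ->]]]]; rewrite raddf_sum => nz.
have /existsP[i hi] : [exists i, (d i *: f i)@_N != 0].
  apply: contraR nz => /existsPn h; apply/eqP; apply: big1 => i _.
  by have := h i; rewrite negbK => /eqP.
have [T [hT e]] := hf i; move: hi.
rewrite e F_polE !mcoeffZ !mulf_eq0 !negb_or => /and3P[_ _ /symX_content h].
by apply: perm_trans h _; apply: (@expo_content _ (shape M)).
Qed.

Definition supported m (P : pred (seq nat)) (p : {mpoly rat[m]}) :=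
  forall N : 'X_{1..m}, p@_N != 0 -> P N.

Lemma supportedP m (P : pred (seq nat)) (p : {mpoly rat[m]}) :
  (forall s t, perm_eq s t -> P s = P t) ->
  supported P p <-> sumP (fun M => all_SSYT m M /\ P (flatten M)) (V m) p.
Proof.
move=> hP; split; last first.
  move=> [s [f [_ hf ->]]] N; rewrite raddf_sum => nz.
  have /hasP[M sM hM] : has (fun M => (f M)@_N != 0) s.
    apply: contraR nz => /hasPn h; rewrite big_seq; apply/eqP; apply: big1 => M /h.
    by rewrite negbK => /eqP.
  have [[_ PM] VM] := hf M sM; by rewrite (hP _ _ (V_content VM hM)).
move=> hp; have [D eD] := F_span_gen (leqnn (msize p)).
have -> : p = \sum_(j <- enum {: gen_index m (msize p)} | P (j.2 : 'X_{1..m})) D j *: gen j.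
  have gz (j : gen_index m (msize p)) (N : 'X_{1..m}) : P N != P (j.2 : 'X_{1..m}) -> (D j *: gen j)@_N = 0.
    move=> ne; rewrite mcoeffZ; have [->|/gen_supp/hP e] := eqVneq ((gen j)@_N) 0.
      by rewrite mulr0.
    by rewrite e eqxx in ne.
  apply/mpolyP => N; rewrite big_enum_cond raddf_sum /=.
  have [PN|PN] := boolP (P N).
    rewrite {1}eD raddf_sum (bigID (fun j : gen_index _ _ => P (j.2 : 'X_{1..m}))) /=.
    by rewrite [X in _ + X]big1 ?addr0 // => j /negbTE nj; apply: gz; rewrite PN nj.
  have /eqP -> : p@_N == 0 by apply: contraNT PN => /hp.
  by rewrite big1 // => j Pj; apply: gz; rewrite Pj (negbTE PN).
apply: subspace_sum => [|j _ Pj]; first by apply: sumP_subspace => M; apply: V_subspace.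
rewrite /gen; case: ifP => [/and3P[hl hT hM]|_]; last by rewrite scaler0; apply: sumP0.
have sM := SSYT_shape hM; apply: (sumP_mem (@V_subspace m) (i := gen_tableau j)).
  split; first by rewrite /all_SSYT sM hl hM.
  have := expo_content hT sM; rewrite (_ : expo _ _ = j.2) => [/hP <-//|].
  by apply/mnmP => u; rewrite mnmE (entry_map_map hT).
have [_ _ hZ] := V_subspace m (gen_tableau j); apply: hZ; apply: span_mem.
by exists (gen_filling j); rewrite sM.
Qed.

Section Young.
Variables (m : nat) (lam : seq nat) (T : seq (seq 'I_m)).
Hypotheses (hl : is_part lam) (hT : is_filling lam T).
Let r := row_of T.
Let c := col_of T.

Lemma sum_row_preim (r' : 'I_m -> nat) (g : 'S_m) : (\sum_u r' (g u) = \sum_u r' u)%N.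
Proof. by rewrite [RHS](reindex_inj (@perm_inj _ g)). Qed.

Lemma symmetrizers_shape lam' (T' : seq (seq 'I_m)) q : is_part lam' -> is_filling lam' T' ->
  lam != lam' -> Asym c (Sym r (Asym (col_of T') (Sym (row_of T') q))) = 0.
Proof.
move=> hl' hT' ne; set r' := row_of T'; set c' := col_of T'.
have yo := young_filling hl hT; have yo' := young_filling hl' hT'.
have [/existsP[u /existsP[v /and3P[uv /eqP ruv /eqP cuv]]]|/existsPn no1] :=
    boolP [exists u, exists v, [&& u != v, r u == r v & c' u == c' v]].
  by rewrite (Sym_Asym0 _ uv cuv ruv) linear0.
have [|le1 eq1] := @young_sum_row m r' c' r yo'.
  move=> u v uv cuv; have := no1 u; rewrite negb_exists => /forallP/(_ v).
  by rewrite uv cuv eqxx andbT.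
rewrite {1}/Sym linear_sum big1 // => t _ /=.
rewrite [X in msym t X]/Asym (raddf_sum (msym t)) linear_sum big1 // => s _ /=.
rewrite msymZ linearZ /= -msymMm msym_SymJ.
have [/existsP[u /existsP[v /and3P[uv /eqP ruv /eqP cuv]]]|/existsPn no2] :=
    boolP [exists u, exists v, [&& u != v, r' ((s * t)^-1%g u) == r' ((s * t)^-1%g v) & c u == c v]].
  by rewrite (@Asym_Sym0 _ c _ _ u v) ?scaler0.
have [|le2 eq2] := @young_sum_row m r c (fun u => r' ((s * t)^-1%g u)) yo.
  move=> u v uv cuv; have := no2 u; rewrite negb_exists => /forallP/(_ v).
  by rewrite uv cuv eqxx andbT.
rewrite sum_row_preim in le2 eq2.
have e : (\sum_u r u = \sum_u r' u)%N by apply/eqP; rewrite eqn_leq le2.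
case/eqP: ne; have [s1 _ h1] := eq2 e.
apply: (part_eq_rows (s := s1 * (s * t)^-1)%g hl hl' hT hT') => u.
by rewrite permM; apply: h1.
Qed.

Lemma scal_sum (I : Type) (s : seq I) (P : pred I) (F : I -> {mpoly rat[m]}) G :
  (forall i, P i -> exists k, F i = k *: G) -> exists k, \sum_(i <- s | P i) F i = k *: G.
Proof.
move=> h; elim/big_rec: _ => [|i p Pi [k ->]]; first by exists 0; rewrite scale0r.
by have [l ->] := h i Pi; exists (l + k); rewrite scalerDl.
Qed.

(* Von Neumann's lemma: between the two symmetrizers every permutation acts
   through a scalar. *)
Lemma symmetrizers_scalar M (T' : seq (seq 'I_m)) : is_filling lam T' ->
  exists k, Asym c (Sym r (symX (row_of T') (col_of T') (expo M T'))) = k *: symX r c (expo M T).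
Proof.
move=> hT'; rewrite /symX; set r' := row_of T'; set c' := col_of T'.
have yo := young_filling hl hT.
have [p hp] := filling_perm hl hT hT'.
rewrite {1}/Sym linear_sum; apply: scal_sum => t _ /=.
rewrite [X in msym t X]/Asym (raddf_sum (msym t)) linear_sum; apply: scal_sum => s _ /=.
rewrite msymZ linearZ /= -msymMm; move: (s * t)%g ((-1) ^+ s) => g e.
suff [k ->] : exists k, Asym c (msym g (Sym r' 'X_[expo M T'])) = k *: Asym c (Sym r 'X_[expo M T]).
  by exists (e * k); rewrite scalerA.
rewrite msym_SymJ.
have [/existsP[u /existsP[v /and3P[uv /eqP ruv /eqP cuv]]]|/existsPn no] :=
    boolP [exists u, exists v, [&& u != v, r' (g^-1%g u) == r' (g^-1%g v) & c u == c v]].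
  by exists 0; rewrite (@Asym_Sym0 _ c _ _ u v) // scale0r.
have [|_ eq] := @young_sum_row m r c (fun u => r' (g^-1%g u)) yo.
  move=> u v uv cuv; have := no u; rewrite negb_exists => /forallP/(_ v).
  by rewrite uv cuv eqxx andbT.
have [|s1 hs1 h1] := eq.
  rewrite sum_row_preim -(sum_row_preim r' p).
  by apply: eq_bigr => u _; rewrite /r' (hp u).1.
have er u : r (s1^-1%g u) = r' (g^-1%g u) by rewrite -h1 permKV.
rewrite (_ : Sym _ _ = msym s1 (Sym r 'X_[expo M T])).
  by exists ((-1) ^+ s1); rewrite Asym_msym.
rewrite msym_SymJ (eq_Sym _ er) !msymX.
pose w := (g^-1 * p^-1 * s1)%g.
have hw : w^-1%g \in stab (fun u => r' (g^-1%g u)).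
  rewrite stabV; apply/stabP => u; rewrite -!er !permM permK.
  have [e1 _] := hp (p^-1%g (g^-1%g u)); rewrite permKV in e1.
  by rewrite -[LHS]e1 er.
rewrite -[RHS](Sym_msym _ hw) msymX invgK; congr (Sym _ 'X_[_]).
apply/mnmP => u; rewrite !mnmE !permM permK.
have [e1 e2] := hp (p^-1%g (g^-1%g u)); rewrite permKV in e1 e2.
by rewrite /box_of e1 e2.
Qed.

Lemma V_symmetrizers M s p : SSYT lam M -> V m M p ->
  exists k, Asym c (Sym r (msym s p)) = k *: symX r c (expo M T).
Proof.
move=> hM [n [d [f [hf ->]]]]; rewrite (raddf_sum (msym s)) (linear_sum (Sym r)) (linear_sum (Asym c)); apply: scal_sum => i _.
have [T' [hT' ->]] := hf i; rewrite (SSYT_shape hM) in hT'.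
have [k ek] := symmetrizers_scalar M (filling_map s hT').
exists (d i * ((s_num M T')%:R^-1 * k)).
by rewrite /= msymZ F_polE msymZ msym_symX !linearZ /= ek !scalerA !mulrA.
Qed.

Lemma V_symmetrizers0 M s p : is_part (shape M) -> shape M != lam -> V m M p ->
  Asym c (Sym r (msym s p)) = 0.
Proof.
move=> hl' ne [n [d [f [hf ->]]]]; rewrite (raddf_sum (msym s)) (linear_sum (Sym r)) (linear_sum (Asym c)) big1 // => i _.
have [T' [hT' ->]] := hf i.
rewrite /= msymZ F_polE msymZ msym_symX !linearZ /=.
by rewrite (symmetrizers_shape _ hl' (filling_map s hT')) ?scaler0 // eq_sym.
Qed.

End Young.

Lemma V_eq0 m lam M p : is_part lam -> SSYT lam M -> V m M p ->
  (forall (T : seq (seq 'I_m)) s, is_filling lam T ->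
    Asym (col_of T) (Sym (row_of T) (msym s p)) = 0) -> p = 0.
Proof.
move=> hl hM hp h; have [n [d [f [hf ep]]]] := hp.
apply: (dot_eq0 (leqnn (msize p))); rewrite {3}ep dot_sumr big1 // => i _.
have [T [hT ->]] := hf i; rewrite (SSYT_shape hM) in hT.
rewrite F_polE !dotZr /symX -dot_Asym -dot_Sym.
set g := Sym _ (Asym _ p).
suff -> : g = 0 by rewrite dot0l !mulr0.
apply: (@dot_eq0 _ (msize p)).
  by apply: leq_trans (msize_Sym _ _) _; apply: msize_Asym.
have ag : Asym (col_of T) g = 0.
  rewrite /g [X in Sym _ X]/Asym (linear_sum (Sym _)) (linear_sum (Asym _)) big1 // => s _.
  by rewrite !linearZ /= h ?scaler0.
by rewrite {1}/g dot_Sym dot_Asym {1}/g Sym_Sym -/g linearZ /= ag scaler0 dotC dot0l.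
Qed.

Theorem V_direct m : direct (all_SSYT m) (V m).
Proof.
move=> Ms f uMs sub hf e0 M0 hM0.
have /andP[/andP[hl _] hM] := sub _ hM0.
apply: (V_eq0 hl hM (hf _ hM0)) => T s hT.
set r := row_of T; set c := col_of T.
have yo := young_filling hl hT.
pose E p := Asym c (Sym r (msym s p)).
pose k M := (E (f M))@_(expo M T) / (symX r c (expo M T))@_(expo M T).
have kE M : M \in Ms -> shape M = shape M0 -> E (f M) = k M *: symX r c (expo M T).
  move=> hMs sM; have /andP[_] := sub _ hMs; rewrite sM => hM'.
  have [l el] := V_symmetrizers hl hT s hM' (hf _ hMs); rewrite /k /E el mcoeffZ mulfK //.
  by apply: symX_diag_neq0 => //; apply: (SSYT_semistandard hl hT hM').
have := congr1 E e0; rewrite /E (raddf_sum (msym s)) (linear_sum (Sym r)) (linear_sum (Asym c)) !raddf0 /=.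
rewrite (bigID (fun M => shape M == shape M0)) /= [X in _ + X]big1_seq ?addr0; last first.
  move=> M /andP[ne hMs]; have /andP[/andP[hl' _] _] := sub _ hMs.
  exact: V_symmetrizers0 hl' ne (hf _ hMs).
rewrite big_seq_cond (eq_bigr (fun M => k M *: symX r c (expo M T))); last first.
  by move=> M /andP[hMs /eqP sM]; apply: kE.
rewrite -big_seq_cond -big_filter => ez.
have k0 : k M0 = 0.
  apply: (symX_free (a := fun M => expo M T) yo (filter_uniq _ uMs) _ _ ez).
  - move=> M; rewrite mem_filter => /andP[/eqP sM /sub /andP[_]]; rewrite sM.
    exact: SSYT_semistandard.
  - move=> M M'; rewrite !mem_filter => /andP[/eqP sM _] /andP[/eqP sM' _].
    move=> /= e; exact: (filling_entry hT sM sM' e).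
  by rewrite mem_filter eqxx.
by rewrite -/(E (f M0)) kE // k0 scale0r.
Qed.

(** * Extension and lower enlargement *)

Section Direct.
Variables (m : nat) (K : eqType) (A : pred K) (W : K -> subspace m).
Hypotheses (hW : forall x, is_subspace (W x)) (hA : direct A W).

Lemma direct_reindex (J : eqType) (A' : pred J) (g : J -> K) :
  (forall j, A' j -> A (g j)) -> {in A' &, injective g} -> direct A' (fun j => W (g j)).
Proof.
move=> gA inj s f us sub hf e0 j hj.
have injs : {in s &, injective g} by move=> x y /sub hx /sub hy; apply: inj.
pose F x := \sum_(i <- s | g i == x) f i.
have FE i : i \in s -> F (g i) = f i.
  move=> si; rewrite /F -big_filter (@eq_in_filter _ _ (pred1 i)) ?filter_pred1_uniq ?big_seq1 //.
  by move=> k ks /=; apply/eqP/eqP => [|->//]; apply: injs.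
rewrite -(FE j hj); apply: (hA (s := [seq g i | i <- s])) => //.
- by rewrite map_inj_in_uniq.
- by move=> _ /mapP[i /sub si ->]; apply: gA.
- by move=> _ /mapP[i si ->]; rewrite FE //; apply: hf.
- by rewrite big_map big_seq (eq_bigr f) -?big_seq // => i /FE.
exact: map_f.
Qed.

End Direct.

Lemma seq_choice (I : eqType) (Y : Type) (P : I -> Y -> Prop) (s : seq I) (y0 : Y) :
  (forall i, i \in s -> exists y, P i y) -> exists phi, forall i, i \in s -> P i (phi i).
Proof.
elim: s => [|i s IH] h; first by exists (fun=> y0).
have [|phi hphi] := IH; first by move=> j js; apply: h; rewrite inE js orbT.
have [y hy] := h i (mem_head _ _).
exists (fun j => if j == i then y else phi j) => j; rewrite inE.
by case: eqP => [-> _|_ /hphi].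
Qed.

Lemma direct_nested m (K I J : eqType) (A : pred K) (W : K -> subspace m)
    (A' : pred I) (B : I -> pred J) (g : I -> J -> K) :
  (forall x, is_subspace (W x)) -> direct A W ->
  (forall i j, A' i -> B i j -> A (g i j)) ->
  (forall i j i' j', A' i -> B i j -> A' i' -> B i' j' -> g i j = g i' j' -> i = i' /\ j = j') ->
  direct A' (fun i => sum_of (B i) (fun j => W (g i j))).
Proof.
move=> hW hA gA inj s f us sub hf e0.
have [|phi hphi] := @seq_choice I (seq J * (J -> {mpoly rat[m]}))
  (fun i y => [/\ uniq y.1, {subset y.1 <= B i}, forall j, j \in y.1 -> W (g i j) (y.2 j)
    & f i = \sum_(j <- y.1) y.2 j]) s ([::], fun=> 0).
  by move=> i /hf[t [h [ut st ht e]]]; exists (t, h).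
pose L := [seq (i, j) | i <- s, j <- (phi i).1].
have uL : uniq L.
  apply: allpairs_uniq_dep => // [i /hphi[]//|[i j] [k l] _ _ /= [-> ->]] //.
pose A2 := [pred p : I * J | A' p.1 && B p.1 p.2].
have LA p : p \in L -> [/\ p.1 \in s, A2 p & p.2 \in (phi p.1).1].
  case/allpairsPdep=> i [j [is_ js ->]]; split=> //=.
  by apply/andP; split; [apply: sub|have [_ sB _ _] := hphi i is_; apply: sB].
have D2 : direct A2 (fun p => W (g p.1 p.2)).
  apply: (direct_reindex hA (g := fun p => g p.1 p.2)) => [p /andP[]|]; first exact: gA.
  move=> [i j] [k l] /andP[/= h1 h2] /andP[/= h3 h4] e.
  by have [-> ->] := inj _ _ _ _ h1 h2 h3 h4 e.
have z p : p \in L -> (phi p.1).2 p.2 = 0.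
  apply: (D2 L (fun p => (phi p.1).2 p.2)) => //.
  - by move=> q /LA[].
  - by move=> q /LA[qs _ q2]; have [_ _ h _] := hphi _ qs; apply: h.
  rewrite -[RHS]e0 big_allpairs_dep /= big_seq [RHS]big_seq; apply: eq_bigr => i is_.
  by have [_ _ _ ->] := hphi i is_.
move=> i is_; have [_ _ _ ->] := hphi i is_; rewrite big_seq big1 // => j js.
by apply: (z (i, j)); apply/allpairsPdep; exists i, j.
Qed.

Lemma sumP_iff m (I : eqType) (Q Q' : I -> Prop) (W : I -> subspace m) p :
  (forall i, Q i <-> Q' i) -> sumP Q W p <-> sumP Q' W p.
Proof.
by move=> h; split=> -[s [f [us hf ->]]]; exists s, f; split=> // i /hf[/h ? ?].
Qed.

Lemma sumP_nested m (K I J : eqType) (W : K -> subspace m)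
    (A' : pred I) (B : I -> pred J) (g : I -> J -> K) p : (forall x, is_subspace (W x)) ->
  sum_of A' (fun i => sum_of (B i) (fun j => W (g i j))) p <->
  sumP (fun x => exists i j, [/\ A' i, B i j & x = g i j]) W p.
Proof.
move=> hW; rewrite sum_ofP; split.
  apply: sumP_sub => [|i q Ai]; first exact: sumP_subspace.
  rewrite sum_ofP; apply: sumP_sub => [|j q' Bj Wq]; first exact: sumP_subspace.
  by apply: sumP_mem Wq => //; exists i, j.
have hU i : is_subspace (sum_of (B i) (fun j => W (g i j))).
  by apply: sum_of_subspace.
apply: sumP_sub => [|x q [i [j [Ai Bj ->]]] Wq]; first exact: sumP_subspace.
by apply: (sumP_mem hU Ai); apply/sum_ofP; apply: (@sumP_mem _ _ _ (fun j => W (g i j)) _ j).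
Qed.

Section Decompose.
Variables (m : nat).
Local Notation Vm := (V m).
Local Notation Am := (all_SSYT m).

Lemma supported_sumP (Q : tableau -> Prop) (P : pred (seq nat)) p :
  (forall s t, perm_eq s t -> P s = P t) ->
  sumP Q Vm p /\ supported P p <-> sumP (fun M => Q M /\ P (flatten M)) Vm p.
Proof.
move=> hP; split=> [[[s [f [us hf ->]]] sP]|[s [f [us hf ep]]]].
  have -> : \sum_(M <- s) f M = \sum_(M <- [seq M <- s | P (flatten M)]) f M.
    have fz M (N : 'X_{1..m}) : M \in s -> P (flatten M) != P N -> (f M)@_N = 0.
      move=> /hf[_ VM] ne; apply/eqP; apply: contraNT ne => nz.
      by rewrite (hP _ _ (V_content VM nz)).
    rewrite big_filter; apply/mpolyP => N; have [PN|PN] := boolP (P N).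
      rewrite (bigID (fun M => P (flatten M))) /= mcoeffD [X in _ + X]raddf_sum.
      rewrite [X in _ + X]big1_seq ?addr0 // => M /andP[/negbTE nM Ms].
      by apply: fz => //; rewrite PN nM.
    have /eqP -> : (\sum_(M <- s) f M)@_N == 0 by apply: contraNT PN => /sP.
    rewrite raddf_sum big1_seq // => M /andP[PM Ms].
    by apply: fz => //; rewrite PM (negbTE PN).
  exists [seq M <- s | P (flatten M)], f; split=> //; first exact: filter_uniq.
  by move=> M; rewrite mem_filter => /andP[PM /hf[QM VM]].
split; first by exists s, f; split=> // M /hf[[QM _] VM].
move=> N; rewrite ep raddf_sum => nz.
have /hasP[M sM hM] : has (fun M => (f M)@_N != 0) s.
  apply: contraR nz => /hasPn h; rewrite big_seq; apply/eqP; apply: big1 => M /h.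
  by rewrite negbK => /eqP.
by have [[_ PM] VM] := hf M sM; rewrite (hP _ _ (V_content VM hM)).
Qed.

Lemma direct_sum3_sumP (U A B C : subspace m) (Q Q1 Q2 Q3 : tableau -> Prop) :
  (forall M, Q M -> Am M) ->
  (forall M, Q M <-> [\/ Q1 M, Q2 M | Q3 M]) ->
  (forall M, Q1 M -> Q2 M -> False) -> (forall M, Q1 M -> Q3 M -> False) ->
  (forall M, Q2 M -> Q3 M -> False) ->
  (forall p, U p <-> sumP Q Vm p) -> (forall p, A p <-> sumP Q1 Vm p) ->
  (forall p, B p <-> sumP Q2 Vm p) -> (forall p, C p <-> sumP Q3 Vm p) ->
  direct_sum3 U A B C.
Proof.
move=> QA Qor n12 n13 n23 eU eA eB eC.
have hV := @V_subspace m.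
have sub1 M : Q1 M -> Q M by move=> h; apply/Qor; constructor 1.
have sub2 M : Q2 M -> Q M by move=> h; apply/Qor; constructor 2.
have sub3 M : Q3 M -> Q M by move=> h; apply/Qor; constructor 3.
split=> [p|a b c].
  rewrite eU; split=> [[s [f [_ hf ->]]]|[a [b [c [/eA ha /eB hb /eC hc ->]]]]].
    elim: s hf => [|M s IH] hf.
      exists 0, 0, 0; split; [apply/eA|apply/eB|apply/eC|by rewrite big_nil !addr0]; exact: sumP0.
    have [|a [b [c [ha hb hc e]]]] := IH; first by move=> N Ns; apply: hf; rewrite inE Ns orbT.
    have [/Qor QM VM] := hf M (mem_head _ _); rewrite big_cons e.
    case: QM => QM.
    - exists (a + f M), b, c; split=> //; last by rewrite !addrA (addrC (f M)).
      by apply/eA; apply: (sumP_cons hV _ QM VM); apply/eA.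
    - exists a, (b + f M), c; split=> //; last by rewrite !addrA (addrC (f M)) (addrAC a).
      by apply/eB; apply: (sumP_cons hV _ QM VM); apply/eB.
    exists a, b, (c + f M); split=> //; last by rewrite addrC !addrA.
    by apply/eC; apply: (sumP_cons hV _ QM VM); apply/eC.
  have [_ hD _] := sumP_subspace Q hV.
  have w Q' q : (forall M, Q' M -> Q M) -> sumP Q' Vm q -> sumP Q Vm q.
    by move=> h; apply: sumP_sub => [|M q' /h QM]; [exact: sumP_subspace|apply: sumP_mem].
  exact: (hD _ _ (hD _ _ (w _ _ sub1 ha) (w _ _ sub2 hb)) (w _ _ sub3 hc)).
move=> /eA[s1 [f1 [u1 h1 ->]]] /eB[s2 [f2 [u2 h2 ->]]] /eC[s3 [f3 [u3 h3 ->]]] e0.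
pose f M := if M \in s1 then f1 M else if M \in s2 then f2 M else f3 M.
have d12 M : M \in s2 -> M \in s1 = false.
  by move=> /h2[m2 _]; apply/negP => /h1[m1 _]; apply: n12 m1 m2.
have d13 M : M \in s3 -> M \in s1 = false.
  by move=> /h3[m3 _]; apply/negP => /h1[m1 _]; apply: n13 m1 m3.
have d23 M : M \in s3 -> M \in s2 = false.
  by move=> /h3[m3 _]; apply/negP => /h2[m2 _]; apply: n23 m2 m3.
have e1 M : M \in s1 -> f M = f1 M by rewrite /f => ->.
have e2 M : M \in s2 -> f M = f2 M by move=> h; rewrite /f (d12 _ h) h.
have e3 M : M \in s3 -> f M = f3 M by move=> h; rewrite /f (d13 _ h) (d23 _ h).
have z M : M \in s1 ++ s2 ++ s3 -> f M = 0.
  apply: (@V_direct m).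
  - rewrite !cat_uniq u1 u2 u3 /= andbT; apply/andP; split.
      apply/hasPn => N; rewrite mem_cat => /orP[/d12|/d13] /= -> //.
    by apply/hasPn => N /d23 /= ->.
  - by move=> N; rewrite !mem_cat => /or3P[/h1[/sub1/QA]|/h2[/sub2/QA]|/h3[/sub3/QA]].
  - move=> N; rewrite !mem_cat => /or3P[h|h|h].
    + by rewrite e1 //; case: (h1 _ h).
    + by rewrite e2 //; case: (h2 _ h).
    by rewrite e3 //; case: (h3 _ h).
  rewrite !big_cat /= -[RHS]e0 addrA; congr (_ + _ + _); rewrite big_seq [RHS]big_seq.
  - by apply: eq_bigr => N /e1.
  - by apply: eq_bigr => N /e2.
  by apply: eq_bigr => N /e3.
split; rewrite big_seq big1 // => M hM.
- by rewrite -e1 // z // mem_cat hM.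
- by rewrite -e2 // z // !mem_cat hM orbT.
by rewrite -e3 // z // !mem_cat hM !orbT.
Qed.

End Decompose.

Lemma pol_degP m (d : int) (p : {mpoly rat[m]}) :
  pol_deg m d p <-> supported (fun s => (sumn s)%:Z == d) p.
Proof.
have e (N : 'X_{1..m}) : sumn N = mdeg N by rewrite sumnE.
case: d => d /=.
  split=> [/dhomogP h N nz|h]; last first.
    by apply/dhomogP => N; rewrite mcoeff_msupp => /h; rewrite e => /eqP[].
  by rewrite e; apply/eqP; rewrite h // mcoeff_msupp.
split=> [->|h]; first by move=> N; rewrite mcoeff0 eqxx.
by apply/mpolyP => N; rewrite mcoeff0; apply/eqP; apply: contraT => /h.
Qed.

Lemma pol_contP m mu (p : {mpoly rat[m]}) :
  pol_cont m mu p <-> supported (fun s => perm_eq s mu) p.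
Proof.
split=> [[k [c [g [hg ->]]]] N|h].
  rewrite raddf_sum; case: (boolP (perm_eq N mu)) => // nN /eqP[]; apply: big1 => i _.
  have [a [pa ->]] := hg i; rewrite /= mcoeffZ mcoeffX; case: eqP => [e|]; last by rewrite mulr0.
  by rewrite -e pa in nN.
have [h0 hD hZ] := span_subspace (fun q : {mpoly rat[m]} => exists a : 'X_{1..m}, perm_eq a mu /\ q = 'X_[a]).
rewrite (mpolyE p); apply: subspace_sum => [|N hN _]; first exact: span_subspace.
by apply: hZ; apply: span_mem; exists N; split=> //; apply: h; rewrite -mcoeff_msupp.
Qed.

Definition lowered (P : pred (seq nat)) : pred (seq nat) :=
  fun s => all (fun h => 0 < h)%N s && P (map predn s).

Lemma mul_by_supported m (U : subspace m) (P : pred (seq nat)) p :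
  (forall q, U q <-> supported P q) -> mul_by (e_top m) U p <-> supported (lowered P) p.
Proof.
move=> hU; pose one : 'X_{1..m} := [multinom 1%N | i < m].
have eE : e_top m = 'X_[one].
  by rewrite mpolyXE_id; apply: eq_bigr => i _; rewrite mnmE expr1.
have seqE (a : 'X_{1..m}) : (a : seq nat) = map a (enum 'I_m).
  by rewrite -[LHS]map_tnth_enum; apply: eq_map => i; rewrite -multinomE.
have allE (N : 'X_{1..m}) : all (fun h => 0 < h)%N N = (one <= N)%MM.
  rewrite seqE all_map; apply/allP/mnm_lepP => h i.
    by rewrite mnmE; apply: h; rewrite mem_enum.
  by move=> _ /=; have := h i; rewrite mnmE.
have predE (N : 'X_{1..m}) : map predn N = (N - one)%MM.
  rewrite seqE [RHS]seqE -map_comp; apply: eq_map => i /=.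
  by rewrite mnmBE mnmE subn1.
split=> [[q [/hU hq ->]] N|hp].
  rewrite eE mulrC -mcoeff_msupp (perm_mem (msuppMX _ _)) => /mapP[N' + ->].
  by rewrite mcoeff_msupp /lowered allE predE lem_addr // addmC addmK => /hq.
exists (\sum_(N <- msupp p) p@_N *: 'X_[N - one]); split.
  apply/hU => N; rewrite raddf_sum => nz.
  have /hasP[N' sN hN] : has (fun N' => (p@_N' *: 'X_[rat, (N' - one)%MM])@_N != 0) (msupp p).
    apply: contraR nz => /hasPn h; rewrite big_seq; apply/eqP; apply: big1 => N' /h.
    by rewrite negbK => /eqP.
  move: hN; rewrite mcoeffZ mcoeffX; case: ((_ - _)%MM =P N) => [<-|]; last by rewrite mulr0 eqxx.
  by move=> _; rewrite -predE; have := hp N'; rewrite -mcoeff_msupp => /(_ sN) /andP[].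
rewrite mulr_sumr {1}(mpolyE p) big_seq [RHS]big_seq; apply: eq_bigr => N.
rewrite mcoeff_msupp => /hp /andP[le _]; rewrite allE in le.
by rewrite -scalerAr eE -mpolyXD addmC submK.
Qed.

Lemma SSYT_degE n d M : all_SSYT_deg n d M = all_SSYT n M && ((sumn (flatten M))%:Z == d).
Proof. by rewrite /all_SSYT_deg /SSYT_deg andbA. Qed.

Lemma SSYT_contE n mu M : all_SSYT_cont n mu M = all_SSYT n M && perm_eq (flatten M) mu.
Proof. by rewrite /all_SSYT_cont /SSYT_cont andbA. Qed.

Lemma size_SSYT k M : all_SSYT k M -> size (flatten M) = k.
Proof. by case/andP=> /andP[_ /eqP]; rewrite size_flatten. Qed.

Lemma sumn_mapS s : sumn (map S s) = (sumn s + size s)%N.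
Proof. by elim: s => //= x s ->; lia. Qed.

Lemma SSYT_deg_sub n d M : all_SSYT_deg n d M -> all_SSYT n M.
Proof. by rewrite SSYT_degE => /andP[]. Qed.

Lemma SSYT_cont_sub n mu M : all_SSYT_cont n mu M -> all_SSYT n M.
Proof. by rewrite SSYT_contE => /andP[]. Qed.

Lemma perm_sumn s t : perm_eq s t -> sumn s = sumn t.
Proof. by move=> h; rewrite !sumnE; apply: perm_big. Qed.

Lemma perm_rem0 (s eta : seq nat) : 0%N \in eta ->
  perm_eq (0%N :: s) eta = perm_eq s (rem 0%N eta).
Proof. by move=> h; rewrite (permPr (perm_to_rem h)) perm_cons. Qed.

Definition hat_image (del : bool) (A : pred tableau) (N : tableau) :=
  exists M v, [/\ A M, EC_delta M del v & N = hat_add M v].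

Section Main.
Variable n : nat.
Hypothesis n0 : (0 < n)%N.


Lemma enlarge_sumP del (A : pred tableau) p :
  sum_of A (enlarge n del) p <-> sumP (hat_image del A) (V n.+1) p.
Proof. by apply: (sumP_nested _ _ _ _ (@V_subspace n.+1)). Qed.

Lemma direct_enlarge_SSYT del (A : pred tableau) : (forall M, A M -> all_SSYT n M) ->
  direct_enlarge n del A.
Proof.
move=> hA; split.
  move=> M /hA hM; apply: (direct_reindex (@V_direct n.+1)) => [v /andP[hv _]|v v'].
    by have [] := hat_add_SSYT n0 hM hv.
  by move=> /andP[hv _] /andP[hv' _] e; have [] := hat_add_inj n0 hM hM hv hv' e.
apply: (direct_nested (@V_subspace n.+1) (@V_direct n.+1)) => [M v /hA hM /andP[hv _]|].
  by have [] := hat_add_SSYT n0 hM hv.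
move=> M v M' v' /hA hM /andP[hv _] /hA hM' /andP[hv' _] e.
by have [-> ->] := hat_add_inj n0 hM hM' hv hv' e.
Qed.

Lemma hat_image_Ext (A : pred tableau) N : (forall M, A M -> all_SSYT n M) -> hat_image true A N ->
  all_SSYT n.+1 N /\ exists2 M, A M & perm_eq (flatten N) (0%N :: flatten M).
Proof.
move=> hA [M [v [AM /andP[hv /eqP dl] ->]]].
have [h1 h2] := hat_add_SSYT n0 (hA _ AM) hv; split=> //; exists M => //.
by rewrite dl in h2.
Qed.

Lemma hat_image_LE (A : pred tableau) N : (forall M, A M -> all_SSYT n M) -> hat_image false A N ->
  all_SSYT n.+1 N /\ exists2 M, A M & perm_eq (flatten N) (0%N :: map S (flatten M)).
Proof.
move=> hA [M [v [AM /andP[hv /eqP dl] ->]]].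
have [h1 h2] := hat_add_SSYT n0 (hA _ AM) hv; split=> //; exists M => //.
by rewrite dl in h2.
Qed.

Lemma SSYT_hat_image N : all_SSYT n.+1 N -> 0%N \in flatten N ->
  exists M v del, [/\ all_SSYT n M, EC_delta M del v, N = hat_add M v &
    perm_eq (flatten N) (0%N :: if del then flatten M else map S (flatten M))].
Proof.
move=> hN z; have [M [v [hM hv ->]]] := hat_add_surj n0 hN z.
exists M, v, (delta M v); rewrite /EC_delta hv eqxx.
by have [_] := hat_add_SSYT n0 hM hv.
Qed.

Lemma hat_image_disjoint (A A' : pred tableau) N : (forall M, A M -> all_SSYT n M) ->
  (forall M, A' M -> all_SSYT n M) -> hat_image true A N -> hat_image false A' N -> False.
Proof.
move=> hA hA' [M [v [AM /andP[hv /eqP dl] ->]]] [M' [v' [AM' /andP[hv' /eqP dl'] e]]].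
have [eM ev] := hat_add_inj n0 (hA _ AM) (hA' _ AM') hv hv' e.
by rewrite eM ev dl' in dl.
Qed.

Lemma hat_image_mono del (A A' : pred tableau) N : (forall M, A M -> all_SSYT n M) ->
  hat_image del A N ->
  (forall M, A M -> perm_eq (flatten N) (0%N :: if del then flatten M else map S (flatten M)) ->
     A' M) -> hat_image del A' N.
Proof.
move=> hA [M [v [AM hv eN]]] h; exists M, v; split=> //; apply: h => //.
have /andP[hv1 /eqP dl] := hv; rewrite eN.
by have [_] := hat_add_SSYT n0 (hA _ AM) hv1; rewrite dl.
Qed.

End Main.

Theorem theorem3p25 (d n : nat) (hn : (1 <= n)%N)
    (eta : seq nat) (heta : size eta = n.+1) :
  (* (i), with the directness of the sums defining the first two summands *)
  [/\ direct_enlarge n true (all_SSYT_deg n d%:Z),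
      direct_enlarge n false (all_SSYT_deg n (d%:Z - n%:Z))
    & direct_sum3 (pol_deg n.+1 d%:Z)
        (Ext_deg n d%:Z)
        (LE_deg n (d%:Z - n%:Z))
        (mul_by (e_top n.+1) (pol_deg n.+1 (d%:Z - n%:Z - 1)))] /\
  (sumn eta = d ->
   [/\ (* (ii) *)
       0%N \in eta ->
       (forall p, (pol_cont n.+1 eta p /\ Ext_deg n d%:Z p) <->
                  Ext_cont n (rem 0%N eta) p) /\
       ((1 < count_mem 0%N eta)%N ->
        forall p, Ext_cont n (rem 0%N eta) p <-> pol_cont n.+1 eta p),
       (* (iii) *)
       0%N \in eta -> all (fun h => 0 < h)%N (rem 0%N eta) ->
       forall p, (LE_deg n (d%:Z - n%:Z) p /\ pol_cont n.+1 eta p) <->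
                 LE_cont n [seq h.-1 | h <- rem 0%N eta] p
     & (* (iv) *)
       all (fun h => 0 < h)%N eta ->
       forall p, (mul_by (e_top n.+1)
                    (pol_deg n.+1 (d%:Z - n%:Z - 1)) p /\
                  pol_cont n.+1 eta p) <->
                 mul_by (e_top n.+1)
                   (pol_cont n.+1 [seq h.-1 | h <- eta]) p]).
Proof.
have degP (k : int) s t : perm_eq s t -> ((sumn s)%:Z == k) = ((sumn t)%:Z == k).
  by move/perm_sumn->.
have contP (mu : seq nat) s t : perm_eq s t -> perm_eq s mu = perm_eq t mu.
  by move=> /permPl ->.
have lowP P : (forall s t, perm_eq s t -> P s = P t) ->
    forall s t, perm_eq s t -> lowered P s = lowered P t.
  move=> hP s t h; rewrite /lowered (perm_all _ h); congr (_ && _).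
  by apply: hP; apply: perm_map.
have lowdeg s : size s = n.+1 -> all (fun h => 0 < h)%N s ->
    ((sumn (map predn s))%:Z == d%:Z - n%:Z - 1) = ((sumn s)%:Z == d%:Z).
  move=> sz pos; have -> : sumn s = (sumn (map predn s) + n.+1)%N.
    rewrite -sz -(size_map predn) -sumn_mapS; congr sumn.
    by rewrite -map_comp -[LHS]map_id; apply/eq_in_map => x /(allP pos) /= /prednK ->.
  by apply/eqP/eqP; lia.
have subd k := @SSYT_deg_sub n k.
have hEd p : Ext_deg n d%:Z p <-> _ := @enlarge_sumP n true (all_SSYT_deg n d%:Z) p.
have hLd p : LE_deg n (d%:Z - n%:Z) p <-> _ :=
  @enlarge_sumP n false (all_SSYT_deg n (d%:Z - n%:Z)) p.
have sizeN (N : 'X_{1..n.+1}) : size N = n.+1 by rewrite size_tuple.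
split.
  split; try by apply: direct_enlarge_SSYT => // M /subd.
  apply: (@direct_sum3_sumP _ _ _ _ _
    (fun N => all_SSYT n.+1 N /\ ((sumn (flatten N))%:Z == d%:Z)) _ _
    (fun N => all_SSYT n.+1 N /\ lowered (fun s => (sumn s)%:Z == d%:Z - n%:Z - 1) (flatten N))
    _ _ _ _ _ _ hEd hLd) => [N []//|N|N|N|N|p|p].
  - split.
      move=> [hN sN]; have [z|z] := boolP (0%N \in flatten N).
        have [M [v [[] [hM hv eN pN]]]] := SSYT_hat_image hn hN z.
          constructor 1; exists M, v; split=> //.
          by rewrite SSYT_degE hM -(eqP sN) (perm_sumn pN) /= add0n.
        constructor 2; exists M, v; split=> //; rewrite SSYT_degE hM -(eqP sN) (perm_sumn pN) /= add0n.
        by rewrite sumn_mapS (size_SSYT hM); apply/eqP; lia.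
      have pos : all (fun h => 0 < h)%N (flatten N).
        by apply/allP => x xN; rewrite lt0n; apply: contraNneq z => <-.
      by constructor 3; split=> //; rewrite /lowered pos /= lowdeg // (size_SSYT hN).
    case=> [/(hat_image_Ext hn (subd _))[hN [M]]|/(hat_image_LE hn (subd _))[hN [M]]|[hN]].
    - by rewrite SSYT_degE => /andP[_ /eqP sM] pN; split=> //; rewrite (perm_sumn pN) /= add0n sM.
    - rewrite SSYT_degE => /andP[hM /eqP sM] pN; split=> //; rewrite (perm_sumn pN) /= add0n.
      by rewrite sumn_mapS (size_SSYT hM); apply/eqP; lia.
    by case/andP=> pos; rewrite lowdeg ?(size_SSYT hN).
  - move=> h1 h2; exact: (hat_image_disjoint hn (subd _) (subd _) h1 h2).
  - move=> /(hat_image_Ext hn (subd _))[_ [M _ pN]] [_ /andP[+ _]].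
    by rewrite (perm_all _ pN).
  - move=> /(hat_image_LE hn (subd _))[_ [M _ pN]] [_ /andP[+ _]].
    by rewrite (perm_all _ pN).
  - by rewrite pol_degP supportedP //; apply: degP.
  rewrite (mul_by_supported _ (@pol_degP _ _)) supportedP //.
  by apply: lowP; apply: degP.
move=> seta.
have hEc mu p : Ext_cont n mu p <-> _ := @enlarge_sumP n true (all_SSYT_cont n mu) p.
have hLc mu p : LE_cont n mu p <-> _ := @enlarge_sumP n false (all_SSYT_cont n mu) p.
have subc mu := @SSYT_cont_sub n mu.
split.
- move=> z; have seta' : sumn (rem 0%N eta) = d by rewrite -seta (perm_sumn (perm_to_rem z)).
  split=> [p|c0 p].
    rewrite pol_contP hEd hEc and_comm (supported_sumP _ _ (contP eta)); apply: sumP_iff => N.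
    split=> [[hN pN]|hN].
      apply: (hat_image_mono hn (subd _) hN) => M hM pM; rewrite SSYT_contE (subd _ _ hM) /=.
      by rewrite -(perm_rem0 _ z) -(permPl pM).
    have [_ [M]] := hat_image_Ext hn (subc _) hN.
    rewrite SSYT_contE => /andP[hM cM] pN; split; last by rewrite (permPl pN) perm_rem0.
    apply: (hat_image_mono hn (subc _) hN) => M'; rewrite SSYT_contE SSYT_degE => /andP[-> cM'] _.
    by rewrite (perm_sumn cM') seta' eqxx.
  rewrite pol_contP hEc supportedP; last exact: contP.
  apply: sumP_iff => N; split=> [hN|[hN pN]].
    have [hN' [M]] := hat_image_Ext hn (subc _) hN; rewrite SSYT_contE => /andP[_ cM] pN.
    by split=> //; rewrite (permPl pN) perm_rem0.
  have zN : 0%N \in flatten N by rewrite (perm_mem pN).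
  have [M [v [[] [hM hv eN pM]]]] := SSYT_hat_image hn hN zN.
    exists M, v; split=> //; rewrite SSYT_contE hM -(perm_rem0 _ z) /=.
    by rewrite -(permPl pM).
  move: c0; rewrite -(seq.permP pN) (seq.permP pM) /= count_map /=.
  by rewrite (eq_count (a2 := pred0)) ?count_pred0.
- move=> z pos p; rewrite pol_contP hLd hLc (supported_sumP _ _ (contP eta)).
  have sz : size (rem 0%N eta) = n by rewrite size_rem // heta.
  have es : map S [seq h.-1 | h <- rem 0%N eta] = rem 0%N eta.
    by rewrite -map_comp -[RHS]map_id; apply/eq_in_map => x /(allP pos) /= /prednK ->.
  have cE M : perm_eq (map S (flatten M)) (rem 0%N eta) =
      perm_eq (flatten M) [seq h.-1 | h <- rem 0%N eta].
    by rewrite -{1}es; apply/idP/idP; [apply: perm_map_inj succn_inj _ _|apply: perm_map].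
  apply: sumP_iff => N; split=> [[hN pN]|hN].
    apply: (hat_image_mono hn (subd _) hN) => M hM pM; rewrite SSYT_contE (subd _ _ hM) /=.
    by rewrite -cE -(perm_rem0 _ z) -(permPl pM).
  have [_ [M]] := hat_image_LE hn (subc _) hN.
  rewrite SSYT_contE -cE => /andP[hM cM] pN; split; last by rewrite (permPl pN) perm_rem0.
  apply: (hat_image_mono hn (subc _) hN) => M'; rewrite SSYT_contE SSYT_degE -cE => /andP[hM' cM'] _.
  rewrite hM' /=; have := perm_sumn cM'; rewrite sumn_mapS (size_SSYT hM').
  have := perm_sumn (perm_to_rem z); rewrite seta /= => -> <-.
  by apply/eqP; lia.
move=> pos p; rewrite (mul_by_supported _ (@pol_degP _ _)) (mul_by_supported _ (@pol_contP _ _)) pol_contP.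
have es : map S [seq h.-1 | h <- eta] = eta.
  by rewrite -map_comp -[RHS]map_id; apply/eq_in_map => x /(allP pos) /= /prednK ->.
split=> [[h1 h2] N nz|h].
  by have /andP[h3 _] := h1 N nz; rewrite /lowered h3; apply: perm_map; apply: h2.
have cont N : p@_N != 0 -> perm_eq N eta.
  move/h => /andP[hN] /(perm_map S); rewrite es -map_comp => pN.
  by rewrite -(permPr pN) (_ : map _ N = N) // -[RHS]map_id; apply/eq_in_map => x /(allP hN) /= /prednK ->.
split=> N nz; last exact: cont.
have /andP[hN _] := h N nz; rewrite /lowered hN lowdeg ?sizeN //.
by rewrite (perm_sumn (cont N nz)) seta /= eqxx.
Qed.
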